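(* Let $C_n$ be the cycle graph on $n$ vertices. Let $X$ be the number of crossings in a uniformly random embedding of $C_n$, and let $W=\frac{X-E(X)}{\sqrt{\mathrm{Var}(X)}}$. Then $$E(X)=\frac{n(n-3)}{6},\qquad \mathrm{Var}(X)=\frac{n^3}{45}+\frac{n^2}{90}-\frac{n}{3},$$ and $$d_K(W,Z)\le\frac{6270}{\sqrt n}\qquad\text{for all } n\ge 3,$$ where $Z$ is a standard normal random variable.
   Context: Let $G=(V,E)$ be a graph with vertex set $V=[n]=\{1,\dots,n\}$. For a permutation $\pi\in S_n$, the embedding $G_\pi$ is the graph on $[n]$ in which $(\pi(v),\pi(w))$ is an edge if and only if $(v,w)\in E$. A crossing in $G_\pi$ is a quadruple $(a,b,c,d)$ of vertices with $(a,b),(c,d)\in E$ and $\pi(a)>\pi(c)>\pi(b)>\pi(d)$. A uniformly random embedding of $G$ is $G_\pi$ with $\pi$ uniformly random in $S_n$. The Kolmogorov distance between real random variables is $d_K(X,Y)=\sup_{x\in\mathbb{R}}|P(X\le x)-P(Y\le x)|$.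
   Formalization: The variance formula is asserted only for n ≥ 5: it fails at n = 3 (X is constantly 0, the formula gives −3/10) and at n = 4 (true variance 2/9, the formula gives 4/15). At n = 3, where W would be 0/0, W is taken to be 0. *)

(* Defs.v *)
From mathcomp Require Import all_boot all_order all_algebra all_fingroup.
From mathcomp Require Import all_classical all_reals all_analysis.

Set Implicit Arguments.
Unset Strict Implicit.
Unset Printing Implicit Defensive.

Import Order.TTheory GRing.Theory Num.Theory.

Local Open Scope classical_set_scope.
Local Open Scope ring_scope.

(* Vertices are 0, ..., n-1 instead of 1, ..., n: crossings only depend on the
   order of the labels. For n >= 3 this relation is irreflexive and each vertex
   has exactly two neighbours. *)
Definition cycle_graph (n : nat) : rel 'I_n :=
  fun v w => (w == ordS v) || (v == ordS w).

Arguments cycle_graph : clear implicits.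

(* An edge is listed with its two endpoints in both orders; the strict
   inequalities select exactly one of the resulting quadruples for each pair of
   crossing edges. *)
Definition crossings (n : nat) (e : rel 'I_n) (s : 'S_n) :
    {set 'I_n * 'I_n * 'I_n * 'I_n} :=
  [set q | let: (a, b, c, d) := q in
    [&& e a b, e c d, (s a > s c)%N, (s c > s b)%N & (s b > s d)%N]]%SET.

(* 'S_n carries no sigma-algebra here; measurability of the fibres is
   measurability for the discrete one. *)
Definition uniform_permutation (R : realType) (d : measure_display)
    (T : measurableType d) (P : probability T R) (n : nat) (s : T -> 'S_n) :
    Prop :=
  forall t : 'S_n, measurable (s @^-1` [set t]) /\
    P (s @^-1` [set t]) = ((n`!)%:R^-1)%:E.

Definition standard_normal (R : realType) (d : measure_display)
    (T : measurableType d) (P : probability T R) (Z : {RV P >-> R}) : Prop :=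
  forall A : set R, measurable A -> distribution P Z A = normal_prob 0 1 A.

(* If the variance vanishes, division by zero makes this the zero function. *)
Definition standardization (R : realType) (d : measure_display)
    (T : measurableType d) (P : probability T R) (X : T -> R) : T -> R :=
  fun w => (X w - fine 'E_P[X]) / Num.sqrt (fine 'V_P[X]).

Definition kolmogorov_dist (R : realType)
    (d1 : measure_display) (T1 : measurableType d1) (P1 : probability T1 R)
    (d2 : measure_display) (T2 : measurableType d2) (P2 : probability T2 R)
    (X : T1 -> R) (Y : T2 -> R) : \bar R :=
  ereal_sup [set (`|P1 [set w | (X w <= x)%R] - P2 [set w | (Y w <= x)%R]|)%E
            | x in [set: R]].

(* Main.v *)
(* Stein's method for the exchangeable pair obtained by composing the random
   permutation with a random transposition. The number of chords of the
   complete graph that cross a given edge depends only on the distance of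
   its end points, and its centred version is an exact eigenfunction of the
   random transposition walk. Summing over the edges of the cycle and
   rescaling gives the linear part L of X; the rest X - E X - L has second
   moment O(n^2), against Var X ~ n^3 / 45. In Stein's equation with (L, W),
   the conditional averages of (L - L')(W - W') and |L - L'|(W - W') are
   bounded-difference functions of the permutation, so a Poincare inequality
   on S_n makes them concentrate. The solution f of Stein's equation for a
   half line has w f(w) monotone, which gives the Kolmogorov bound with no
   smoothing. For n < 30 the bound exceeds 1.

   The moments rest on one identity: of the three ways to match four points on
   a circle into two chords, exactly one crosses. *)

Require Import Defs.
From mathcomp Require Import all_boot all_order all_algebra all_fingroup.
From mathcomp Require Import zify ring lra.

Set Implicit Arguments.
Unset Strict Implicit.
Unset Printing Implicit Defensive.

Import Order.TTheory GRing.Theory Num.Theory.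

Local Open Scope ring_scope.

(** * Averages over the symmetric group and the Poincare inequality *)

(** The crossing number X is not an eigenfunction of the transposition walk, so Stein's identity is
    run on L - L' instead of W - W'. The price is E|W - L| and 1 - E[LW], both of order n^(-1/2)
    because X - EX - L is of lower order than the standard deviation of X. That fact rests on a
    cancellation: Var X, E L^2 and E[XL] all have leading term n^3/45, so these moments must be
    known to leading order with error O(n^2). Second moments of crossing indicators involve up to
    eight points. They are found without enumerating orders: multiplying the matching identity by
    another indicator and averaging gives a linear equation, and the transitivity of S_n on tuples
    of distinct vertices identifies its unknowns. Concentration of the exchange sums works since the
    mixed second difference of L along two independent transpositions is zero and that of X is
    bounded. A Lipschitz constant of order n^3, against the normalisation n * n^3, then leaves
    n^(-1/2) after the Poincare inequality. *)

Section Average.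
Variables (R : realFieldType) (n : nat).
Implicit Types (f g : 'S_n -> R) (p t : 'S_n) (a b k l : 'I_n).

Definition avg f : R := (\sum_(p : 'S_n) f p) / n`!%:R.

Lemma card_Sn_neq0 : n`!%:R != 0 :> R.
Proof. by rewrite pnatr_eq0 -lt0n fact_gt0. Qed.

Lemma eq_avg f g : f =1 g -> avg f = avg g.
Proof. by move=> fg; congr (_ / _); apply: eq_bigr. Qed.

Lemma avgD f g : avg (fun p => f p + g p) = avg f + avg g.
Proof. by rewrite /avg big_split mulrDl. Qed.

Lemma avgZ c f : avg (fun p => c * f p) = c * avg f.
Proof. by rewrite /avg -mulr_sumr mulrA. Qed.

Lemma avgZr c f : avg (fun p => f p * c) = avg f * c.
Proof. by rewrite mulrC -avgZ; apply: eq_avg => p; rewrite mulrC. Qed.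

Lemma avgN f : avg (fun p => - f p) = - avg f.
Proof. by rewrite /avg sumrN mulNr. Qed.

Lemma avgB f g : avg (fun p => f p - g p) = avg f - avg g.
Proof. by rewrite avgD avgN. Qed.

Lemma avg_const c : avg (fun=> c) = c.
Proof.
by rewrite /avg sumr_const card_Sn -[c *+ _]mulr_natr mulfK ?card_Sn_neq0.
Qed.

Lemma avg_sum (I : finType) (P : pred I) (f : I -> 'S_n -> R) :
  avg (fun p => \sum_(i | P i) f i p) = \sum_(i | P i) avg (f i).
Proof. by rewrite /avg exchange_big /= mulr_suml. Qed.

Lemma le_avg f g : (forall p, f p <= g p) -> avg f <= avg g.
Proof.
by move=> fg; rewrite /avg ler_wpM2r ?invr_ge0 ?ler0n// ler_sum.
Qed.

Lemma avg_ge0 f : (forall p, 0 <= f p) -> 0 <= avg f.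
Proof. by move=> f0; rewrite -(avg_const 0) le_avg. Qed.

Lemma ler_norm_avg f : `|avg f| <= avg (fun p => `|f p|).
Proof.
rewrite /avg normrM [`|_^-1|]ger0_norm ?invr_ge0 ?ler0n//.
by rewrite ler_wpM2r ?invr_ge0 ?ler0n// ler_norm_sum.
Qed.

Lemma avg_mulg t f : avg (fun p => f (t * p)%g) = avg f.
Proof.
by congr (_ / _); rewrite [RHS](reindex_inj (mulgI t)).
Qed.

Lemma avg_sqr_ge f : avg f ^+ 2 <= avg (fun p => f p ^+ 2).
Proof.
have: 0 <= avg (fun p => (f p - avg f) ^+ 2) by apply: avg_ge0 => p; exact: sqr_ge0.
rewrite (@eq_avg _ (fun p => f p ^+ 2 + (avg f ^+ 2 - 2 * avg f * f p))); last first.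
  by move=> p; ring.
rewrite avgD avgB avg_const avgZ; lra.
Qed.

Lemma avg_norm_le f (c : R) : 0 <= c ->
  avg (fun p => f p ^+ 2) <= c ^+ 2 -> avg (fun p => `|f p|) <= c.
Proof.
move=> c0 fc; rewrite -(@ler_pXn2r _ 2)//; last first.
  by rewrite nnegrE avg_ge0.
apply: le_trans fc; apply: le_trans (avg_sqr_ge _) _.
by apply: le_avg => p; rewrite real_normK ?num_real.
Qed.

End Average.

Section Poincare.
Variables (R : realFieldType) (n : nat).
Implicit Types (f g : 'S_n -> R) (p t : 'S_n) (a b k l : 'I_n).

(** Left multiplication acts on vertices before [p]: [tperm a b * p] is the embedding with the
    places of [a] and [b] exchanged, one step of the walk that defines the exchangeable pair. *)
Definition transp_lip (c : R) f :=
  forall a b p, `|f (tperm a b * p)%g - f p| <= c.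

Definition transp_inv (m : nat) f :=
  forall a b p, (a < m)%N -> (b < m)%N -> f (tperm a b * p)%g = f p.

(* The transpositions (k j), j <= k, represent the cosets of Sym{0..k-1} in
   Sym{0..k}: iterating over k turns f into its mean, and each step costs at most
   c^2 of second moment. *)
Definition avg_step k f p : R :=
  (\sum_(j < n | (j <= k)%N) f (tperm k j * p)%g) / k.+1%:R.

Lemma sum_ord_le_const k (x : R) : \sum_(j < n | (j <= k)%N) x = x *+ k.+1.
Proof. by rewrite -(big_ord_widen n (fun=> x) (ltn_ord k)) sumr_const card_ord. Qed.

Lemma avg_avg_step k f : avg (avg_step k f) = avg f.
Proof.
rewrite /avg_step -[RHS](@mulfK _ k.+1%:R) ?pnatr_eq0// avgZr; congr (_ / _).
rewrite avg_sum (eq_bigr (fun=> avg f)) => [|j _]; last exact: avg_mulg.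
by rewrite sum_ord_le_const mulr_natr.
Qed.

(** Transpositions are closed under conjugation: [tperm a b] moved past [tperm k j] is again a
    transposition, so every summand changes by at most [c]. *)
Lemma avg_step_lip k f c : transp_lip c f -> transp_lip c (avg_step k f).
Proof.
move=> fc a b p; rewrite /avg_step -mulrBl -sumrB normrM.
rewrite [`|_^-1|]ger0_norm ?invr_ge0 ?ler0n// ler_pdivrMr ?ltr0n//.
apply: le_trans (ler_norm_sum _ _ _) _.
rewrite mulr_natr -sum_ord_le_const; apply: ler_sum => j _.
have -> : (tperm k j * (tperm a b * p) =
   (tperm (tperm k j a) (tperm k j b)) * (tperm k j * p))%g.
  by rewrite -tpermJ conjgE tpermV -!mulgA tpermKg.
exact: fc.
Qed.

(** A transposition of {0..k} only permutes the coset representatives [tperm k j], up to a factor in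
    Sym{0..k-1} that [f] absorbs. [g1] treats the transpositions that fix [k], [g2] those that move
    it. *)
Lemma avg_step_inv k f : transp_inv k f -> transp_inv k.+1 (avg_step k f).
Proof.
move=> fk; set g := avg_step k f.
have g1 a b p : (a < k)%N -> (b < k)%N -> g (tperm a b * p)%g = g p.
  move=> ak bk; rewrite /g /avg_step; congr (_ / _).
  rewrite (reindex_inj (@perm_inj _ (tperm a b))) /=; apply: eq_big => [j|j jk].
    by case: tpermP => [->|->|//]; rewrite !(ltnW ak) ?(ltnW bk).
  rewrite -[in RHS](fk a b)//; congr f.
  have tk : tperm a b k = k by rewrite tpermD // neq_ltn ?ak ?bk.
  rewrite !mulgA; congr (_ * _)%g.
  by rewrite -{1}tk -tpermJ conjgE tpermV -!mulgA tperm2 mulg1.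
have g2 b p : (b < k)%N -> g (tperm k b * p)%g = g p.
  move=> bk; rewrite /g /avg_step; congr (_ / _).
  rewrite (reindex_inj (@perm_inj _ (tperm k b))) /=; apply: eq_big => [j|j jk].
    by case: tpermP => [->|->|//]; rewrite ?leqnn ?(ltnW bk).
  case: tpermP jk => [->|->|/eqP jk /eqP jb] jle.
  - by rewrite mulgA tperm2 mul1g tperm1 mul1g.
  - by rewrite tperm1 mul1g.
  rewrite -[in RHS](fk j b)//; last by rewrite ltn_neqAle jle andbT; apply: contra jk => /eqP/val_inj->.
  congr f; rewrite !mulgA; congr (_ * _)%g.
  have -> : tperm j b = (tperm k b ^ (tperm k j))%g.
    by rewrite tpermJ tpermL tpermD // eq_sym ?jb // neq_ltn bk ?orbT.
  by rewrite conjgE tpermV -!mulgA tperm2 mulg1.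
move=> a b p; rewrite !ltnS [(a <= _)%N]leq_eqVlt [(b <= _)%N]leq_eqVlt.
case/predU1P => [/val_inj->|ak]; case/predU1P => [/val_inj->|bk].
- by rewrite tperm1 mul1g.
- exact: g2.
- by rewrite tpermC g2.
- exact: g1.
Qed.

(** The sum of squared deviations from the mean [m] is at most that from [f p], whose terms are at
    most [c ^+ 2]. The two sums differ by k + 1 times [(m - f p) ^+ 2], which the last line uses. *)
Lemma avg_sqr_avg_step k f c : 0 <= c -> transp_lip c f ->
  avg (fun p => f p ^+ 2) <= avg (fun p => avg_step k f p ^+ 2) + c ^+ 2.
Proof.
move=> c0 fc; rewrite -(avg_avg_step k) -[c ^+ 2](@avg_const R n) -avgD; apply: le_avg => p.
set m := avg_step k f p.
have Em : m * k.+1%:R = \sum_(j < n | (j <= k)%N) f (tperm k j * p)%g.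
  by rewrite divfK // pnatr_eq0.
rewrite /avg_step ler_pdivrMr ?ltr0n//.
have : \sum_(j < n | (j <= k)%N) (f (tperm k j * p)%g - f p) ^+ 2 <= c ^+ 2 * k.+1%:R.
  rewrite mulr_natr -sum_ord_le_const; apply: ler_sum => j _.
  by rewrite -[X in X <= _]real_normK ?num_real// lerXn2r ?nnegrE.
rewrite [X in _ -> X <= _](eq_bigr (fun j => (f (tperm k j * p)%g - f p) ^+ 2 +
  (2 * f p * f (tperm k j * p)%g - f p ^+ 2))) => [|j _]; last by ring.
rewrite big_split sumrB /= -mulr_sumr sum_ord_le_const -mulr_natr -Em.
have := mulr_ge0 (sqr_ge0 (m - f p)) (ler0n R k.+1); nra.
Qed.

Fixpoint avg_iter m f : 'S_n -> R :=
  if m is m'.+1 then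
    if insub m' is Some k then avg_step k (avg_iter m' f) else avg_iter m' f
  else f.

Lemma avg_iterP m f c : 0 <= c -> (m <= n)%N -> transp_lip c f ->
  [/\ transp_lip c (avg_iter m f), transp_inv m (avg_iter m f),
      avg (avg_iter m f) = avg f &
      avg (fun p => f p ^+ 2) <= avg (fun p => avg_iter m f p ^+ 2) + m%:R * c ^+ 2].
Proof.
move=> c0 + fc; elim: m => [|m IH] mn /=.
  by split=> //; rewrite mul0r addr0.
have [flip finv favg fsqr] := IH (ltnW mn).
rewrite (insubT (fun m => (m < n)%N) mn).
split; [exact: avg_step_lip|exact: (@avg_step_inv (Ordinal mn))|by rewrite avg_avg_step|].
have := avg_sqr_avg_step (Ordinal mn) c0 flip.
rewrite -natr1 mulrDl mul1r addrCA [avg _ + c ^+ 2]addrC; move: fsqr; lra.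
Qed.

Lemma poincare f c : 0 <= c -> transp_lip c f ->
  avg (fun p => (f p - avg f) ^+ 2) <= n%:R * c ^+ 2.
Proof.
move=> c0 fc; have [_ finv favg fsqr] := avg_iterP c0 (leqnn n) fc.
have gE p : avg_iter n f p = avg f.
  have cst q : avg_iter n f q = avg_iter n f 1%g.
    have [ts -> _] := prod_tpermP q.
    elim: ts => [|t ts IH]; first by rewrite big_nil.
    by rewrite big_cons finv ?ltn_ord.
  rewrite -favg [LHS]cst -[LHS](@avg_const R n); apply: eq_avg => q; exact/esym/cst.
move: fsqr; rewrite (@eq_avg _ _ (fun p => avg_iter n f p ^+ 2) (fun=> avg f ^+ 2)) => [|p]; last first.
  by rewrite gE.
rewrite avg_const => fsqr.
rewrite (@eq_avg _ _ _ (fun p => f p ^+ 2 + (avg f ^+ 2 - 2 * avg f * f p))); last first.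
  by move=> p; ring.
rewrite avgD avgB avg_const avgZ; lra.
Qed.

End Poincare.

(** * Crossing chords and their moments *)

Definition inside (x y z : nat) : bool := (x < z < y)%N || (y < z < x)%N.
Definition outside (x y z : nat) : bool := [&& ~~ inside x y z, z != x & z != y].

Definition chords_cross (x y z w : nat) : bool :=
  inside x y z && outside x y w || outside x y z && inside x y w.

Ltac order_cases x y z w :=
  case: (ltngtP x y) => ?; case: (ltngtP x z) => ?; case: (ltngtP y z) => ?;
  try (exfalso; lia); case: (ltngtP x w) => ?; case: (ltngtP y w) => ?; try (exfalso; lia);
  case: (ltngtP z w) => ?; try (exfalso; lia); subst; rewrite ?ltnn ?eqxx //=; try (exfalso; lia).

Lemma chords_crossCl x y z w : chords_cross y x z w = chords_cross x y z w.
Proof.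
have i t : inside y x t = inside x y t by rewrite /inside orbC.
have o t : outside y x t = outside x y t by rewrite /outside i andbA andbAC -andbA.
by rewrite /chords_cross !i !o.
Qed.

Lemma chords_crossCr x y z w : chords_cross x y w z = chords_cross x y z w.
Proof. by rewrite /chords_cross orbC !(andbC (outside _ _ _)). Qed.

Lemma chords_cross_swap x y z w : chords_cross z w x y = chords_cross x y z w.
Proof. by rewrite /chords_cross /outside /inside; order_cases x y z w. Qed.

Lemma chords_cross_neq x y z w : chords_cross x y z w ->
  [/\ x != y, x != z, x != w, y != z & y != w] /\ z != w.
Proof. by rewrite /chords_cross /outside /inside; order_cases x y z w. Qed.

Lemma chords_cross_matching x b c d :
  x != b -> x != c -> x != d -> b != c -> b != d -> c != d ->
  (chords_cross x b c d + chords_cross x c b d + chords_cross x d b c = 1)%N.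
Proof. by rewrite /chords_cross /outside /inside; order_cases x b c d. Qed.

(** Crossing the chord ab means having one end on each side of it. Three points off the chord lie on
    one side, and nothing crosses, or split 2 + 1; then two of their three chords cross ab, and
    these two share one apex. *)
Lemma chords_cross_apex a b c d f :
  c != a -> c != b -> d != a -> d != b -> f != a -> f != b ->
  (2 * (chords_cross a b c d * chords_cross a b c f
      + chords_cross a b d c * chords_cross a b d f
      + chords_cross a b f c * chords_cross a b f d) =
   chords_cross a b c d + chords_cross a b c f + chords_cross a b d f)%N.
Proof.
rewrite /chords_cross /outside => -> -> -> -> -> ->; rewrite !andbT.
by case: (inside a b c) (inside a b d) (inside a b f) => [] [] [].
Qed.

Definition desc (x y z w : nat) : bool := [&& x > z, z > y & y > w]%N.

(** [desc] is the order pattern required in [crossings]. Eight quadruples list the same two chords;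
    for a crossing pair the position of the largest label and the alternation single out one of
    them. *)
Lemma chords_cross_desc x y z w :
  (chords_cross x y z w = desc x y z w + desc x y w z + desc y x z w + desc y x w z
   + (desc z w x y + desc z w y x + desc w z x y + desc w z y x) :> nat)%N.
Proof. by rewrite /chords_cross /desc /outside /inside; order_cases x y z w. Qed.

Section Transitivity.
Variables (R : realFieldType) (n : nat).

Lemma perm_extension (s1 s2 : seq 'I_n) : uniq s1 -> uniq s2 ->
  size s1 = size s2 -> exists t : 'S_n, map t s1 = s2.
Proof.
elim: s1 s2 => [|x s IH] [|y s2] //=; first by exists 1%g.
move=> /andP[xs us] /andP[ys us2] [/(IH _ us us2)[t ts]].
exists (t * tperm (t x) y)%g; rewrite permM tpermL; congr (_ :: _).
rewrite -[RHS]ts; apply/eq_in_map => z zs; rewrite permM tpermD //.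
  by rewrite (inj_eq perm_inj); apply: contra xs => /eqP->.
by apply: contra ys => /eqP->; rewrite -ts map_f.
Qed.

(** Moments at distinct vertices do not depend on the choice of the vertices. Hence an identity for
    a sum over vertices determines a single unknown average. *)
Lemma avg_transport (F : seq 'I_n -> R) (s1 s2 : seq 'I_n) :
  uniq s1 -> uniq s2 -> size s1 = size s2 ->
  avg (fun p => F (map p s1)) = avg (fun p => F (map p s2)).
Proof.
move=> u1 u2 /(perm_extension u1 u2)[t <-].
rewrite -[LHS](avg_mulg t); apply: eq_avg => p; congr F.
by rewrite -map_comp; apply: eq_map => x; rewrite permM.
Qed.

Lemma sum_notin (s : seq 'I_n) (c : R) : uniq s ->
  \sum_(x | x \notin s) c = c * (n%:R - (size s)%:R).
Proof.
move=> us; rewrite sumr_const -[c *+ _]mulr_natr; congr (_ * _).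
have /(congr1 (fun k => k%:R : R)) := cardC (mem s).
rewrite (card_uniqP us) card_ord natrD => <-.
by rewrite addrAC subrr add0r.
Qed.

Lemma sum_notin_split (s : seq 'I_n) (F : 'I_n -> R) c : c \notin s ->
  \sum_(x | x \notin s) F x = F c + \sum_(x | x \notin c :: s) F x.
Proof.
move=> cs; rewrite (bigD1 c)//=; congr (_ + _); apply: eq_bigl => x.
by rewrite inE negb_or andbC.
Qed.

End Transitivity.

Ltac solve_neq := first [assumption | rewrite eq_sym; assumption].

Ltac tperm_simp tpermE :=
  rewrite ?tpermE ?tpermL ?tpermR;
  repeat match goal with |- context[fun_of_perm (tperm ?a ?b) ?c] =>
    rewrite (@tpermD _ a b c ltac:(solve_neq) ltac:(solve_neq)) end.

Section Crossing.
Variables (R : realFieldType) (n : nat).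
Implicit Types (p t : 'S_n) (a b c d e f x : 'I_n) (Y : 'S_n -> R).

(* This is 0 as soon as two of the four vertices coincide. *)
Definition cross a b c d p : R := (chords_cross (p a) (p b) (p c) (p d))%:R.

Lemma crossCl a b c d p : cross b a c d p = cross a b c d p.
Proof. by rewrite /cross chords_crossCl. Qed.

Lemma crossCr a b c d p : cross a b d c p = cross a b c d p.
Proof. by rewrite /cross chords_crossCr. Qed.

Lemma cross_swap a b c d p : cross c d a b p = cross a b c d p.
Proof. by rewrite /cross chords_cross_swap. Qed.

Lemma cross_ge0 a b c d p : 0 <= cross a b c d p.
Proof. exact: ler0n. Qed.

Lemma cross_le1 a b c d p : cross a b c d p <= 1.
Proof. by rewrite /cross lern1 leq_b1. Qed.

Lemma cross_sqr a b c d p : cross a b c d p * cross a b c d p = cross a b c d p.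
Proof. by rewrite /cross -natrM mulnb andbb. Qed.

Lemma cross_nuniq a b c d p : ~~ uniq [:: a; b; c; d] -> cross a b c d p = 0.
Proof.
rewrite /cross; case: chords_cross (@chords_cross_neq (p a) (p b) (p c) (p d)) => //.
case/(_ isT) => -[ab ac ad bc bd] cd; rewrite /= !inE !negb_or.
have neq (x y : 'I_n) : val (p x) != val (p y) -> x != y by apply: contra => /eqP->.
by rewrite (neq _ _ ab) (neq _ _ ac) (neq _ _ ad) (neq _ _ bc) (neq _ _ bd) (neq _ _ cd).
Qed.

Lemma cross_tperm k l a b c d p : cross a b c d (tperm k l * p)%g =
  cross (tperm k l a) (tperm k l b) (tperm k l c) (tperm k l d) p.
Proof. by rewrite /cross !permM. Qed.

Lemma cross_matching x b c d p : uniq [:: x; b; c; d] ->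
  cross x b c d p + cross x c b d p + cross x d b c p = 1.
Proof.
rewrite /= !inE !negb_or => /andP[/and3P[xb xc xd] /andP[/andP[bc bd]]] /andP[cd _].
have neq (y z : 'I_n) : y != z -> val (p y) != val (p z).
  by rewrite (inj_eq val_inj) (inj_eq perm_inj).
by rewrite /cross -!natrD chords_cross_matching //; apply: neq.
Qed.

Definition tperm_fixes Y a b := forall p, Y (tperm a b * p)%g = Y p.

Lemma cross_matching_disj x b c d p : cross x b c d p * cross x c b d p = 0.
Proof.
have [u|u] := boolP (uniq [:: x; b; c; d]); last by rewrite cross_nuniq ?mul0r.
have E := cross_matching p u; have h := cross_ge0 x d b c p.
rewrite /cross -natrM mulnb.
case bE: (chords_cross (p x) (p b) _ _) => //; case cE: (chords_cross (p x) (p c) _ _) => //=.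
by move: E; rewrite {1}/cross bE {1}/cross cE /=; lra.
Qed.

(** The transpositions (b c) and (b d) carry the first matching of [cross_matching] to the other two
    and leave [Y] unchanged, so the three averages agree and add up to [avg Y]. *)
Lemma avg_third x b c d Y : uniq [:: x; b; c; d] ->
  tperm_fixes Y b c -> tperm_fixes Y b d ->
  avg (fun p => cross x b c d p * Y p) = avg Y / 3.
Proof.
move=> u Ybc Ybd; have := u.
rewrite /= !inE !negb_or => /andP[/and3P[xb xc xd] /andP[/andP[bc bd]]] /andP[cd _].
have <- : avg (fun p => cross x b c d p * Y p) * 3 = avg Y.
  rewrite -[in RHS](@eq_avg _ _ (fun p => cross x b c d p * Y p + cross x c b d p * Y p +
     cross x d b c p * Y p)) => [|p]; last by rewrite -!mulrDl cross_matching // mul1r.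
  rewrite !avgD -[X in _ = _ + X + _](avg_mulg (tperm b c)) -[X in _ = _ + _ + X](avg_mulg (tperm b d)).
  set A := avg _; have -> : A * 3 = A + A + A by ring.
  congr (_ + _ + _); apply: eq_avg => p; rewrite ?Ybc ?Ybd; congr (_ * _); tperm_simp cross_tperm => //.
  exact/esym/crossCr.
by rewrite mulfK // pnatr_eq0.
Qed.

Lemma avg_cross a b c d : uniq [:: a; b; c; d] -> avg (cross a b c d) = 1 / 3.
Proof.
move=> u; rewrite -[X in _ = X / 3](@avg_const R n) -(@avg_third a b c d (fun=> 1) u)//.
by apply: eq_avg => p; rewrite mulr1.
Qed.

(** In the average of [chords_cross_apex] the three products have equal means by symmetry, so 3A =
    (1/3 + 1/3 + 1/3) / 2. *)
Lemma avg_cross_apex a b c d f : uniq [:: a; b; c; d; f] ->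
  avg (fun p => cross a b c d p * cross a b c f p) = 1 / 6.
Proof.
move=> u.
have /= := u; rewrite !inE !negb_or => /andP[/and4P[ab ac ad af]].
move=> /andP[/and3P[bc bd bf]] /andP[/andP[cd cf]] /andP[df _].
have ne p (y z : 'I_n) : y != z -> val (p z) != val (p y).
  by rewrite (inj_eq val_inj) (inj_eq perm_inj) eq_sym.
have E p : cross a b c d p * cross a b c f p + cross a b d c p * cross a b d f p
    + cross a b f c p * cross a b f d p
    = (cross a b c d p + cross a b c f p + cross a b d f p) / 2.
  have := chords_cross_apex (ne p _ _ ac) (ne p _ _ bc) (ne p _ _ ad) (ne p _ _ bd)
    (ne p _ _ af) (ne p _ _ bf).
  move=> /(congr1 (fun k => k%:R : R)); rewrite natrM !natrD !natrM /cross; lra.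
have := eq_avg E; rewrite avgZr !avgD.
rewrite -[X in _ + X + _ = _](avg_mulg (tperm c d)) -[X in _ + _ + X = _](avg_mulg (tperm c f)).
rewrite !avg_cross /= ?inE ?negb_or ?ab ?ac ?ad ?af ?bc ?bd ?bf ?cd ?cf ?df//.
set A := avg _; set B := avg (fun p => _ (tperm c d * p)%g * _); set C := avg (fun p => _ (tperm c f * p)%g * _).
have -> : B = A by apply: eq_avg => p; tperm_simp cross_tperm.
have -> : C = A by apply: eq_avg => p; tperm_simp cross_tperm; rewrite mulrC.
lra.
Qed.

(** Multiply the matching identity for f, a, b, c by [cross a b c d]. Two of the products agree
    under the swap of a and b, and the third is [avg_cross_apex]: 2A + 1/6 = 1/3. *)
Lemma avg_cross_path a b c d f : uniq [:: a; b; c; d; f] ->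
  avg (fun p => cross a b c d p * cross b c a f p) = 1 / 12.
Proof.
move=> u.
have /= := u; rewrite !inE !negb_or => /andP[/and4P[ab ac ad af]].
move=> /andP[/and3P[bc bd bf]] /andP[/andP[cd cf]] /andP[df _].
have E p : cross a b c d p * cross b c a f p + cross a b c d p * cross a c b f p
   + cross a b c d p * cross a b c f p = cross a b c d p.
  have U : uniq [:: f; a; b; c].
    by rewrite /= !inE !negb_or !(eq_sym f) af bf cf ab ac bc.
  rewrite (cross_swap a f b c) (crossCl f a) (cross_swap b f a c) (crossCl f b).
  by rewrite (cross_swap c f a b) (crossCl f c) -!mulrDr cross_matching ?mulr1.
have := eq_avg E; rewrite !avgD avg_cross_apex// avg_cross; last first.
  by rewrite /= !inE !negb_or ab ac ad bc bd cd.
rewrite -[X in _ + X + _ = _](avg_mulg (tperm a b)).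
set A := avg _; set B := avg (fun p => _ (tperm a b * p)%g * _).
have -> : B = A by apply: eq_avg => p; tperm_simp cross_tperm; rewrite crossCl.
lra.
Qed.

Definition chord_cross_sum a b p : R := \sum_c \sum_d cross a b c d p.

End Crossing.

(** * Crossing count of a chord as a function of its length *)

Lemma sum_inside m x y : (x < y)%N -> (\sum_(z < m) inside x y z = minn m y - x.+1)%N.
Proof.
move=> xy; rewrite /inside; elim: m => [|m IH]; first by rewrite big_ord0 min0n.
rewrite big_ord_recr /= {}IH.
rewrite [(y < m < x)%N](_ : _ = false); last by apply/negbTE; lia.
by rewrite orbF; case: (ltnP x m) => xm; case: (ltnP m y) => my; rewrite /= ?addn0; lia.
Qed.

Lemma inside_outside x y z :  x != y ->
  (inside x y z + outside x y z + ((z == x :> nat) + (z == y :> nat)) = 1)%N.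
Proof.
move=> xy; rewrite /outside; case: (ltngtP z x) => [zx|xz|->]; last by rewrite /inside !ltnn (negPf xy) !andbF.
  by case: (ltngtP z y) => [zy|yz|->]; rewrite ?andbT ?andbF; [case: inside..|rewrite /inside !ltnn !andbF].
by case: (ltngtP z y) => [zy|yz|->]; rewrite ?andbT ?andbF; [case: inside..|rewrite /inside !ltnn !andbF].
Qed.

Lemma sum_outside m x y : (x < y < m)%N -> (\sum_(z < m) outside x y z = m.-1 - (y - x))%N.
Proof.
move=> /andP[xy ym].
have : (\sum_(z < m) (inside x y z + outside x y z + ((z == x :> nat) + (z == y :> nat))) = m)%N.
  rewrite -[RHS]card_ord -sum1_card; apply: eq_bigr => z _.
  by rewrite inside_outside // neq_ltn xy.
have eq1 (c : 'I_m) : (\sum_(z < m) (z == c :> nat) = 1)%N.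
  by rewrite (bigD1 c)//= eqxx big1 ?addn0// => z; rewrite -val_eqE /= => /negPf->.
rewrite !big_split /= (eq1 (Ordinal (ltn_trans xy ym))) (eq1 (Ordinal ym)) sum_inside //.
by rewrite (minn_idPr (ltnW ym)); set A := (\sum_(z < m) _)%N; lia.
Qed.

Lemma sum_chords_cross m x y : (x < y < m)%N ->
  (\sum_(z < m) \sum_(w < m) chords_cross x y z w = 2 * ((y - x).-1 * (m.-1 - (y - x))))%N.
Proof.
move=> /andP[xy ym].
rewrite (eq_bigr (fun z : 'I_m => inside x y z * (\sum_(w < m) outside x y w)
   + outside x y z * (\sum_(w < m) inside x y w)))%N => [|z _]; last first.
  rewrite !big_distrr -big_split; apply: eq_bigr => w _ /=.
  rewrite /chords_cross /outside.
  by case: (inside x y z); case: (inside x y w); case: (_ && (nat_of_ord z != y));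
    case: (_ && (nat_of_ord w != y)).
rewrite big_split /= -!big_distrl /= sum_inside // sum_outside ?xy //.
have -> : (minn m y - x.+1 = (y - x).-1)%N by rewrite (minn_idPr (ltnW ym)); lia.
by rewrite mul2n -addnn [X in (_ + X)%N]mulnC.
Qed.

Definition dist (x y : nat) : nat := (if x < y then y - x else x - y)%N.

Lemma dist_sym x y : dist x y = dist y x.
Proof. by rewrite /dist; case: ltngtP => // ->. Qed.

Section Arc.
Variable R : realFieldType.

(** The labels left of x give the distances 1..x; those right of x give 1..m-1-x, which the symmetry
    of [F] turns into x+1..m-1. *)
Lemma sum_dist (m x : nat) (F : nat -> R) : (x < m)%N ->
  (forall k, (0 < k < m)%N -> F (m - k)%N = F k) ->
  \sum_(y < m | y != x :> nat) F (dist x y) = \sum_(1 <= k < m) F k.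
Proof.
move=> xm Fm; rewrite -(big_mkord (fun y => y != x) (fun y => F (dist x y))).
rewrite (big_cat_nat (n := x)) ?(ltnW xm) //= [RHS](big_cat_nat (n := x.+1)) //=; congr (_ + _).
  rewrite big_add1 /= [RHS]big_nat_rev /= [RHS]big_nat [LHS]big_nat_cond.
  apply: eq_big => [i|i /andP[/andP[_ ix] _]]; first by case: ltngtP.
  by rewrite /dist ltnNge (ltnW ix) /= add0n subnSK.
rewrite big_ltn_cond // eqxx /= big_nat_cond (eq_bigl (fun i => x.+1 <= i < m)%N) => [|i]; last first.
  by case: (ltngtP i x) => //= _; rewrite andbT.
rewrite -big_nat big_nat_rev /= big_nat [RHS]big_nat; apply: eq_bigr => i im.
by rewrite -[RHS]Fm; [congr F; rewrite /dist; case: ltnP|]; lia.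
Qed.

(** k - 1 labels lie strictly between two labels at distance k and m - 1 - k lie outside; the factor
    2 counts both orders of the ends of the crossing chord. *)
Definition arc_cross (m k : nat) : R := 2 * (k%:R - 1) * (m%:R - 1 - k%:R).

Lemma arc_cross_sym m k : (k <= m)%N -> arc_cross m (m - k) = arc_cross m k.
Proof. by move=> km; rewrite /arc_cross natrB //; ring. Qed.

Lemma sum_arc_cross_sqr m : (0 < m)%N ->
  \sum_(1 <= k < m) arc_cross m k ^+ 2 =
  2 / 15 * (m%:R - 1) * (m%:R - 2) * (m%:R - 3) * ((m%:R - 2) ^+ 2 + 1).
Proof.
move=> m0.
have E (M : R) k : \sum_(0 <= j < k) (2 * j%:R * (M - j%:R)) ^+ 2 =
  4 * (M ^+ 2 * ((k%:R - 1) * k%:R * (2 * k%:R - 1) / 6)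
   - 2 * M * ((k%:R - 1) ^+ 2 * k%:R ^+ 2 / 4)
   + (k%:R - 1) * k%:R * (2 * k%:R - 1) * (3 * k%:R ^+ 2 - 3 * k%:R - 1) / 30).
  elim: k => [|k IH]; first by rewrite big_nil; field.
  by rewrite big_nat_recr //= {}IH -natr1; field.
rewrite big_add1 /= (eq_bigr (fun j => (2 * j%:R * ((m%:R - 2) - j%:R)) ^+ 2)) => [|j _]; last first.
  by rewrite /arc_cross -natr1; congr (_ ^+ 2); ring.
by rewrite E -[in RHS](prednK m0) -natr1 -[in LHS](prednK m0) -natr1 /=; field.
Qed.

End Arc.

Ltac split_uniq H := let H' := fresh in have H' := H; move: H'; rewrite /= ?inE ?negb_or -?andbA;
  repeat (let h := fresh "h" in case/andP => h); let h := fresh "h" in move=> h.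

Ltac solve_uniq := rewrite /= ?inE ?negb_or -?andbA;
  repeat (apply/andP; split); try done; try assumption; try (rewrite eq_sym; assumption).

Section ChordSum.
Variables (R : realFieldType) (n : nat).
Implicit Types (p t : 'S_n) (a b c d e f x : 'I_n) (Y : 'S_n -> R).
Local Notation cross := (@cross R n).
Local Notation chord_cross_sum := (@chord_cross_sum R n).

Lemma chord_cross_sumE a b p : a != b ->
  chord_cross_sum a b p = arc_cross R n (dist (p a) (p b)).
Proof.
have lt a' b' : (p a' < p b')%N -> chord_cross_sum a' b' p = arc_cross R n (dist (p a') (p b')).
  move=> ab; transitivity ((\sum_(z < n) \sum_(w < n) chords_cross (p a') (p b') z w)%N%:R : R).
    rewrite natr_sum [RHS](reindex_inj (@perm_inj _ p)); apply: eq_bigr => c _.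
    by rewrite natr_sum [RHS](reindex_inj (@perm_inj _ p)).
  have bn := ltn_ord (p b').
  rewrite sum_chords_cross ?ab ?bn // /arc_cross /dist ab !natrM mulrA; congr (_ * _ * _).
    by rewrite -subn1 natrB // subn_gt0.
  by rewrite natrB -?subn1 ?natrB //; lia.
move=> ab; have: p a != p b by rewrite (inj_eq perm_inj).
rewrite -val_eqE neq_ltn => /orP[/lt//|/lt].
by rewrite dist_sym => <-; apply: eq_bigr => c _; apply: eq_bigr => d _; rewrite crossCl.
Qed.

Lemma chord_cross_sumC a b p : chord_cross_sum b a p = chord_cross_sum a b p.
Proof. by apply: eq_bigr => c _; apply: eq_bigr => d _; rewrite crossCl. Qed.

Lemma chord_cross_sum_notin a b p : chord_cross_sum a b p =
  \sum_(c | c \notin [:: a; b]) \sum_(d | d \notin [:: c; a; b]) cross a b c d p.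
Proof.
rewrite /chord_cross_sum [RHS]big_mkcond /=; apply: eq_bigr => c _.
case: ifPn => [cab|/negPn cab].
  rewrite [RHS]big_mkcond; apply: eq_bigr => d _; case: ifPn => // /negPn dab.
  rewrite cross_nuniq //; apply: contraL dab.
  by rewrite /= !inE !negb_or => u; split_uniq u; solve_uniq.
rewrite big1 // => d _; rewrite cross_nuniq //; apply: contraL cab.
by rewrite /= !inE !negb_or => u; split_uniq u; solve_uniq.
Qed.

Lemma sum_dist_perm a p (F : nat -> R) :
  (forall k, (0 < k < n)%N -> F (n - k)%N = F k) ->
  \sum_(b | b != a) F (dist (p a) (p b)) = \sum_(1 <= k < n) F k.
Proof.
move=> Fn; rewrite -(@sum_dist R n (p a)) //.
rewrite [RHS](reindex_inj (@perm_inj _ p)) /=; apply: eq_bigl => b.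
by rewrite val_eqE (inj_eq perm_inj).
Qed.

Lemma ord_neq_gt1 a b : a != b -> (1 < n)%N.
Proof. by rewrite -val_eqE /=; have := ltn_ord a; have := ltn_ord b; lia. Qed.

Lemma natr_sub1_neq0 a b : a != b -> (n%:R - 1 : R) != 0.
Proof. by move/ord_neq_gt1 => n1; rewrite subr_eq0 pnatr_eq1 neq_ltn n1 orbT. Qed.

(** The sum over the second end point is the same for every permutation, and by transitivity its n -
    1 terms have equal averages. *)
Lemma avg_dist a b (F : nat -> R) : a != b ->
  (forall k, (0 < k < n)%N -> F (n - k)%N = F k) ->
  avg (fun p => F (dist (p a) (p b))) = (\sum_(1 <= k < n) F k) / (n%:R - 1).
Proof.
move=> ab Fn.
have n1 := natr_sub1_neq0 ab.
apply: (mulIf n1); rewrite divfK // -[RHS](@avg_const R n).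
rewrite -[RHS](@eq_avg _ _ (fun p => \sum_(c | c != a) F (dist (p a) (p c)))) => [|p]; last first.
  exact: sum_dist_perm.
rewrite avg_sum (eq_bigr (fun=> avg (fun p => F (dist (p a) (p b))))) => [|c ca].
  rewrite (eq_bigl (fun c => c \notin [:: a])) => [|c]; last by rewrite inE.
  by rewrite sum_notin.
apply: (@avg_transport R n (fun l => if l is [:: x; y] then F (dist x y) else 0) [:: a; c] [:: a; b]) => //=.
  by rewrite inE eq_sym ca.
by rewrite inE ab.
Qed.

Definition chord_mean : R := (n%:R - 2) * (n%:R - 3) / 3.
Definition chord_dev a b p : R := chord_cross_sum a b p - chord_mean.
Definition chord_var : R := (n%:R - 3) * (n%:R - 2) * n%:R * (n%:R + 1) / 45.

Lemma sum_arc_cross m : (0 < m)%N ->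
  \sum_(1 <= k < m) arc_cross R m k = (m%:R - 1) * (m%:R - 2) * (m%:R - 3) / 3.
Proof.
move=> m0; have E (M : R) k : \sum_(0 <= j < k) 2 * j%:R * (M - j%:R) =
    2 * (M * (k%:R * (k%:R - 1) / 2) - (k%:R - 1) * k%:R * (2 * k%:R - 1) / 6).
  elim: k => [|k IH]; first by rewrite big_nil; field.
  by rewrite big_nat_recr //= {}IH -natr1; field.
rewrite big_add1 /= (eq_bigr (fun j => 2 * j%:R * ((m%:R - 2) - j%:R))) => [|j _]; last first.
  by rewrite /arc_cross -natr1; ring.
by rewrite E -[in RHS](prednK m0) -natr1 -[in LHS](prednK m0) -natr1 /=; field.
Qed.

(** This vanishing row sum, valid for each permutation, is the source of the eigenfunction identity
    and of all covariances of [chord_dev]. *)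
Lemma sum_chord_dev a p : \sum_(b | b != a) chord_dev a b p = 0.
Proof.
rewrite sumrB (eq_bigr (fun b => arc_cross R n (dist (p a) (p b)))) => [|b ba]; last first.
  by rewrite chord_cross_sumE // eq_sym.
rewrite sum_dist_perm => [|k /andP[_ /ltnW kn]]; last exact: arc_cross_sym.
rewrite sum_arc_cross; last exact: leq_ltn_trans (ltn_ord a).
rewrite [X in _ - X](eq_bigl (fun c => c \notin [:: a])) => [|c]; last by rewrite inE.
by rewrite sum_notin // /chord_mean /=; field.
Qed.

Lemma avg_chord_sqr a b : a != b -> avg (fun p => chord_cross_sum a b p ^+ 2) =
  2 / 15 * (n%:R - 2) * (n%:R - 3) * ((n%:R - 2) ^+ 2 + 1).
Proof.
move=> ab; have n2 := ord_neq_gt1 ab; have n1 := natr_sub1_neq0 ab.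
rewrite (@eq_avg _ _ _ (fun p => arc_cross R n (dist (p a) (p b)) ^+ 2)) => [|p]; last first.
  by rewrite chord_cross_sumE.
rewrite (avg_dist (F := fun k => arc_cross R n k ^+ 2) ab) => [|k /andP[_ /ltnW kn]]; last first.
  by rewrite arc_cross_sym.
by rewrite sum_arc_cross_sqr 1?ltnW //; field.
Qed.

Lemma avg_chord a b : a != b -> avg (chord_cross_sum a b) = chord_mean.
Proof.
move=> ab; have n2 := ord_neq_gt1 ab; have n1 := natr_sub1_neq0 ab.
rewrite (@eq_avg _ _ _ (fun p => arc_cross R n (dist (p a) (p b)))) => [|p]; last first.
  by rewrite chord_cross_sumE.
rewrite (avg_dist ab) => [|k /andP[_ /ltnW kn]]; last by rewrite arc_cross_sym.
by rewrite sum_arc_cross 1?ltnW // /chord_mean; field.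
Qed.

Lemma avg_chord_dev_sqr a b : a != b -> avg (fun p => chord_dev a b p ^+ 2) = chord_var.
Proof.
move=> ab; rewrite (@eq_avg _ _ _ (fun p => chord_cross_sum a b p ^+ 2 + (chord_mean ^+ 2
  - 2 * chord_mean * chord_cross_sum a b p))) => [|p]; last by rewrite /chord_dev; ring.
by rewrite avgD avgB avg_const avgZ avg_chord_sqr // avg_chord // /chord_mean /chord_var; field.
Qed.

(** Expanding one factor of the known average of [chord_cross_sum a b p ^+ 2] over the crossing
    chord gives (n - 2)(n - 3) equal averages. *)
Lemma avg_cross_chord a b c d : uniq [:: a; b; c; d] ->
  avg (fun p => cross a b c d p * chord_cross_sum a b p) = 2 / 15 * ((n%:R - 2) ^+ 2 + 1).
Proof.
move=> u; split_uniq u.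
have n4 : (4 <= n)%N by have := uniq_leq_size u (fun x _ => mem_enum 'I_n x); rewrite size_enum_ord.
have N2 : (n%:R - 2 : R) != 0 by rewrite subr_eq0 eqr_nat; lia.
have N3 : (n%:R - 3 : R) != 0 by rewrite subr_eq0 eqr_nat; lia.
apply: (mulIf N2); apply: (mulIf N3); transitivity (avg (fun p => chord_cross_sum a b p ^+ 2)); last first.
  by rewrite avg_chord_sqr //; ring.
rewrite [RHS](@eq_avg _ _ _ (fun p => \sum_(c | c \notin [:: a; b]) \sum_(d | d \notin [:: c; a; b])
   cross a b c d p * chord_cross_sum a b p)) => [|p]; last first.
  rewrite expr2 {1}chord_cross_sum_notin mulr_suml; apply: eq_bigr => ? _; exact: mulr_suml.
rewrite avg_sum (eq_bigr (fun=> avg (fun p => cross a b c d p * chord_cross_sum a b p) * (n%:R - 3))); last first.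
  move=> c' c'ab; rewrite avg_sum -[3]/((size [:: c'; a; b])%:R).
  rewrite -sum_notin; last by rewrite /= c'ab inE h.
  apply: eq_bigr => d' d'ab.
  pose F l := if l is [:: x; y; z; w] then ((chords_cross x y z w)%:R * arc_cross R n (dist x y) : R) else 0.
  have E x y z w : x != y -> avg (fun p => cross x y z w p * chord_cross_sum x y p) =
      avg (fun p => F (map val (map p [:: x; y; z; w]))).
    by move=> xy; apply: eq_avg => p; rewrite chord_cross_sumE.
  rewrite !E //; apply: (avg_transport (fun l => F (map val l))) => //.
  by move: c'ab d'ab; rewrite !inE !negb_or => /andP[? ?] /and3P[? ? ?]; solve_uniq.
by rewrite sum_notin /= ?inE ?h //; ring.
Qed.

End ChordSum.

Section CrossMoments.
Variables (R : realFieldType) (n : nat).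
Implicit Types (p t : 'S_n) (a b c d e f x : 'I_n) (Y : 'S_n -> R).
Local Notation cross := (@cross R n).
Local Notation chord_cross_sum := (@chord_cross_sum R n).

(* Expanding avg_cross_chord over the end points of the second chord leaves this
   as the only unknown. *)
Lemma avg_cross_edge a b c d e f : uniq [:: a; b; c; d; e; f] ->
  avg (fun p => cross a b c d p * cross a b e f p) = 2 / 15.
Proof.
move=> u; have n6 : (6 <= n)%N.
  by have := uniq_leq_size u (fun x _ => mem_enum 'I_n x); rewrite size_enum_ord.
split_uniq u; set z := avg _.
have u4 : uniq [:: a; b; c; d] by solve_uniq.
have := avg_cross_chord R u4; set q := fun x y => avg (fun p => cross a b c d p * cross a b x y p).
have -> : avg (fun p => cross a b c d p * chord_cross_sum a b p) =
    \sum_(x | x \notin [:: a; b]) \sum_(y | y \notin [:: x; a; b]) q x y.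
  rewrite (@eq_avg _ _ _ (fun p => \sum_(x | x \notin [:: a; b]) \sum_(y | y \notin [:: x; a; b])
     cross a b c d p * cross a b x y p)) => [|p]; last first.
    by rewrite chord_cross_sum_notin mulr_sumr; apply: eq_bigr => ? _; rewrite mulr_sumr.
  by rewrite avg_sum; apply: eq_bigr => ? _; rewrite avg_sum.
have qcd : q c d = 1 / 3.
  by rewrite -(avg_cross R u4); apply: eq_avg => p; rewrite cross_sqr.
have qdc : q d c = 1 / 3.
  by rewrite -(avg_cross R u4); apply: eq_avg => p; rewrite (crossCr _ a b c) cross_sqr.
have qcy y : uniq [:: a; b; c; d; y] -> q c y = 1 / 6 by exact: avg_cross_apex.
have qdy y : uniq [:: a; b; d; c; y] -> q d y = 1 / 6.
  by move=> u'; rewrite -(avg_cross_apex R u'); apply: eq_avg => p; rewrite (crossCr _ a b c).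
have qyc y : uniq [:: a; b; c; d; y] -> q y c = 1 / 6.
  by move=> u'; rewrite -(qcy y u'); apply: eq_avg => p; rewrite (crossCr _ a b c y).
have qyd y : uniq [:: a; b; d; c; y] -> q y d = 1 / 6.
  by move=> u'; rewrite -(qdy y u'); apply: eq_avg => p; rewrite (crossCr _ a b d y).
have qxy x y : uniq [:: a; b; c; d; x; y] -> q x y = z.
  move=> u'; exact: (@avg_transport R n (fun l => if l is [:: a; b; c; d; x; y] then
     ((chords_cross a b c d)%:R * (chords_cross a b x y)%:R : R) else 0) _ _ u' u erefl).
rewrite (@sum_notin_split _ _ _ _ c); last by solve_uniq.
rewrite (@sum_notin_split _ _ [:: c; a; b] _ d); last by solve_uniq.
rewrite (@sum_notin_split _ _ [:: c; a; b] _ d); last by solve_uniq.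
rewrite (@sum_notin_split _ _ [:: d; a; b] _ c); last by solve_uniq.
rewrite qcd qdc (eq_bigr (fun=> 1 / 6)) => [|y]; last first.
  by rewrite !inE !negb_or => /and4P[? ? ? ?]; apply: qcy; solve_uniq.
rewrite sum_notin; last by solve_uniq.
rewrite (eq_bigr (fun=> 1 / 6)) => [|y]; last first.
  by rewrite !inE !negb_or => /and4P[? ? ? ?]; apply: qdy; solve_uniq.
rewrite sum_notin; last by solve_uniq.
rewrite (eq_bigr (fun=> 1 / 6 + (1 / 6 + z * (n%:R - 5)))) => [|x]; last first.
  rewrite !inE !negb_or => /and4P[? ? ? ?].
  rewrite (@sum_notin_split _ _ _ _ c); last by solve_uniq.
  rewrite (@sum_notin_split _ _ _ _ d); last by solve_uniq.
  congr (_ + (_ + _)); [by apply: qyc; solve_uniq|by apply: qyd; solve_uniq|].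
  rewrite (eq_bigr (fun=> z)) => [|y]; last first.
    by rewrite !inE !negb_or => /and5P[? ? ? ? ?]; apply: qxy; solve_uniq.
  by rewrite sum_notin //; solve_uniq.
rewrite sum_notin; last by solve_uniq.
move=> /= E.
have N4 : (n%:R - 4 : R) != 0 by rewrite subr_eq0 eqr_nat; clear -n6; lia.
have N5 : (n%:R - 5 : R) != 0 by rewrite subr_eq0 eqr_nat; clear -n6; lia.
apply: (mulIf N4); apply: (mulIf N5); move: E; clear; move: z (n%:R : R) => z N; lra.
Qed.

(** The matching identity for a, b, e, f times [cross a b c d]: 2/15 + 2A = 1/3. *)
Lemma avg_cross_edge_split a b c d e f : uniq [:: a; b; c; d; e; f] ->
  avg (fun p => cross a b c d p * cross a e b f p) = 1 / 10.
Proof.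
move=> u; split_uniq u.
have E p : cross a b c d p * cross a b e f p + cross a b c d p * cross a e b f p
   + cross a b c d p * cross a f b e p = cross a b c d p.
  by rewrite -!mulrDr cross_matching ?mulr1 //; solve_uniq.
have := eq_avg E; rewrite !avgD avg_cross_edge// avg_cross; last by solve_uniq.
rewrite -[X in _ + X = _](avg_mulg (tperm e f)).
set A := avg _; set B := avg (fun p => _ (tperm e f * p)%g * _).
have -> : B = A by apply: eq_avg => p; tperm_simp cross_tperm.
lra.
Qed.

(** The matching identity for a, c, e, f times [cross a b c d]; the product with [cross a c e f] is
    an instance of [avg_cross_edge_split], so 1/10 + 2A = 1/3. *)
Lemma avg_cross_split a b c d e f : uniq [:: a; b; c; d; e; f] ->
  avg (fun p => cross a b c d p * cross a e c f p) = 7 / 60.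
Proof.
move=> u; split_uniq u.
have E p : cross a c e f p * cross a b c d p + cross a b c d p * cross a e c f p
   + cross a b c d p * cross a f c e p = cross a b c d p.
  by rewrite (mulrC (cross a c e f p)) -!mulrDr cross_matching ?mulr1 //; solve_uniq.
have := eq_avg E; rewrite !avgD avg_cross_edge_split; last by solve_uniq.
rewrite avg_cross; last by solve_uniq.
rewrite -[X in _ + X = _](avg_mulg (tperm e f)).
set A := avg _; set B := avg (fun p => _ (tperm e f * p)%g * _).
have -> : B = A by apply: eq_avg => p; tperm_simp cross_tperm.
lra.
Qed.

End CrossMoments.

(** * Covariance of two crossing indicators *)

Section CrossCov.
Variables (R : realFieldType) (n : nat).
Implicit Types (p t : 'S_n) (a b c d e f x : 'I_n) (Y : 'S_n -> R).
Local Notation cross := (@cross R n).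

Definition overlap a b a' b' : R :=
  (a == a')%:R + (a == b')%:R + (b == a')%:R + (b == b')%:R.

(* The covariance of two crossing indicators depends only on the numbers of
   vertices shared by the four pairs of edges; this polynomial, divided by 180,
   interpolates its values. *)
Definition overlap_poly (A B C D : R) : R :=
  2 * (A * (A - 1) + B * (B - 1) + C * (C - 1) + D * (D - 1))
  - 2 * (A * B + C * D + A * C + B * D) + (A * D + B * C)
  + 2 * (A * D * (A + D - 2) + B * C * (B + C - 2))
  - 2 * (A * B * C + A * B * D + A * C * D + B * C * D)
  + 3 * (A * (A - 1) * D * (D - 1) + B * (B - 1) * C * (C - 1))
  - 6 * (A * B * C * D).

(** The distinctness conditions are part of the predicate, so that the symmetry reductions below are
    implications that can be chained. 1/9 is the product of the two means. *)
Definition cross_cov a b c d a' b' c' d' : Prop :=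
  uniq [:: a; b; c; d] -> uniq [:: a'; b'; c'; d'] ->
  180 * (avg (fun p => cross a b c d p * cross a' b' c' d' p) - 1 / 9) =
  overlap_poly (overlap a b a' b') (overlap a b c' d') (overlap c d a' b') (overlap c d c' d').

Lemma overlapCl a b a' b' : overlap b a a' b' = overlap a b a' b'.
Proof. by rewrite /overlap; ring. Qed.

Lemma overlap_tr a b a' b' : overlap a' b' a b = overlap a b a' b'.
Proof. by rewrite /overlap !(eq_sym a') !(eq_sym b'); ring. Qed.

(** This and the next six lemmas are the symmetries of a pair of crossings: exchanging the
    crossings, the two edges of one, or the ends of an edge. They reduce all coincidences of
    vertices to a few patterns. *)
Lemma cross_cov_tr a b c d a' b' c' d' :
  cross_cov a' b' c' d' a b c d -> cross_cov a b c d a' b' c' d'.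
Proof.
move=> H u u'; have {H} := H u' u; rewrite (overlap_tr a b a') (overlap_tr c d a')
  (overlap_tr a b c') (overlap_tr c d c').
rewrite (@eq_avg _ _ _ (fun p => cross a b c d p * cross a' b' c' d' p)) => [->|p]; last first.
  by rewrite mulrC.
by rewrite /overlap_poly; ring.
Qed.

Lemma cross_cov_l12 a b c d a' b' c' d' :
  cross_cov b a c d a' b' c' d' -> cross_cov a b c d a' b' c' d'.
Proof.
move=> H u u'; rewrite -!(overlapCl a b) -H //; last by split_uniq u; solve_uniq.
by congr (180 * (_ - _)); apply: eq_avg => p; rewrite crossCl.
Qed.

Lemma cross_cov_lsw a b c d a' b' c' d' :
  cross_cov c d a b a' b' c' d' -> cross_cov a b c d a' b' c' d'.
Proof.
move=> H u u'; transitivity (overlap_poly (overlap c d a' b') (overlap c d c' d')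
  (overlap a b a' b') (overlap a b c' d')); last by rewrite /overlap_poly; ring.
rewrite -H //; last by split_uniq u; solve_uniq.
by congr (180 * (_ - _)); apply: eq_avg => p; rewrite cross_swap.
Qed.

Lemma cross_cov_l34 a b c d a' b' c' d' :
  cross_cov a b d c a' b' c' d' -> cross_cov a b c d a' b' c' d'.
Proof. by move=> H; apply/cross_cov_lsw/cross_cov_l12/cross_cov_lsw. Qed.

Lemma cross_cov_r12 a b c d a' b' c' d' :
  cross_cov a b c d b' a' c' d' -> cross_cov a b c d a' b' c' d'.
Proof. by move=> H; apply/cross_cov_tr/cross_cov_l12/cross_cov_tr. Qed.

Lemma cross_cov_r34 a b c d a' b' c' d' :
  cross_cov a b c d a' b' d' c' -> cross_cov a b c d a' b' c' d'.
Proof. by move=> H; apply/cross_cov_tr/cross_cov_l34/cross_cov_tr. Qed.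

Lemma cross_cov_rsw a b c d a' b' c' d' :
  cross_cov a b c d c' d' a' b' -> cross_cov a b c d a' b' c' d'.
Proof. by move=> H; apply/cross_cov_tr/cross_cov_lsw/cross_cov_tr. Qed.

Ltac eval_eq := rewrite ?eqxx; repeat match goal with |- context[?x == ?y] =>
  let H := fresh in
  assert (H : (x == y) = false); [apply/negbTE; solve_neq | rewrite H; clear H] end.

(** Only [a] can occur in the second crossing, which is therefore fixed by the transpositions of
    [avg_third]: the indicators are uncorrelated. The polynomial vanishes too, since at most one
    overlap is nonzero, and it equals 1. *)
Lemma cross_cov_disjoint a b c d a' b' c' d' :
  b \notin [:: a'; b'; c'; d'] -> c \notin [:: a'; b'; c'; d'] ->
  d \notin [:: a'; b'; c'; d'] -> cross_cov a b c d a' b' c' d'.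
Proof.
move=> bq cq dq u u'.
have u4 := u; split_uniq u; have u4' := u'; split_uniq u'; split_uniq bq; split_uniq cq; split_uniq dq.
rewrite avg_third //; last 2 first.
- by move=> p; tperm_simp cross_tperm.
- by move=> p; tperm_simp cross_tperm.
rewrite avg_cross // /overlap /overlap_poly; eval_eq.
have : ((a == a') + (a == b') + ((a == c') + (a == d')) <= 1)%N.
  case: (eqVneq a a') => [->|_]; first by eval_eq.
  case: (eqVneq a b') => [->|_]; first by eval_eq.
  by case: (eqVneq a c') => [->|_]; [eval_eq|case: (a == d')].
by case: (a == a'); case: (a == b'); case: (a == c'); case: (a == d') => //= _; field.
Qed.

Lemma cross_cov_edge_c a b c d d' : cross_cov a b c d a b c d'.
Proof.
move=> u u'; have u4 := u; split_uniq u; split_uniq u'.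
case: (eqVneq d d') => [<-|dd'].
  rewrite (eq_avg (fun p => cross_sqr R a b c d p)) avg_cross // /overlap /overlap_poly; eval_eq.
  by rewrite /=; field.
rewrite avg_cross_apex; last by solve_uniq.
by rewrite /overlap /overlap_poly; eval_eq; rewrite /=; field.
Qed.

Lemma cross_cov_edge a b c d c' d' : cross_cov a b c d a b c' d'.
Proof.
case: (eqVneq c c') => [<-|cc']; first exact: cross_cov_edge_c.
case: (eqVneq c d') => [<-|cd']; first exact/cross_cov_r34/cross_cov_edge_c.
case: (eqVneq d c') => [<-|dc']; first exact/cross_cov_l34/cross_cov_edge_c.
case: (eqVneq d d') => [<-|dd']; first exact/cross_cov_r34/cross_cov_l34/cross_cov_edge_c.
move=> u u'; split_uniq u; split_uniq u'.
rewrite avg_cross_edge; last by solve_uniq.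
by rewrite /overlap /overlap_poly; eval_eq; rewrite /=; field.
Qed.

Lemma cross_cov_path_c a b c d d' : cross_cov a b c d a c b d'.
Proof.
move=> u u'; have u4 := u; split_uniq u; split_uniq u'.
case: (eqVneq d d') => [<-|dd'].
  rewrite (eq_avg (fun p => cross_matching_disj R a b c d p)) avg_const /overlap /overlap_poly; eval_eq.
  by rewrite /=; field.
rewrite (@eq_avg _ _ _ (fun p => cross b a c d p * cross a c b d' p)) => [|p]; last by rewrite crossCl.
rewrite avg_cross_path; last by solve_uniq.
by rewrite /overlap /overlap_poly; eval_eq; rewrite /=; field.
Qed.

Lemma cross_cov_path a b c d b' d' : cross_cov a b c d a b' b d'.
Proof.
case: (eqVneq c b') => [<-|cb']; first exact: cross_cov_path_c.
case: (eqVneq d b') => [<-|db']; first exact/cross_cov_l34/cross_cov_path_c.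
case: (eqVneq c d') => [<-|cd']; first exact/cross_cov_l12/cross_cov_rsw/cross_cov_path_c.
case: (eqVneq d d') => [<-|dd'].
  exact/cross_cov_l12/cross_cov_l34/cross_cov_rsw/cross_cov_path_c.
move=> u u'; split_uniq u; split_uniq u'.
rewrite avg_cross_edge_split; last by solve_uniq.
by rewrite /overlap /overlap_poly; eval_eq; rewrite /=; field.
Qed.

Lemma cross_cov_ab1 a b c d b' c' d' : b \in [:: b'; c'; d'] -> cross_cov a b c d a b' c' d'.
Proof.
rewrite !inE => /or3P[] /eqP <-; first exact: cross_cov_edge.
  exact: cross_cov_path.
exact/cross_cov_r34/cross_cov_path.
Qed.

Lemma cross_cov_ab a b c d a' b' c' d' : a \in [:: a'; b'; c'; d'] ->
  b \in [:: a'; b'; c'; d'] -> cross_cov a b c d a' b' c' d'.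
Proof.
move=> aq bq u; have ab : b != a by split_uniq u; solve_neq.
move: u; change (cross_cov a b c d a' b' c' d'); move: aq bq; rewrite !inE.
case/or4P => /eqP <-; rewrite (negPf ab) /= ?orbF => bq.
- by apply: cross_cov_ab1; rewrite !inE.
- by apply/cross_cov_r12/cross_cov_ab1; rewrite !inE.
- by apply/cross_cov_rsw/cross_cov_ab1; rewrite !inE; case/or3P: bq => ->; rewrite ?orbT.
- by apply/cross_cov_rsw/cross_cov_r12/cross_cov_ab1; rewrite !inE; case/or3P: bq => ->; rewrite ?orbT.
Qed.

Lemma cross_cov_cd a b c d a' b' c' d' : c \in [:: a'; b'; c'; d'] ->
  d \in [:: a'; b'; c'; d'] -> cross_cov a b c d a' b' c' d'.
Proof. by move=> cq dq; apply/cross_cov_lsw/cross_cov_ab. Qed.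

Lemma cross_cov_ac1 a b c d b' c' d' : b \notin [:: a; b'; c'; d'] ->
  d \notin [:: a; b'; c'; d'] -> c \in [:: b'; c'; d'] -> cross_cov a b c d a b' c' d'.
Proof.
have main x y : b \notin [:: a; x; c; y] -> d \notin [:: a; x; c; y] -> cross_cov a b c d a x c y.
  move=> bq dq u u'; split_uniq u; split_uniq u'; split_uniq bq; split_uniq dq.
  rewrite avg_cross_split; last by solve_uniq.
  by rewrite /overlap /overlap_poly; eval_eq; rewrite /=; field.
move=> bq dq; rewrite !inE => /or3P[] /eqP cE; move: bq dq; rewrite -{}cE => bq dq.
- by apply/cross_cov_tr/cross_cov_ab1; rewrite !inE eqxx orbT.
- exact: main.
- apply/cross_cov_r34/main; first by move: bq; rewrite !inE !negb_or => /and4P[-> -> -> ->].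
  by move: dq; rewrite !inE !negb_or => /and4P[-> -> -> ->].
Qed.

Lemma cross_cov_ac a b c d a' b' c' d' : b \notin [:: a'; b'; c'; d'] ->
  d \notin [:: a'; b'; c'; d'] -> a \in [:: a'; b'; c'; d'] -> c \in [:: a'; b'; c'; d'] ->
  cross_cov a b c d a' b' c' d'.
Proof.
move=> bq dq aq cq u; have ac : c != a by split_uniq u; solve_neq.
move: u; change (cross_cov a b c d a' b' c' d').
have wl x y z w : perm_eq [:: a'; b'; c'; d'] [:: x; y; z; w] -> a = x -> cross_cov a b c d x y z w.
  move=> q /esym xa; move: q; rewrite xa => /perm_mem q; move: bq dq cq; rewrite !q.
  rewrite [c \in _]inE (negPf ac) /=; exact: cross_cov_ac1.
move: aq; rewrite !inE => /or4P[] /eqP aE.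
- exact: wl.
- by apply/cross_cov_r12/wl => //; apply/seq.permP => P /=; clear; lia.
- by apply/cross_cov_rsw/wl => //; apply/seq.permP => P /=; clear; lia.
- by apply/cross_cov_rsw/cross_cov_r12/wl => //; apply/seq.permP => P /=; clear; lia.
Qed.

(** Cases by the vertices of the first crossing that occur in the second: both ends of one edge, one
    end of each edge, or at most one vertex. Up to symmetry these are [cross_cov_ab], [cross_cov_ac]
    and [cross_cov_disjoint]. *)
Theorem cross_covE a b c d a' b' c' d' : cross_cov a b c d a' b' c' d'.
Proof.
set q := [:: a'; b'; c'; d'].
have [aq|aq] := boolP (a \in q); have [bq|bq] := boolP (b \in q);
have [cq|cq] := boolP (c \in q); have [dq|dq] := boolP (d \in q);
  do [exact: cross_cov_ab | exact: cross_cov_cd | exact: cross_cov_ac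
  | exact: cross_cov_disjoint | exact/cross_cov_l12/cross_cov_ac | exact/cross_cov_l34/cross_cov_ac
  | exact/cross_cov_l12/cross_cov_l34/cross_cov_ac | exact/cross_cov_l12/cross_cov_disjoint
  | exact/cross_cov_lsw/cross_cov_disjoint | exact/cross_cov_lsw/cross_cov_l12/cross_cov_disjoint].
Qed.

End CrossCov.

(** * Crossings of the cycle *)

Section Cyclic.
Variables (R : realFieldType) (m : nat).
Local Notation Z := 'I_m.+3.
Local Notation n := m.+3.
Implicit Types (i j k l x y a : Z).

Lemma Zp_int_eq0 (c : int) : (`|c| < n)%N -> (c%:~R == 0 :> Z) = (c == 0).
Proof.
have nat_eq0 (k : nat) : (k < n)%N -> (k%:R == 0 :> Z) = (k == 0)%N.
  by move=> kn; rewrite Zp_nat -val_eqE /= modn_small.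
case: c => k kn; first by rewrite -pmulrn nat_eq0.
by rewrite NegzE mulrNz oppr_eq0 -pmulrn nat_eq0.
Qed.

(* Edge i is (i, i + 1): two edges i and j are disjoint when nonadj (j - i) = 1,
   and shared (k - i) is the number of common end points of edges i and k. *)
Definition delta x : R := (x == 0)%:R.
Definition nonadj x : R := 1 - delta x - delta (x - 1) - delta (x + 1).
Definition shared x : R := 2 * delta x + delta (x - 1) + delta (x + 1).

Lemma deltaN x : delta (- x) = delta x.
Proof. by rewrite /delta oppr_eq0. Qed.

Lemma nonadjN x : nonadj (- x) = nonadj x.
Proof.
rewrite /nonadj -(deltaN (- x - 1)) -(deltaN (- x + 1)) deltaN.
by rewrite !opprD !opprK; ring.
Qed.

Lemma sharedN x : shared (- x) = shared x.
Proof.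
rewrite /shared -(deltaN (- x - 1)) -(deltaN (- x + 1)) deltaN.
by rewrite !opprD !opprK; ring.
Qed.

Lemma nonadjC x y : nonadj (x - y) = nonadj (y - x).
Proof. by rewrite -nonadjN opprB. Qed.

Lemma sharedC x y : shared (x - y) = shared (y - x).
Proof. by rewrite -sharedN opprB. Qed.

Lemma sum_delta a (f : Z -> R) : \sum_x delta (x - a) * f x = f a.
Proof.
rewrite (bigD1 a) //= big1 ?addr0 => [|x xa]; rewrite /delta subr_eq0.
  by rewrite eqxx mul1r.
by rewrite (negPf xa) mul0r.
Qed.

Lemma sum_shared a (f : Z -> R) :
  \sum_x shared (x - a) * f x = 2 * f a + f (a + 1) + f (a - 1).
Proof.
rewrite -(sum_delta a f) -(sum_delta (a + 1) f) -(sum_delta (a - 1) f) mulr_sumr -!big_split.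
apply: eq_bigr => x _ /=; rewrite /shared (_ : x - a - 1 = x - (a + 1)); last by ring.
by rewrite (_ : x - a + 1 = x - (a - 1)); ring.
Qed.

Lemma sum_nonadj a (f : Z -> R) :
  \sum_x nonadj (x - a) * f x = \sum_x f x - f a - f (a + 1) - f (a - 1).
Proof.
rewrite -(sum_delta a f) -(sum_delta (a + 1) f) -(sum_delta (a - 1) f) -!sumrB.
apply: eq_bigr => x _ /=; rewrite /nonadj (_ : x - a - 1 = x - (a + 1)); last by ring.
by rewrite (_ : x - a + 1 = x - (a - 1)); ring.
Qed.

Lemma sum_nonadj1 a : \sum_x nonadj (x - a) = n%:R - 3.
Proof.
under eq_bigr do rewrite -[nonadj _]mulr1.
by rewrite sum_nonadj sumr_const card_ord; ring.
Qed.

Lemma delta_int (c : int) : (`|c| < n)%N -> delta c%:~R = (c == 0)%:R.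
Proof. by move=> cn; rewrite /delta Zp_int_eq0. Qed.

Lemma delta_excl x : [/\ delta x * delta (x - 1) = 0, delta x * delta (x + 1) = 0 &
  delta (x - 1) * delta (x + 1) = 0].
Proof.
have one : (1 == 0 :> Z) = false by exact: (@Zp_int_eq0 1).
have two : (1 + 1 == 0 :> Z) = false by exact: (@Zp_int_eq0 2).
rewrite /delta -!natrM !mulnb; split; case: eqP => //= x0; case: eqP => //= x1.
- by case/negbT/eqP: one; transitivity (x - (x - 1)); [ring | rewrite x1 x0 subrr].
- by case/negbT/eqP: one; transitivity (x + 1 - x); [ring | rewrite x1 x0 subrr].
- by case/negbT/eqP: two; transitivity (x + 1 - (x - 1)); [ring | rewrite x1 x0 subrr].
Qed.

Lemma delta_sqr x : delta x * delta x = delta x.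
Proof. by rewrite /delta -natrM mulnb andbb. Qed.

(** The values of [shared] are 0, 1, 2, with 2 only at 0. Falling factorials of overlaps thus
    collapse to [delta]. *)
Lemma shared_sub1 x : shared x * (shared x - 1) = 2 * delta x.
Proof.
have [h1 h2 h3] := delta_excl x; have := delta_sqr x; have := delta_sqr (x - 1); have := delta_sqr (x + 1).
by rewrite /shared; move: h1 h2 h3; clear; nra.
Qed.

Definition sum4 (M : Z -> Z -> Z -> Z -> R) : R :=
  \sum_i \sum_j \sum_k \sum_l nonadj (j - i) * nonadj (l - k) * M i j k l.

Lemma sum4D M1 M2 : sum4 (fun i j k l => M1 i j k l + M2 i j k l) = sum4 M1 + sum4 M2.
Proof.
rewrite -big_split; apply: eq_bigr => i _; rewrite -big_split; apply: eq_bigr => j _.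
rewrite -big_split; apply: eq_bigr => k _; rewrite -big_split; apply: eq_bigr => l _.
exact: mulrDr.
Qed.

Lemma sum4Z c M : sum4 (fun i j k l => c * M i j k l) = c * sum4 M.
Proof.
rewrite mulr_sumr; apply: eq_bigr => i _; rewrite mulr_sumr; apply: eq_bigr => j _.
rewrite mulr_sumr; apply: eq_bigr => k _; rewrite mulr_sumr; apply: eq_bigr => l _.
exact: mulrCA.
Qed.

Lemma eq_sum4 M1 M2 : (forall i j k l, M1 i j k l = M2 i j k l) -> sum4 M1 = sum4 M2.
Proof.
move=> E; apply: eq_bigr => i _; apply: eq_bigr => j _; apply: eq_bigr => k _.
by apply: eq_bigr => l _; rewrite E.
Qed.

Lemma sum4_swapr M : sum4 (fun i j k l => M i j l k) = sum4 M.
Proof.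
apply: eq_bigr => i _; apply: eq_bigr => j _; rewrite exchange_big /=.
by apply: eq_bigr => k _; apply: eq_bigr => l _; rewrite [nonadj (k - l)]nonadjC.
Qed.

Lemma sum4_swapl M : sum4 (fun i j k l => M j i k l) = sum4 M.
Proof.
rewrite /sum4 exchange_big /=; apply: eq_bigr => i _; apply: eq_bigr => j _.
by apply: eq_bigr => k _; apply: eq_bigr => l _; rewrite [nonadj (i - j)]nonadjC.
Qed.

Lemma sum4_tr M : sum4 (fun i j k l => M k l i j) = sum4 M.
Proof.
rewrite /sum4; under eq_bigr do rewrite exchange_big /=.
rewrite exchange_big /=; apply: eq_bigr => k _.
under eq_bigr do rewrite exchange_big /=.
rewrite exchange_big /=; apply: eq_bigr => l _.
by apply: eq_bigr => i _; apply: eq_bigr => j _; congr (_ * _); exact: mulrC.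
Qed.

Lemma sum4B M1 M2 : sum4 (fun i j k l => M1 i j k l - M2 i j k l) = sum4 M1 - sum4 M2.
Proof.
by rewrite -mulN1r -sum4Z -sum4D; apply: eq_sum4 => i j k l; rewrite mulN1r.
Qed.

(** [sum4] is invariant under i <-> j, k <-> l and (i, j) <-> (k, l). Each bracket collects images
    of one function under these symmetries, so it counts as their number times that function. *)
Lemma sum4_orbits (Q1 Q2 Q3 Q4 Q4' Q5 Q6 Q7 : Z -> Z -> Z -> Z -> R) :
  sum4 (fun i j k l => 4 * (Q1 i j k l + Q1 j i k l + Q1 i j l k + Q1 j i l k)
    - 2 * (Q2 i j k l + Q2 j i k l + Q2 k l i j + Q2 l k i j)
    + (Q3 i j k l + Q3 i j l k)
    + 4 * (Q4 i j k l + Q4 i j l k) + 4 * (Q4' i j k l + Q4' i j l k)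
    - 2 * (Q5 i j k l + Q5 i j l k + Q5 j i k l + Q5 j i l k)
    + 12 * (Q6 i j k l + Q6 i j l k) - 6 * Q7 i j k l) =
  16 * sum4 Q1 - 8 * sum4 Q2 + 2 * sum4 Q3 + 8 * sum4 Q4 + 8 * sum4 Q4'
  - 8 * sum4 Q5 + 24 * sum4 Q6 - 6 * sum4 Q7.
Proof.
have slr M : sum4 (fun i j k l => M j i l k) = sum4 M.
  by rewrite -(sum4_swapl M) -(sum4_swapr (fun i j k l => M j i k l)).
have trl M : sum4 (fun i j k l => M l k i j) = sum4 M.
  by rewrite -(sum4_swapl M) -(sum4_tr (fun i j k l => M j i k l)).
rewrite sum4B sum4D sum4B sum4D sum4D sum4D sum4B !sum4Z !sum4D.
rewrite (slr Q1) (slr Q5) (trl Q2) (sum4_swapl Q1) (sum4_swapl Q2) (sum4_swapl Q5) (sum4_tr Q2).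
rewrite (sum4_swapr Q1) (sum4_swapr Q3) (sum4_swapr Q4) (sum4_swapr Q4') (sum4_swapr Q5) (sum4_swapr Q6).
ring.
Qed.

Local Notation o := (fun i k => shared (k - i)).

Lemma sum4_poly :
  sum4 (fun i j k l => overlap_poly (o i k) (o i l) (o j k) (o j l)) =
  16 * sum4 (fun i j k l => delta (k - i))
  - 8 * sum4 (fun i j k l => o i k * o i l)
  + 2 * sum4 (fun i j k l => o i k * o j l)
  + 8 * sum4 (fun i j k l => delta (k - i) * o j l)
  + 8 * sum4 (fun i j k l => o i k * delta (l - j))
  - 8 * sum4 (fun i j k l => o i k * o i l * o j k)
  + 24 * sum4 (fun i j k l => delta (k - i) * delta (l - j))
  - 6 * sum4 (fun i j k l => o i k * o i l * o j k * o j l).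
Proof.
rewrite -sum4_orbits; apply: eq_sum4 => i j k l.
rewrite [shared (i - k)]sharedC [shared (i - l)]sharedC [shared (j - k)]sharedC [shared (j - l)]sharedC.
have := shared_sub1 (k - i); have := shared_sub1 (l - i).
have := shared_sub1 (k - j); have := shared_sub1 (l - j).
move: (shared (k - i)) (shared (l - i)) (shared (k - j)) (shared (l - j)) => A B' C D.
move: (delta (k - i)) (delta (l - i)) (delta (k - j)) (delta (l - j)) => a b c d hd hc hb ha.
(* Regrouped by falling factorials such as A(A - 1), the form to which [shared_sub1] applies. *)
transitivity (2 * (A * (A - 1) + B' * (B' - 1) + C * (C - 1) + D * (D - 1))
  - 2 * (A * B' + C * D + A * C + B' * D) + (A * D + B' * C)
  + 2 * (A * (A - 1) * D + A * (D * (D - 1)) + B' * (B' - 1) * C + B' * (C * (C - 1)))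
  - 2 * (A * B' * C + A * B' * D + A * C * D + B' * C * D)
  + 3 * (A * (A - 1) * (D * (D - 1)) + B' * (B' - 1) * (C * (C - 1)))
  - 6 * (A * B' * C * D)); first by rewrite /overlap_poly; ring.
by rewrite ha hb hc hd; ring.
Qed.

End Cyclic.

(** * Evaluation of the cyclic sums for cycles of length at least 5 *)

Section CyclicSums.
Variables (R : realFieldType) (m : nat).
Hypothesis m2 : (2 <= m)%N.
Local Notation Z := 'I_m.+3.
Local Notation n := m.+3.
Implicit Types (i j k l x y a : Z).
Local Notation nonadj := (@nonadj R m).
Local Notation shared := (@shared R m).
Local Notation delta := (@delta R m).
Local Notation sum4 := (@sum4 R m).
Local Notation N := (n%:R : R).

(** The sums involve offsets of absolute value up to 4, which must not vanish modulo n: this is why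
    n >= 5. For n = 4 the variance is 2/9, while the formula would give 4/15. *)
Lemma delta_small (c : int) x : x = c%:~R -> (`|c| <= 4)%N -> delta x = (c == 0)%:R.
Proof. by move=> -> c4; rewrite delta_int //; apply: leq_ltn_trans c4 _; rewrite !ltnS. Qed.

Lemma nonadj_small (c : int) x : x = c%:~R -> (`|c| <= 3)%N ->
  nonadj x = 1 - (c == 0)%:R - (c - 1 == 0)%:R - (c + 1 == 0)%:R.
Proof.
move=> xc c3; rewrite /nonadj (@delta_small c) // 1?ltnW //.
rewrite (@delta_small (c - 1)) ?xc ?rmorphB //; last by lia.
by rewrite (@delta_small (c + 1)) ?rmorphD //; lia.
Qed.

Lemma shared_small (c : int) x : x = c%:~R -> (`|c| <= 3)%N ->
  shared x = 2 * (c == 0)%:R + (c - 1 == 0)%:R + (c + 1 == 0)%:R.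
Proof.
move=> xc c3; rewrite /shared (@delta_small c) // 1?ltnW //.
rewrite (@delta_small (c - 1)) ?xc ?rmorphB //; last by lia.
by rewrite (@delta_small (c + 1)) ?rmorphD //; lia.
Qed.

Ltac small_const tac :=
  first [tac 0%Z | tac 1%Z | tac (-1)%Z | tac 2%Z | tac (-2)%Z | tac 3%Z | tac (-3)%Z].

Ltac eval_small := repeat match goal with
  | |- context[nonadj ?x] =>
    small_const ltac:(fun c => rewrite (@nonadj_small c x ltac:(ring) isT))
  | |- context[shared ?x] =>
    small_const ltac:(fun c => rewrite (@shared_small c x ltac:(ring) isT))
  end; rewrite /=.

Lemma sum4E M : sum4 M =
  \sum_i \sum_k \sum_j nonadj (j - i) * \sum_l nonadj (l - k) * M i j k l.
Proof.
apply: eq_bigr => i _; rewrite exchange_big /=; apply: eq_bigr => k _; apply: eq_bigr => j _.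
by rewrite mulr_sumr; apply: eq_bigr => l _; rewrite mulrA.
Qed.

Lemma sum4_const M c :
  (forall i, \sum_k \sum_j nonadj (j - i) * (\sum_l nonadj (l - k) * M i j k l) = c) ->
  sum4 M = N * c.
Proof.
by move=> Mc; rewrite sum4E (eq_bigr _ (fun i _ => Mc i)) sumr_const card_ord mulr_natl.
Qed.

Lemma sum_nonadj_nonadj i k : \sum_j nonadj (j - i) * nonadj (j - k) =
  N - 3 - nonadj (i - k) - nonadj (i + 1 - k) - nonadj (i - 1 - k).
Proof. by rewrite sum_nonadj sum_nonadj1. Qed.

Lemma sum_nonadj_shift i (c : Z) : \sum_j nonadj (j + c - i) = N - 3.
Proof.
rewrite -(sum_nonadj1 R (i - c)); apply: eq_bigr => j _; congr (nonadj _); ring.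
Qed.

Lemma sum_nonadj_shared i k :
  \sum_j nonadj (j - i) * (\sum_l nonadj (l - k) * shared (l - j)) =
  4 * (N - 3) - (2 * nonadj (i - k) + nonadj (i + 1 - k) + nonadj (i - 1 - k))
   - (2 * nonadj (i + 1 - k) + nonadj (i + 1 + 1 - k) + nonadj (i + 1 - 1 - k))
   - (2 * nonadj (i - 1 - k) + nonadj (i - 1 + 1 - k) + nonadj (i - 1 - 1 - k)).
Proof.
rewrite (eq_bigr (fun j => nonadj (j - i) * (2 * nonadj (j - k) + nonadj (j + 1 - k) + nonadj (j - 1 - k)))).
  rewrite sum_nonadj /= big_split big_split /= -mulr_sumr (sum_nonadj_shift k 1) (sum_nonadj_shift k (-1)) sum_nonadj1; ring.
move=> j _; congr (_ * _); rewrite -(sum_shared j (fun l => nonadj (l - k))).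
by apply: eq_bigr => l _; rewrite mulrC.
Qed.

Lemma sum4_delta : sum4 (fun i j k l => delta (k - i)) = N * (N - 3) ^+ 2.
Proof.
apply: sum4_const => i.
rewrite (eq_bigr (fun k => delta (k - i) * (N - 3) ^+ 2)) => [|k _].
  exact: (sum_delta i (fun=> (N - 3) ^+ 2)).
rewrite (eq_bigr (fun j => nonadj (j - i) * ((N - 3) * delta (k - i)))) => [|j _].
  by rewrite -mulr_suml sum_nonadj1; ring.
by rewrite -mulr_suml sum_nonadj1.
Qed.

Lemma sum4_row : sum4 (fun i j k l => shared (k - i) * shared (l - i)) = N * (2 * (N - 3)).
Proof.
apply: sum4_const => i.
rewrite (eq_bigr (fun k => shared (k - i) * ((N - 3) *
   (2 * nonadj (i - k) + nonadj (i + 1 - k) + nonadj (i - 1 - k))))) => [|k _].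
  by rewrite sum_shared; eval_small; ring.
rewrite -(sum_shared i (fun l => nonadj (l - k))) -mulr_suml sum_nonadj1 [RHS]mulrCA; congr (_ * _).
by rewrite mulr_sumr; apply: eq_bigr => l _; ring.
Qed.

Lemma sum4_diag : sum4 (fun i j k l => shared (k - i) * shared (l - j)) = N * (16 * N - 60).
Proof.
apply: sum4_const => i.
rewrite (eq_bigr (fun k => shared (k - i) *
   (\sum_j nonadj (j - i) * (\sum_l nonadj (l - k) * shared (l - j))))) => [|k _].
  by rewrite sum_shared !sum_nonadj_shared; eval_small; ring.
rewrite mulr_sumr; apply: eq_bigr => j _; rewrite [RHS]mulrCA; congr (_ * _).
by rewrite mulr_sumr; apply: eq_bigr => l _; ring.
Qed.

Lemma sum4_delta_diag : sum4 (fun i j k l => delta (k - i) * shared (l - j)) = N * (4 * N - 14).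
Proof.
apply: sum4_const => i.
rewrite (eq_bigr (fun k => delta (k - i) *
   (\sum_j nonadj (j - i) * (\sum_l nonadj (l - k) * shared (l - j))))) => [|k _].
  by rewrite sum_delta sum_nonadj_shared; eval_small; ring.
rewrite mulr_sumr; apply: eq_bigr => j _; rewrite [RHS]mulrCA; congr (_ * _).
by rewrite mulr_sumr; apply: eq_bigr => l _; ring.
Qed.

Lemma sum_nonadj_delta j k : \sum_l nonadj (l - k) * delta (l - j) = nonadj (j - k).
Proof.
rewrite -(sum_delta j (fun l => nonadj (l - k))).
by apply: eq_bigr => l _; rewrite mulrC.
Qed.

Lemma sum4_diag_delta : sum4 (fun i j k l => shared (k - i) * delta (l - j)) = N * (4 * N - 14).
Proof.
apply: sum4_const => i.
rewrite (eq_bigr (fun k => shared (k - i) * (\sum_j nonadj (j - i) * nonadj (j - k)))) => [|k _].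
  by rewrite sum_shared !sum_nonadj_nonadj; eval_small; ring.
rewrite mulr_sumr; apply: eq_bigr => j _; rewrite [RHS]mulrCA -(sum_nonadj_delta j k); congr (_ * _).
by rewrite mulr_sumr; apply: eq_bigr => l _; ring.
Qed.

Lemma sum4_delta_delta : sum4 (fun i j k l => delta (k - i) * delta (l - j)) = N * (N - 3).
Proof.
apply: sum4_const => i.
rewrite (eq_bigr (fun k => delta (k - i) * (\sum_j nonadj (j - i) * nonadj (j - k)))) => [|k _].
  by rewrite sum_delta sum_nonadj_nonadj; eval_small; ring.
rewrite mulr_sumr; apply: eq_bigr => j _; rewrite [RHS]mulrCA -(sum_nonadj_delta j k); congr (_ * _).
by rewrite mulr_sumr; apply: eq_bigr => l _; ring.
Qed.

Lemma sum4_triple :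
  sum4 (fun i j k l => shared (k - i) * shared (l - i) * shared (k - j)) = N * 2.
Proof.
apply: sum4_const => i.
pose h k := 2 * nonadj (k - i) + nonadj (k + 1 - i) + nonadj (k - 1 - i).
rewrite (eq_bigr (fun k => shared (k - i) * (h k *
   (2 * nonadj (i - k) + nonadj (i + 1 - k) + nonadj (i - 1 - k))))) => [|k _].
  by rewrite sum_shared /h; eval_small; ring.
rewrite -(sum_shared i (fun l => nonadj (l - k))) /h -(sum_shared k (fun j => nonadj (j - i))).
rewrite mulr_suml mulr_sumr; apply: eq_bigr => j _; rewrite !mulr_sumr; apply: eq_bigr => l _.
by rewrite (sharedC _ k j); ring.
Qed.

(** A nonzero term would have disjoint edges i, j and disjoint edges k, l with each of k, l meeting
    both i and j. That happens only in a cycle of length 4. *)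
Lemma sum4_quad :
  sum4 (fun i j k l => shared (k - i) * shared (l - i) * shared (k - j) * shared (l - j)) = 0.
Proof.
rewrite -[RHS](mulr0 N); apply: sum4_const => i.
pose F k l := 2 * (nonadj (k - i) * shared (l - k)) + nonadj (k + 1 - i) * shared (l - (k + 1))
  + nonadj (k - 1 - i) * shared (l - (k - 1)).
pose G k l := nonadj (l - k) * F k l.
rewrite (eq_bigr (fun k => shared (k - i) * (2 * G k i + G k (i + 1) + G k (i - 1)))) => [|k _].
  by rewrite sum_shared /G /F; eval_small; ring.
rewrite -(sum_shared i (G k)) mulr_sumr.
under eq_bigr do rewrite mulr_sumr.
rewrite exchange_big /=; apply: eq_bigr => l _.
rewrite /G /F -(sum_shared k (fun j => nonadj (j - i) * shared (l - j))) !mulr_sumr.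
by apply: eq_bigr => j _; rewrite (sharedC _ k j); ring.
Qed.

(** Divided by 720 this is the variance: 180 from [cross_cov] and 4 from the two factors 1/2 of
    [cycle_cross]. *)
Lemma sum4_overlap_poly :
  sum4 (fun i j k l => overlap_poly (shared (k - i)) (shared (l - i)) (shared (k - j)) (shared (l - j)))
  = N * (16 * N ^+ 2 + 8 * N - 240).
Proof.
rewrite sum4_poly sum4_delta sum4_row sum4_diag sum4_delta_diag sum4_diag_delta.
by rewrite sum4_triple sum4_delta_delta sum4_quad; ring.
Qed.

End CyclicSums.

Section CycleMoments.
Variables (R : realFieldType) (m : nat).
Local Notation Z := 'I_m.+3.
Local Notation n := m.+3.
Implicit Types (i j k l x y a : Z) (p : 'S_n).
Local Notation nonadj := (@nonadj R m).
Local Notation shared := (@shared R m).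
Local Notation delta := (@delta R m).
Local Notation N := (n%:R : R).

Lemma ordS_add1 i : ordS i = i + 1.
Proof. by apply: val_inj; rewrite /= modnDmr addn1. Qed.

Definition edge_cross i j p : R := cross R i (ordS i) j (ordS j) p.

(* Unordered pairs of edges, hence the factor 1/2. *)
Definition cycle_cross p : R := (\sum_i \sum_j edge_cross i j p) / 2.

Lemma ordS_neq i : ordS i != i.
Proof.
rewrite ordS_add1 -subr_eq0 (_ : i + 1 - i = 1%:~R) ?Zp_int_eq0 //.
by rewrite addrAC subrr add0r.
Qed.

Lemma uniq_nonadj i j : (uniq [:: i; ordS i; j; ordS j])%:R = nonadj (j - i).
Proof.
rewrite /= !inE !negb_or (eq_sym i (ordS i)) (eq_sym j (ordS j)) !ordS_neq /= andbT !ordS_add1.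
rewrite (inj_eq (addIr _)) /nonadj /delta.
rewrite subr_eq0 (eq_sym j i) [j - i - 1 == 0](_ : _ = (i + 1 == j)); last first.
  by rewrite -addrA -opprD subr_eq0 eq_sym.
rewrite [j - i + 1 == 0](_ : _ = (i == j + 1)); last by rewrite addrAC subr_eq0 eq_sym.
case: (eqVneq i j) => [->|ij] /=.
  have := ordS_neq j; rewrite ordS_add1 => /negPf j1; rewrite j1 (eq_sym j) j1 /=; ring.
case: (eqVneq i (j + 1)) => [->|_] /=; last first.
  by case: eqP => _ /=; ring.
rewrite -subr_eq0 (_ : j + 1 + 1 - j = 2%:~R); last by ring.
by rewrite Zp_int_eq0 //=; ring.
Qed.

Lemma overlap_shared i k : overlap R i (ordS i) k (ordS k) = shared (k - i).
Proof.
rewrite /overlap /shared /delta !ordS_add1 (inj_eq (addIr _)).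
rewrite [k - i == 0]subr_eq0 (eq_sym k i) [k - i - 1 == 0](_ : _ = (i + 1 == k)); last first.
  by rewrite -addrA -opprD subr_eq0 eq_sym.
rewrite [k - i + 1 == 0](_ : _ = (i == k + 1)); last by rewrite addrAC subr_eq0 eq_sym.
ring.
Qed.

Lemma avg_edge_cross i j : avg (edge_cross i j) = nonadj (j - i) / 3.
Proof.
rewrite -uniq_nonadj; have [u|u] := boolP (uniq _); first exact: avg_cross.
by rewrite mul0r -[RHS](@avg_const R n); apply: eq_avg => p; apply: cross_nuniq.
Qed.

Lemma avg_cycle_cross : avg cycle_cross = N * (N - 3) / 6.
Proof.
rewrite /cycle_cross avgZr avg_sum (eq_bigr (fun=> (N - 3) / 3)) => [|i _].
  by rewrite sumr_const card_ord -mulr_natl; field.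
rewrite avg_sum (eq_bigr _ (fun j _ => avg_edge_cross i j)) -mulr_suml.
by rewrite sum_nonadj1.
Qed.

Lemma avg_edge_cross2 i j k l : avg (fun p => edge_cross i j p * edge_cross k l p) =
  nonadj (j - i) * nonadj (l - k) * (1 / 9 +
    overlap_poly (shared (k - i)) (shared (l - i)) (shared (k - j)) (shared (l - j)) / 180).
Proof.
rewrite -!uniq_nonadj; have [u|u] := boolP (uniq [:: i; _; _; _]); last first.
  rewrite !mul0r -[RHS](@avg_const R n); apply: eq_avg => p.
  by rewrite /edge_cross (cross_nuniq R p u) mul0r.
have [u'|u'] := boolP (uniq [:: k; _; _; _]); last first.
  rewrite mulr0 mul0r -[RHS](@avg_const R n); apply: eq_avg => p.
  by rewrite /edge_cross (cross_nuniq R p u') mulr0.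
by rewrite -!overlap_shared -(cross_covE R u u') /edge_cross /=; set A := avg _; field.
Qed.

Lemma avg_cycle_cross_sqr : (2 <= m)%N ->
  avg (fun p => (cycle_cross p - avg cycle_cross) ^+ 2) =
  N ^+ 3 / 45 + N ^+ 2 / 90 - N / 3.
Proof.
move=> m2; rewrite (@eq_avg _ _ _ (fun p => cycle_cross p ^+ 2 + (avg cycle_cross ^+ 2
  - 2 * avg cycle_cross * cycle_cross p))) => [|p]; last by ring.
rewrite avgD avgB avg_const avgZ.
have -> : avg (fun p => cycle_cross p ^+ 2) =
    (\sum_i \sum_j \sum_k \sum_l avg (fun p => edge_cross i j p * edge_cross k l p)) / 4.
  rewrite (@eq_avg _ _ _ (fun p =>
    (\sum_i \sum_j \sum_k \sum_l edge_cross i j p * edge_cross k l p) * 4^-1)) => [|p].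
    rewrite avgZr avg_sum; congr (_ * _); apply: eq_bigr => i _.
    rewrite avg_sum; apply: eq_bigr => j _; rewrite avg_sum; apply: eq_bigr => k _.
    by rewrite avg_sum.
  rewrite /cycle_cross exprMn (_ : 2^-1 ^+ 2 = 4^-1 :> R); last by field.
  rewrite expr2 mulr_suml; congr (_ * _); apply: eq_bigr => i _.
  rewrite mulr_suml; apply: eq_bigr => j _.
  by rewrite mulr_sumr; apply: eq_bigr => k _; rewrite mulr_sumr.
have -> : \sum_i \sum_j \sum_k \sum_l avg (fun p => edge_cross i j p * edge_cross k l p) =
    sum4 (fun i j k l => 1 / 9 +
      180^-1 * overlap_poly (shared (k - i)) (shared (l - i)) (shared (k - j)) (shared (l - j))).
  apply: eq_bigr => i _; apply: eq_bigr => j _; apply: eq_bigr => k _; apply: eq_bigr => l _.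
  by rewrite avg_edge_cross2 [_ / 180]mulrC.
(* The constant 1/9 contributes N^2 (N - 3)^2 / 9, which after division by 4 is the square of the
   mean and cancels. *)
rewrite sum4D (sum4Z 180^-1) sum4_overlap_poly // (@sum4_const _ _ _ ((N - 3) ^+ 2 * N / 9)).
  by rewrite avg_cycle_cross; field.
move=> i; rewrite (eq_bigr (fun=> (N - 3) ^+ 2 / 9)) => [|k _].
  by rewrite sumr_const card_ord -[_ *+ _]mulr_natr; ring.
rewrite (eq_bigr (fun j => nonadj (j - i) * ((N - 3) / 9))) => [|j _].
  by rewrite -mulr_suml sum_nonadj1; ring.
by rewrite -mulr_suml sum_nonadj1; ring.
Qed.

End CycleMoments.

(** * The linear part *)

Section ChordDev.
Variables (R : realFieldType) (n : nat).
Implicit Types (p t : 'S_n) (a b c d e f x : 'I_n).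
Local Notation cross := (@cross R n).
Local Notation chord_dev := (@chord_dev R n).
Local Notation N := (n%:R : R).

Lemma chord_devC a b p : chord_dev b a p = chord_dev a b p.
Proof. by rewrite /chord_dev chord_cross_sumC. Qed.

Lemma chord_devE a b p : a != b ->
  chord_dev a b p = arc_cross R n (dist (p a) (p b)) - chord_mean R n.
Proof. by move=> ab; rewrite /chord_dev chord_cross_sumE. Qed.

Lemma chord_dev_tperm k l a b p : a != b -> chord_dev a b (tperm k l * p)%g =
  chord_dev (tperm k l a) (tperm k l b) p.
Proof. by move=> ab; rewrite !chord_devE ?(inj_eq perm_inj) // !permM. Qed.

Lemma avg_chord_dev a b : a != b -> avg (chord_dev a b) = 0.
Proof. by move=> ab; rewrite /chord_dev avgB avg_chord // avg_const subrr. Qed.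

Lemma sum_chord_dev_notin1 a b p : a != b ->
  \sum_(c | c \notin [:: a; b]) chord_dev a c p = - chord_dev a b p.
Proof.
move=> ab; have := sum_chord_dev R a p; rewrite (bigD1 b) 1?eq_sym //= => /eqP.
rewrite addrC addr_eq0 => /eqP <-; apply: eq_bigl => c.
by rewrite !inE negb_or.
Qed.

Lemma sum_chord_dev_notin2 a b p : a != b ->
  \sum_(c | c \notin [:: a; b]) \sum_(d | d \notin [:: c; a; b]) chord_dev c d p =
  2 * chord_dev a b p.
Proof.
move=> ab; transitivity (\sum_(c | c \notin [:: a; b]) (- chord_dev a c p - chord_dev b c p)).
  apply: eq_bigr => c; rewrite !inE negb_or => /andP[ca cb].
  have := @sum_chord_dev_notin1 c a p ca.
  rewrite (@sum_notin_split _ _ _ _ b); last first.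
    by rewrite !inE negb_or (eq_sym b c) cb eq_sym ab.
  rewrite (chord_devC a) (chord_devC b) => E.
  rewrite (eq_bigl (fun x => x \notin [:: b; c; a])) => [|x]; last first.
    by rewrite !inE !negb_or andbA andbC andbA.
  by move: E; lra.
rewrite sumrB sumrN sum_chord_dev_notin1 // (eq_bigl (fun c => c \notin [:: b; a])) => [|x].
  by rewrite sum_chord_dev_notin1 1?eq_sym // (chord_devC a); ring.
by rewrite !inE orbC.
Qed.

(** By transitivity all N - 2 choices of [c] give the same covariance, and the row identity replaces
    the sum of [chord_dev b c] by [- chord_dev a b]. *)
Lemma avg_chord_dev_path a b c : uniq [:: a; b; c] ->
  avg (fun p => chord_dev a b p * chord_dev b c p) * (N - 2) = - chord_var R n.
Proof.
move=> u; split_uniq u.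
rewrite -[N - 2]/(N - (size [:: b; a])%:R) -sum_notin; last by solve_uniq.
rewrite (eq_bigr (fun x => avg (fun p => chord_dev a b p * chord_dev b x p))) => [|x xab].
  rewrite -avg_sum -(avg_chord_dev_sqr R h) -avgN; apply: eq_avg => p.
  by rewrite -mulr_sumr sum_chord_dev_notin1 1?eq_sym // (chord_devC a); ring.
have xba : uniq [:: a; b; x] by move: xab; rewrite !inE negb_or => /andP[? ?]; solve_uniq.
pose F l := if l is [:: x; y; z] then
  (arc_cross R n (dist x y) - chord_mean R n) * (arc_cross R n (dist y z) - chord_mean R n) else 0.
have E y : uniq [:: a; b; y] -> avg (fun p => chord_dev a b p * chord_dev b y p) =
    avg (fun p => F (map val (map p [:: a; b; y]))).
  by move=> u'; split_uniq u'; apply: eq_avg => p; rewrite !chord_devE.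
by rewrite !E //; apply: (avg_transport (fun l => F (map val l))).
Qed.

Lemma avg_chord_dev_disj a b c d : uniq [:: a; b; c; d] ->
  avg (fun p => chord_dev a b p * chord_dev c d p) * (N - 2) * (N - 3) = 2 * chord_var R n.
Proof.
move=> u; split_uniq u.
rewrite mulrAC -[N - 2]/(N - (size [:: a; b])%:R) -sum_notin; last by solve_uniq.
rewrite -(avg_chord_dev_sqr R h) -avgZ.
rewrite (eq_bigr (fun x => \sum_(y | y \notin [:: x; a; b])
  avg (fun p => chord_dev a b p * chord_dev x y p))) => [|x xab].
  rewrite (eq_bigr (fun x => avg (fun p => \sum_(y | y \notin [:: x; a; b])
    (chord_dev a b p * chord_dev x y p)))) => [|x xab]; last by rewrite avg_sum.
  rewrite -avg_sum; apply: eq_avg => p.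
  under eq_bigr do rewrite -mulr_sumr.
  by rewrite -mulr_sumr sum_chord_dev_notin2 //; ring.
rewrite -[N - 3]/(N - (size [:: x; a; b])%:R) -sum_notin; last first.
  by move: xab; rewrite !inE negb_or => /andP[? ?]; solve_uniq.
apply: eq_bigr => y yxab.
have xy : uniq [:: a; b; x; y].
  move: xab yxab; rewrite !inE !negb_or => /andP[? ?] /and3P[? ? ?]; solve_uniq.
pose F l := if l is [:: x; y; z; w] then
  (arc_cross R n (dist x y) - chord_mean R n) * (arc_cross R n (dist z w) - chord_mean R n) else 0.
have E z w : uniq [:: a; b; z; w] -> avg (fun p => chord_dev a b p * chord_dev z w p) =
    avg (fun p => F (map val (map p [:: a; b; z; w]))).
  by move=> u'; split_uniq u'; apply: eq_avg => p; rewrite !chord_devE.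
by rewrite !E //; apply: (avg_transport (fun l => F (map val l))).
Qed.

(** The chord uv meets the crossing at most in [a], so [avg_third] separates the two factors and the
    second has mean 0. *)
Lemma avg_cross_chord_dev_disj a b c d u v : uniq [:: a; b; c; d] -> u != v ->
  b \notin [:: u; v] -> c \notin [:: u; v] -> d \notin [:: u; v] ->
  avg (fun p => cross a b c d p * chord_dev u v p) = 0.
Proof.
move=> U uv bn cn dn; have U' := U.
split_uniq U; split_uniq bn; split_uniq cn; split_uniq dn.
rewrite avg_third // ?avg_chord_dev ?mul0r // => p; rewrite chord_dev_tperm //; tperm_simp cross_tperm => //.
Qed.

Lemma avg_cross_chord_dev a b c d : uniq [:: a; b; c; d] ->
  avg (fun p => cross a b c d p * chord_dev a b p) * (N - 2) * (N - 3) = chord_var R n.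
Proof.
move=> u; have n4 : (4 <= n)%N.
  by have := uniq_leq_size u (fun x _ => mem_enum 'I_n x); rewrite size_enum_ord.
rewrite (@eq_avg _ _ _ (fun p => cross a b c d p * chord_cross_sum R a b p
   - chord_mean R n * cross a b c d p)) => [|p]; last by rewrite /chord_dev; ring.
by rewrite avgB avgZ avg_cross_chord // avg_cross // /chord_mean /chord_var; field.
Qed.

Lemma chord_cross_sum_bound a b p : a != b ->
  0 <= chord_cross_sum R a b p <= (N - 2) ^+ 2 / 2.
Proof.
move=> ab; apply/andP; split; first by do 2 (apply: sumr_ge0 => ? _); exact: cross_ge0.
rewrite chord_cross_sumE // /arc_cross; set k := (dist _ _)%:R.
(* The factors k - 1 and N - 1 - k have sum N - 2, so their product is at most (N - 2)^2 / 4. *)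
by have := sqr_ge0 (2 * k - N); nra.
Qed.

Lemma chord_dev_bound a b p : (3 <= n)%N -> a != b -> `|chord_dev a b p| <= (N - 2) ^+ 2 / 2.
Proof.
move=> n3 ab; have /andP[h1 h2] := chord_cross_sum_bound p ab.
have N3 : 3 <= N by rewrite ler_nat.
have h3 : 0 <= (N - 2) * (N - 3) by rewrite mulr_ge0 // subr_ge0; lra.
rewrite ler_norml /chord_dev /chord_mean; apply/andP; split; nra.
Qed.

End ChordDev.

Section Eigen.
Variables (R : realFieldType) (n : nat).
Implicit Types (p t : 'S_n) (a b c d e f x k l : 'I_n).
Local Notation chord_dev := (@chord_dev R n).
Local Notation N := (n%:R : R).

(* Eigenfunction identity: moving one end point of the chord at random kills its
   centred crossing count on average, since the count depends on a distance. *)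
Lemma chord_dev_transp_sum a b p : a != b ->
  \sum_k \sum_l chord_dev a b (tperm k l * p)%g = (N - 2) ^+ 2 * chord_dev a b p.
Proof.
move=> ab; set D := chord_dev a b p.
have all_notin (F : 'I_n -> R) : \sum_x F x = \sum_(x | x \notin [::]) F x by [].
have ba : b != a by rewrite eq_sym.
have b0 : b \notin [:: a] by rewrite inE.
have dab c d : chord_dev a b (tperm c d * p)%g = chord_dev (tperm c d a) (tperm c d b) p.
  by rewrite chord_dev_tperm.
have rowa : \sum_l chord_dev a b (tperm a l * p)%g = D.
  rewrite all_notin (@sum_notin_split _ _ _ _ a) // (@sum_notin_split _ _ _ _ b) //.
  rewrite !dab tperm1 !perm1 tpermL tpermR (eq_bigr (fun l => chord_dev b l p)) => [|l].
    by rewrite sum_chord_dev_notin1 // (chord_devC _ a) -/D; ring.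
  by rewrite !inE negb_or dab => /andP[lb la]; rewrite tpermL (tpermD ab lb) chord_devC.
have rowb : \sum_l chord_dev a b (tperm b l * p)%g = D.
  rewrite all_notin (@sum_notin_split _ _ _ _ a) // (@sum_notin_split _ _ _ _ b) //.
  rewrite !dab tperm1 !perm1 tpermL tpermR (eq_bigr (fun l => chord_dev a l p)) => [|l].
    rewrite (eq_bigl (fun l => l \notin [:: a; b])) => [|l]; last by rewrite !inE orbC.
    by rewrite sum_chord_dev_notin1 // (chord_devC _ a) -/D; ring.
  by rewrite !inE negb_or dab => /andP[lb la]; rewrite tpermL (tpermD ba la).
rewrite all_notin (@sum_notin_split _ _ _ _ a) // (@sum_notin_split _ _ _ _ b) // rowa rowb.
rewrite (eq_bigr (fun k => chord_dev b k p + (chord_dev a k p + D * (N - 2)))) => [|k].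
  rewrite big_split /= [X in _ + (_ + (_ + X))]big_split /= sum_chord_dev_notin1 // sum_notin; last by rewrite /= inE ba.
  rewrite (eq_bigl (fun l => l \notin [:: a; b])) => [|l]; last by rewrite !inE orbC.
  by rewrite sum_chord_dev_notin1 // (chord_devC _ a) -/D /=; ring.
rewrite !inE negb_or => /andP[kb ka].
rewrite all_notin (@sum_notin_split _ _ _ _ a) // (@sum_notin_split _ _ _ _ b) //.
rewrite !dab !tpermR (tpermD kb ab) (tpermD ka ba).
congr (_ + (_ + _)); first by rewrite chord_devC.
rewrite (eq_bigr (fun=> D)) => [|l]; first by rewrite sum_notin //= inE ba.
by rewrite !inE negb_or dab => /andP[lb la]; rewrite (tpermD kb lb) (tpermD ka la).
Qed.

End Eigen.

Section CycleLinear.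
Variables (R : realFieldType) (m : nat).
Local Notation Z := 'I_m.+3.
Local Notation n := m.+3.
Implicit Types (i j k l x y a b : Z) (p : 'S_n).
Local Notation nonadj := (@nonadj R m).
Local Notation delta := (@delta R m).
Local Notation N := (n%:R : R).
Local Notation cycle_cross := (@cycle_cross R m).
Local Notation edge_cross := (@edge_cross R m).

Definition edge_dev i p : R := chord_dev R i (ordS i) p.

(** The scaling makes the average of [cycle_linear * edge_dev k] equal to [chord_var / (N - 2)] for
    n >= 5, the main term of the average of [cycle_cross * edge_dev k]: this is nearly the
    projection of the crossing number onto the edge deviations. *)
Definition cycle_linear p : R := (\sum_i edge_dev i p) / (N - 2).

Lemma neq_ordS i : i != ordS i.
Proof. by rewrite eq_sym ordS_neq. Qed.

Lemma N2_neq0 : N - 2 != 0.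
Proof. by rewrite -(addn2 m.+1) natrD addrK pnatr_eq0. Qed.

Lemma N2_gt0 : 0 < N - 2.
Proof. by rewrite -(addn2 m.+1) natrD addrK ltr0n. Qed.

Lemma natr3E : 3 + m%:R = N.
Proof. by rewrite -natrD. Qed.

Lemma sum_const2 (c : R) : \sum_(k : Z) \sum_(l : Z) c = N ^+ 2 * c.
Proof. by rewrite sumr_const sumr_const card_ord -mulrnA -[LHS]mulr_natl natrM expr2. Qed.

(** The factor is N^2 - (N - 2)^2, the gap between the number of pairs (k, l) and the eigenvalue of
    [chord_dev_transp_sum]. *)
Lemma cycle_linear_transp_sum p :
  \sum_k \sum_l (cycle_linear p - cycle_linear (tperm k l * p)%g) = 4 * (N - 1) * cycle_linear p.
Proof.
rewrite /cycle_linear.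
transitivity (\sum_i (N ^+ 2 * edge_dev i p - (N - 2) ^+ 2 * edge_dev i p) / (N - 2)).
  under eq_bigr do under eq_bigr do rewrite -mulrBl -sumrB mulr_suml.
  under eq_bigr do rewrite exchange_big /=.
  rewrite exchange_big /=; apply: eq_bigr => i _.
  under eq_bigr do rewrite -mulr_suml sumrB.
  rewrite -mulr_suml sumrB chord_dev_transp_sum ?neq_ordS //.
  by rewrite sum_const2.
by rewrite -mulr_suml sumrB -!mulr_sumr mulrA; congr (_ / _); ring.
Qed.

Hypothesis m2 : (2 <= m)%N.

Lemma N3_neq0 : N - 3 != 0.
Proof. by rewrite -(addn3 m) natrD addrK pnatr_eq0; case: (m) m2. Qed.

Lemma avg_edge_dev2 i j : avg (fun p => edge_dev i p * edge_dev j p) =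
  chord_var R n * (delta (j - i) - (N - 2)^-1 * (delta (j - (i + 1)) + delta (j - (i - 1)))
    + 2 / ((N - 2) * (N - 3)) * nonadj (j - i)).
Proof.
have N2 := N2_neq0; have N3 := N3_neq0.
have nz x y : x != y -> delta (x - y) = 0 by rewrite /delta subr_eq0 => /negPf->.
have dz x : delta (x - x) = 1 by rewrite /delta subrr eqxx.
have nad x y : nonadj (x - y) = 1 - delta (x - y) - delta (x - (y + 1)) - delta (x - (y - 1)).
  rewrite /nonadj (_ : x - y - 1 = x - (y + 1)); last by ring.
  by rewrite (_ : x - y + 1 = x - (y - 1)) //; ring.
case: (eqVneq j i) => [->|ij].
  have ne1 : i != i + 1 by rewrite -ordS_add1 neq_ordS.
  have ne2 : i != i - 1 by have := neq_ordS (i - 1); rewrite ordS_add1 subrK eq_sym.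
  rewrite nad dz (nz _ _ ne1) (nz _ _ ne2) -[LHS](@eq_avg _ _ (fun p => edge_dev i p ^+ 2)) //.
  by rewrite avg_chord_dev_sqr ?neq_ordS //; ring.
have path x : delta (x + 1 - x) = 0 /\ delta (x + 1 - (x - 1)) = 0 /\
    avg (fun p => edge_dev x p * edge_dev (x + 1) p) * (N - 2) = - chord_var R n.
  have n1 : x + 1 != x by rewrite -ordS_add1 eq_sym neq_ordS.
  have n2 : x + 1 + 1 != x.
    by rewrite -subr_eq0 (_ : _ - x = 2%:~R) ?Zp_int_eq0 //; ring.
  have n3 : x + 1 != x - 1 by rewrite eq_sym subr_eq eq_sym.
  split; [exact: nz|split; [exact: nz|]].
  rewrite /edge_dev !ordS_add1 avg_chord_dev_path // /= !inE negb_or (eq_sym x (x + 1)) n1 (eq_sym x) n2.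
  by rewrite -(ordS_add1 (x + 1)) neq_ordS.
case: (eqVneq j (i + 1)) => [->|ij1].
  have [h1 [h2 h3]] := path i.
  rewrite nad h1 dz h2; apply: (mulIf N2); rewrite h3; field.
  by rewrite natr3E N2 N3.
case: (eqVneq j (i - 1)) => [jE|ij2].
  have [] := path j; rewrite jE subrK => h1 [h2 h3].
  have e1 : delta (i - 1 - i) = 0 by apply: nz; rewrite -jE.
  have e2 : delta (i - 1 - (i + 1)) = 0 by apply: nz; rewrite -jE.
  rewrite nad dz e1 e2; apply: (mulIf N2); rewrite (@eq_avg _ _ _ (fun p => edge_dev (i - 1) p * edge_dev i p)) => [|p].
    by rewrite h3; field; rewrite natr3E N2 N3.
  exact: mulrC.
rewrite nad !nz //; have u : uniq [:: i; ordS i; j; ordS j].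
  have /eqP := uniq_nonadj R i j; rewrite nad !nz // !subr0; case: (uniq _) => //.
  by rewrite eq_sym oner_eq0.
apply: (mulIf N2); apply: (mulIf N3); rewrite avg_chord_dev_disj //; field.
by rewrite natr3E N2 N3.
Qed.

(** The negative covariances with the two adjacent edges exactly cancel the positive ones with the N
    - 3 disjoint edges, so only the diagonal is left. *)
Lemma avg_cycle_linear_sqr :
  avg (fun p => cycle_linear p ^+ 2) = N * chord_var R n / (N - 2) ^+ 2.
Proof.
have N2 := N2_neq0; have N3 := N3_neq0.
rewrite (@eq_avg _ _ _ (fun p => (\sum_i \sum_j edge_dev i p * edge_dev j p) / (N - 2) ^+ 2)) => [|p].
  rewrite avgZr avg_sum; congr (_ / _).
  rewrite (eq_bigr (fun=> chord_var R n)) => [|i _]; first by rewrite sumr_const card_ord mulr_natl.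
  rewrite avg_sum (eq_bigr _ (fun j _ => avg_edge_dev2 i j)) -mulr_sumr.
  rewrite big_split sumrB /= -!mulr_sumr big_split /= sum_nonadj1.
  have sd x : \sum_j delta (j - x) = 1.
    by rewrite -[RHS](sum_delta x (fun=> 1)); apply: eq_bigr => j _; rewrite mulr1.
  by rewrite !sd; field; rewrite natr3E N2 N3.
rewrite /cycle_linear expr_div_n expr2 mulr_suml; congr (_ / _).
by apply: eq_bigr => i _; rewrite mulr_sumr.
Qed.

End CycleLinear.

(** * Second moment of the remainder *)

Section Remainder.
Variables (R : realFieldType) (m : nat).
Hypothesis m2 : (2 <= m)%N.
Local Notation Z := 'I_m.+3.
Local Notation n := m.+3.
Implicit Types (i j k l x y a b : Z) (p : 'S_n).
Local Notation nonadj := (@nonadj R m).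
Local Notation delta := (@delta R m).
Local Notation N := (n%:R : R).
Local Notation cycle_cross := (@cycle_cross R m).
Local Notation edge_cross := (@edge_cross R m).
Local Notation edge_dev := (@edge_dev R m).
Local Notation cycle_linear := (@cycle_linear R m).
Local Notation V := (chord_var R n).

Lemma delta_ge0 x : 0 <= delta x.
Proof. exact: ler0n. Qed.

Lemma edge_crossC i j p : edge_cross i j p = edge_cross j i p.
Proof. exact: cross_swap. Qed.

Lemma edge_cross_bound i j p : 0 <= edge_cross i j p <= 1.
Proof. by rewrite cross_ge0 cross_le1. Qed.

Lemma edge_dev_bound i p : `|edge_dev i p| <= (N - 2) ^+ 2 / 2.
Proof. by apply: chord_dev_bound => //; exact: neq_ordS. Qed.

Lemma norm_avg_edge_cross_dev i j k :
  `|avg (fun p => edge_cross i j p * edge_dev k p)| <= (N - 2) ^+ 2 / 2.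
Proof.
apply: le_trans (ler_norm_avg _) _; rewrite -[leRHS](@avg_const R n); apply: le_avg => p.
have /andP[e0 e1] := edge_cross_bound i j p.
rewrite normrM (ger0_norm e0); apply: le_trans (edge_dev_bound k p).
by rewrite ler_piMl.
Qed.

(** Unless k is i or j or joins them, it meets their four ends in at most one vertex, and
    [avg_cross_chord_dev_disj] applies after a symmetry. *)
Lemma avg_edge_cross_dev i j k : uniq [:: i; ordS i; j; ordS j] -> i != k -> j != k ->
  ~~ ((k == ordS i) && (ordS k == j)) -> ~~ ((k == ordS j) && (ordS k == i)) ->
  avg (fun p => edge_cross i j p * edge_dev k p) = 0.
Proof.
move=> u ik jk kij kji; have kS := neq_ordS k.
have Si : ordS i != ordS k by rewrite (inj_eq (can_inj (@ordSK _))).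
have Sj : ordS j != ordS k by rewrite (inj_eq (can_inj (@ordSK _))).
have SSk : k != ordS (ordS k).
  rewrite !ordS_add1 eq_sym -subr_eq0 (_ : _ - k = 2%:~R); last by ring.
  by rewrite Zp_int_eq0.
have swap a b c d (F : 'S_n -> R) : avg (fun p => cross R a b c d p * F p) =
    avg (fun p => cross R b a c d p * F p).
  by apply: eq_avg => p; rewrite crossCl.
have swap2 a b c d (F : 'S_n -> R) : avg (fun p => cross R a b c d p * F p) =
    avg (fun p => cross R c d a b p * F p).
  by apply: eq_avg => p; rewrite cross_swap.
split_uniq u; rewrite /edge_cross /edge_dev.
case: (eqVneq k (ordS i)) kij => [kE|kSi] /= kij.
  have iSk : i != ordS k by apply: contra SSk => /eqP <-; rewrite -kE.
  have Sjk : ordS j != k by rewrite kE; solve_neq.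
  by rewrite swap avg_cross_chord_dev_disj //; solve_uniq.
case: (eqVneq k (ordS j)) kji => [kE|kSj] /= kji.
  have jSk : j != ordS k by apply: contra SSk => /eqP <-; rewrite -kE.
  by rewrite swap2 swap avg_cross_chord_dev_disj //; solve_uniq.
case: (eqVneq (ordS k) i) => [kE|ki].
  have jSk : j != ordS k by rewrite kE; solve_neq.
  by rewrite avg_cross_chord_dev_disj //; solve_uniq.
case: (eqVneq (ordS k) j) => [kE|kj].
  by rewrite swap2 avg_cross_chord_dev_disj //; solve_uniq.
by rewrite avg_cross_chord_dev_disj //; solve_uniq.
Qed.

(** Pairs joined by the edge k are estimated by the sup norm alone; for each k there are only two
    such ordered pairs. A lower bound suffices, as this average enters the second moment of
    [cycle_rest] with a minus sign. *)
Lemma avg_edge_cross_dev_ge i j k : avg (fun p => edge_cross i j p * edge_dev k p) >=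
  V / ((N - 2) * (N - 3)) * (delta (i - k) * nonadj (j - k) + delta (j - k) * nonadj (i - k))
  - (N - 2) ^+ 2 / 2 * (delta (i - (k - 1)) * delta (j - (k + 1))
                      + delta (j - (k - 1)) * delta (i - (k + 1))).
Proof.
have N2 := N2_gt0 R m; have N3 := N3_neq0 R m2.
set B := (N - 2) ^+ 2 / 2; have B0 : 0 <= B by rewrite divr_ge0 ?sqr_ge0.
set E := _ * delta _ + _ ; have E0 : 0 <= E by rewrite addr_ge0 // mulr_ge0 ?delta_ge0.
have dE x y : delta (x - y) = (x == y)%:R by rewrite /delta subr_eq0.
have main x y : uniq [:: x; ordS x; y; ordS y] ->
    avg (fun p => edge_cross x y p * edge_dev x p) = V / ((N - 2) * (N - 3)).
  move=> u; rewrite -(avg_cross_chord_dev R u); field.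
  by rewrite natr3E N3 lt0r_neq0.
set F := _ * nonadj _ + _; have BE : 0 <= B * E by exact: mulr_ge0.
have dz x y : x != y -> delta (x - y) = 0 by rewrite dE => /negPf->.
have nE x y : nonadj (x - y) = (uniq [:: y; ordS y; x; ordS x])%:R by rewrite uniq_nonadj.
have n0 x : nonadj (x - x) = 0 by rewrite nE /= !inE eqxx !orbT.
have Fz : i != k -> j != k -> F = 0 by move=> ik jk; rewrite /F !dz // !mul0r addr0.
have [u|u] := boolP (uniq [:: i; ordS i; j; ordS j]); last first.
  have z : nonadj (j - i) = 0 by rewrite nE (negPf u).
  have -> : avg (fun p => edge_cross i j p * edge_dev k p) = 0.
    rewrite -[RHS](@avg_const R n); apply: eq_avg => p.
    by rewrite /edge_cross cross_nuniq ?mul0r.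
  suff -> : F = 0 by rewrite mulr0 sub0r oppr_le0.
  rewrite /F; case: (eqVneq i k) => [<-|/dz->].
    by rewrite z mulr0 add0r n0 mulr0.
  rewrite mul0r add0r; case: (eqVneq j k) => [<-|/dz->]; last by rewrite mul0r.
  by rewrite nonadjC z mulr0.
have ij : i != j by split_uniq u.
have nij : nonadj (j - i) = 1 by rewrite nE u.
case: (eqVneq i k) => [ik|ik].
  suff -> : F = 1 by rewrite -ik main // mulr1 gerBl.
  by rewrite /F -ik nij mulr1 !dE eqxx eq_sym (negPf ij) mul0r addr0.
case: (eqVneq j k) => [jk|jk].
  have -> : avg (fun p => edge_cross i j p * edge_dev k p) = V / ((N - 2) * (N - 3)).
    rewrite -jk -(main j i) => [|]; last by split_uniq u; solve_uniq.
    by apply: eq_avg => p; rewrite edge_crossC.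
  suff -> : F = 1 by rewrite mulr1 gerBl.
  by rewrite /F -jk nonadjC nij mulr1 !dE eqxx (negPf ij) mul0r add0r.
rewrite Fz // mulr0 sub0r.
have low : 1 <= E -> - (B * E) <= avg (fun p => edge_cross i j p * edge_dev k p).
  move=> E1; have := norm_avg_edge_cross_dev i j k; rewrite ler_norml -/B => /andP[+ _].
  by apply: le_trans; rewrite lerN2 ler_peMr.
have dd x y z w : 0 <= delta (x - y) * delta (z - w) by rewrite mulr_ge0 ?delta_ge0.
case: (boolP ((k == ordS i) && (ordS k == j))) => [/andP[/eqP kE /eqP kj]|kij].
  apply: low; rewrite /E (_ : delta (i - _) * _ = 1) ?lerDl //.
  by rewrite !dE -kj kE !ordS_add1 addrK !eqxx mulr1.
case: (boolP ((k == ordS j) && (ordS k == i))) => [/andP[/eqP kE /eqP kj]|kji].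
  apply: low; rewrite /E [X in _ + X](_ : _ = 1) ?lerDr //.
  by rewrite !dE -kj kE !ordS_add1 addrK !eqxx mulr1.
by rewrite avg_edge_cross_dev // oppr_le0.
Qed.

Lemma avg_cycle_cross_dev k :
  avg (fun p => cycle_cross p * edge_dev k p) >= V / (N - 2) - (N - 2) ^+ 2 / 2.
Proof.
have N2 := N2_gt0 R m; have N3 := N3_neq0 R m2.
rewrite [leRHS](@eq_avg _ _ _ (fun p => (\sum_i \sum_j edge_cross i j p * edge_dev k p) / 2)) => [|p]; last first.
  rewrite /cycle_cross mulrAC mulr_suml; congr (_ / _); apply: eq_bigr => i _.
  exact: mulr_suml.
rewrite avgZr avg_sum ler_pdivlMr // (eq_bigr _ (fun i _ => avg_sum _ _)).
apply: le_trans (ler_sum _ (fun i _ => ler_sum _ (fun j _ => avg_edge_cross_dev_ge i j k))).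
have sd x : \sum_j delta (j - x) = 1.
  by rewrite -[RHS](sum_delta x (fun=> 1)); apply: eq_bigr => j _; rewrite mulr1.
have -> : \sum_i \sum_j (V / ((N - 2) * (N - 3)) *
   (delta (i - k) * nonadj (j - k) + delta (j - k) * nonadj (i - k)) -
   (N - 2) ^+ 2 / 2 *
   (delta (i - (k - 1)) * delta (j - (k + 1)) + delta (j - (k - 1)) * delta (i - (k + 1)))) =
  V / ((N - 2) * (N - 3)) * (2 * (N - 3)) - (N - 2) ^+ 2 / 2 * 2.
  transitivity (\sum_i (V / ((N - 2) * (N - 3)) *
     (delta (i - k) * (N - 3) + nonadj (i - k)) -
     (N - 2) ^+ 2 / 2 * (delta (i - (k - 1)) + delta (i - (k + 1))))).
    apply: eq_bigr => i _; rewrite sumrB -!mulr_sumr; congr (_ * _ - _ * _).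
      by rewrite big_split /= -mulr_sumr sum_nonadj1 -mulr_suml sd mul1r.
    by rewrite big_split /= -mulr_sumr -mulr_suml !sd mulr1 mul1r.
  rewrite sumrB -!mulr_sumr; congr (_ * _ - _ * _).
    by rewrite big_split /= -mulr_suml sd sum_nonadj1; ring.
  by rewrite big_split /= !sd.
by rewrite le_eqVlt; apply/orP; left; apply/eqP; field; rewrite natr3E N3 lt0r_neq0.
Qed.

Definition cycle_rest p : R := cycle_cross p - avg cycle_cross - cycle_linear p.

Lemma avg_cycle_linear : avg cycle_linear = 0.
Proof.
rewrite avgZr avg_sum big1 ?mul0r // => i _; exact/avg_chord_dev/neq_ordS.
Qed.

(** The second moment is Var X + E L^2 - 2 E[XL]. The first two have leading term N^3 / 45, and the
    lower bound for E[XL] has the same one, so the cubic terms cancel. *)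
Lemma avg_cycle_rest_sqr : avg (fun p => cycle_rest p ^+ 2) <= 2 * N ^+ 2.
Proof.
have N2 := N2_gt0 R m; have N3 := N3_neq0 R m2.
rewrite (@eq_avg _ _ _ (fun p => (cycle_cross p - avg cycle_cross) ^+ 2 + (cycle_linear p ^+ 2
  - 2 * (cycle_cross p * cycle_linear p)) + 2 * avg cycle_cross * cycle_linear p)) => [|p]; last first.
  by rewrite /cycle_rest; ring.
rewrite !avgD avgN !avgZ avg_cycle_linear mulr0 addr0.
rewrite avg_cycle_cross_sqr // avg_cycle_linear_sqr //.
have : N * (V / (N - 2) - (N - 2) ^+ 2 / 2) / (N - 2) <= avg (fun p => cycle_cross p * cycle_linear p).
  rewrite [leRHS](@eq_avg _ _ _ (fun p => (\sum_i cycle_cross p * edge_dev i p) / (N - 2))) => [|p]; last first.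
    by rewrite -mulr_sumr mulrA.
  rewrite avgZr ler_pM2r ?invr_gt0 // avg_sum.
  apply: le_trans (ler_sum _ (fun k _ => avg_cycle_cross_dev k)).
  by rewrite sumr_const card_ord mulr_natl.
move: (avg _) => C hC.
have N5 : 5 <= N by rewrite ler_nat; case: (m) m2 => [|[]].
have -> : N ^+ 3 / 45 + N ^+ 2 / 90 - N / 3 + (N * V / (N - 2) ^+ 2 - 2 * C) =
   N ^+ 3 / 45 + N ^+ 2 / 90 - N / 3 - N * V / (N - 2) ^+ 2 + N * (N - 2)
   + 2 * (N * (V / (N - 2) - (N - 2) ^+ 2 / 2) / (N - 2) - C).
  by field; rewrite natr3E lt0r_neq0.
(* Polynomial division by N - 2, with remainder -12; it exhibits the cubic term that cancels against
   the variance. *)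
have -> : N * V / (N - 2) ^+ 2 = (N ^+ 3 - 3 * N - 6 - 12 / (N - 2)) / 45.
  by rewrite /chord_var; field; rewrite natr3E lt0r_neq0.
have q : 12 / (N - 2) <= 12 by rewrite ler_pdivrMr //; lra.
have N5N : 5 * N <= N ^+ 2 by rewrite expr2 ler_wpM2r // (le_trans _ N5).
move: hC q N5 N5N; lra.
Qed.

End Remainder.

(** * Concentration of the exchange sums *)

Section Lipschitz.
Variables (R : realFieldType) (m : nat).
Local Notation Z := 'I_m.+3.
Local Notation n := m.+3.
Implicit Types (i j k l x y a b : Z) (p : 'S_n).
Local Notation N := (n%:R : R).
Local Notation cycle_cross := (@cycle_cross R m).
Local Notation edge_cross := (@edge_cross R m).
Local Notation edge_dev := (@edge_dev R m).
Local Notation cycle_linear := (@cycle_linear R m).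

(** A numerical weight: either it is 0 and [tperm k l] fixes both ends of edge i, or it is at least
    1. Its total over i is exactly 4, so bounds weighted by it can be summed. *)
Definition touch i k l : R :=
  (i == k)%:R + (i == l)%:R + ((ordS i == k)%:R + (ordS i == l)%:R).

Lemma touch_ge0 i k l : 0 <= touch i k l.
Proof. by rewrite !addr_ge0. Qed.

Lemma touchP i k l :
  (touch i k l = 0 /\ tperm k l i = i /\ tperm k l (ordS i) = ordS i) \/ 1 <= touch i k l.
Proof.
have := ler0n R (i == k); have := ler0n R (i == l).
have := ler0n R (ordS i == k); have := ler0n R (ordS i == l); rewrite /touch.
case: (eqVneq i k) => [_|ik] /=; first by right; lra.
case: (eqVneq i l) => [_|il] /=; first by right; lra.
case: (eqVneq (ordS i) k) => [_|Sk] /=; first by right; lra.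
case: (eqVneq (ordS i) l) => [_|Sl] /=; first by right; lra.
by left; rewrite !addr0 !tpermD // eq_sym.
Qed.

Lemma sum_eq1 x : \sum_i ((i == x)%:R : R) = 1.
Proof. by rewrite (bigD1 x) //= eqxx big1 ?addr0 // => i /negPf->. Qed.

Lemma sum_ordS_eq1 x : \sum_i ((ordS i == x)%:R : R) = 1.
Proof. by rewrite -[RHS](sum_eq1 x) [RHS](reindex_inj (can_inj (@ordSK _))). Qed.

Lemma sum_eq1r x : \sum_i ((x == i)%:R : R) = 1.
Proof. by rewrite -[RHS](sum_eq1 x); apply: eq_bigr => i _; rewrite eq_sym. Qed.

Lemma sum_touch k l : \sum_i touch i k l = 4.
Proof. by rewrite !big_split /= !sum_eq1 !sum_ordS_eq1; ring. Qed.

Lemma sum_constn (c : R) : \sum_(i : Z) c = N * c.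
Proof. by rewrite sumr_const card_ord mulr_natl. Qed.

Lemma sum_touch2 i : \sum_k \sum_l touch i k l = 4 * N.
Proof.
rewrite (eq_bigr (fun k => N * ((i == k)%:R + (ordS i == k)%:R) + 2)) => [|k _].
  by rewrite big_split /= -mulr_sumr big_split /= !sum_eq1r sum_constn; ring.
by rewrite !big_split /= !sum_eq1r !sum_constn; ring.
Qed.

Lemma edge_dev_diff i k l p :
  `|edge_dev i p - edge_dev i (tperm k l * p)%g| <= touch i k l * ((N - 2) ^+ 2 / 2).
Proof.
have B0 : 0 <= (N - 2) ^+ 2 / 2 by rewrite divr_ge0 ?sqr_ge0.
case: (touchP i k l) => [[-> [ti tSi]]|t1].
  by rewrite /edge_dev chord_dev_tperm ?neq_ordS // ti tSi subrr normr0 mul0r.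
apply: le_trans (ler_peMl B0 t1); rewrite /edge_dev /chord_dev.
have /andP[] := chord_cross_sum_bound R p (neq_ordS i).
have /andP[] := chord_cross_sum_bound R (tperm k l * p)%g (neq_ordS i).
move: (chord_cross_sum _ _ _ _) (chord_cross_sum _ _ _ _) (_ / 2) => x y B ? ? ? ?.
by rewrite ler_norml; apply/andP; split; lra.
Qed.

Lemma cycle_linear_diff k l p :
  `|cycle_linear p - cycle_linear (tperm k l * p)%g| <= 2 * N.
Proof.
have N2 := N2_gt0 R m.
rewrite /cycle_linear -mulrBl -sumrB normrM [`|_^-1|]gtr0_norm ?invr_gt0 //.
rewrite ler_pdivrMr //; apply: le_trans (ler_norm_sum _ _ _) _.
apply: le_trans (ler_sum _ (fun i _ => edge_dev_diff i k l p)) _.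
by rewrite -mulr_suml sum_touch; move: N2; move: (N) => M; nra.
Qed.

Lemma edge_cross_diff i j k l p :
  `|edge_cross i j p - edge_cross i j (tperm k l * p)%g| <= touch i k l + touch j k l.
Proof.
have /andP[e0 e1] := edge_cross_bound R i j p.
have /andP[f0 f1] := edge_cross_bound R i j (tperm k l * p)%g.
have := touch_ge0 i k l; have := touch_ge0 j k l.
have le1 : `|edge_cross i j p - edge_cross i j (tperm k l * p)%g| <= 1.
  by rewrite ler_norml; apply/andP; split; lra.
case: (touchP i k l) => [[-> [ti tSi]]|t1] tj0 ti0; last by lra.
case: (touchP j k l) => [[-> [tj tSj]]|t1]; last by lra.
by rewrite /edge_cross cross_tperm ti tSi tj tSj subrr normr0 addr0.
Qed.

Lemma cycle_cross_diff k l p :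
  `|cycle_cross p - cycle_cross (tperm k l * p)%g| <= 4 * N.
Proof.
rewrite /cycle_cross -mulrBl normrM [`|_^-1|]ger0_norm ?invr_ge0 // ler_pdivrMr // -sumrB.
apply: le_trans (ler_norm_sum _ _ _) _.
apply: (@le_trans _ _ (\sum_i \sum_j (touch i k l + touch j k l))).
  apply: ler_sum => i _; rewrite -sumrB; apply: le_trans (ler_norm_sum _ _ _) _.
  by apply: ler_sum => j _; exact: edge_cross_diff.
rewrite (eq_bigr (fun i => N * touch i k l + 4)) => [|i _].
  by rewrite big_split /= -mulr_sumr sum_touch sum_constn; lra.
by rewrite big_split /= sum_touch sum_constn.
Qed.

(* The transpositions (k l) and (a b) touch no common edge. For given a, b this
   holds for all but O(n) of the n^2 pairs (k, l), which is what brings the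
   constant of exchange_sum_lip down from n^4 to n^3. *)
Definition transp_indep k l a b := forall i, touch i k l * touch i a b = 0.

Lemma transp_indepP k l a b :
  transp_indep k l a b \/ 1 <= \sum_i touch i k l * touch i a b.
Proof.
have t0 i : 0 <= touch i k l * touch i a b by rewrite mulr_ge0 ?touch_ge0.
have [/forallP h|/forallPn[i hi]] := boolP [forall i, touch i k l * touch i a b == 0].
  by left=> i; apply/eqP.
right; rewrite (bigD1 i) //=; apply: (@le_trans _ _ (touch i k l * touch i a b)); last first.
  by rewrite lerDl sumr_ge0.
case: (touchP i k l) hi => [[-> _]|t1]; first by rewrite mul0r eqxx.
case: (touchP i a b) => [[-> _]|t2]; first by rewrite mulr0 eqxx.
by move=> _; rewrite -[1]mulr1 ler_pM.
Qed.

Lemma transp_indep_comm k l a b p : transp_indep k l a b ->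
  (tperm k l * (tperm a b * p) = tperm a b * (tperm k l * p))%g.
Proof.
(* A vertex x moved by both transpositions would make edge x, which starts there, touched by
   both. *)
move=> ind; have neq x y : x = k \/ x = l -> y = a \/ y = b -> x != y.
  move=> xkl yab; apply/eqP => xy; have /eqP := ind x.
  have pos u v w : w = u \/ w = v -> 0 < touch w u v.
    move=> E; have : w == u \/ w == v by case: E => ->; rewrite eqxx; [left|right].
    have := ler0n R (w == u); have := ler0n R (w == v).
    have := ler0n R (ordS w == u); have := ler0n R (ordS w == v); rewrite /touch.
    by move=> ? ? ? ? [] ->; rewrite /=; lra.
  rewrite mulf_eq0 !gt_eqF ?pos //; by rewrite xy.
have E : (tperm a b ^ tperm k l = tperm a b)%g.
  by rewrite tpermJ !tpermD //; apply: neq; auto.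
by rewrite -{1}E conjgE tpermV -!mulgA tpermKg.
Qed.

(** [cycle_linear] is a sum over single edges, and no edge is touched by both transpositions, so its
    mixed second difference vanishes. *)
Lemma cycle_linear_diff2 k l a b p : transp_indep k l a b ->
  cycle_linear (tperm a b * p)%g - cycle_linear (tperm k l * (tperm a b * p))%g =
  cycle_linear p - cycle_linear (tperm k l * p)%g.
Proof.
move=> ind; rewrite /cycle_linear -!mulrBl -!sumrB; congr (_ / _); apply: eq_bigr => i _.
rewrite /edge_dev; case: (touchP i k l) => [[_ [ti tSi]]|t1].
  by rewrite [X in _ - X = _]chord_dev_tperm ?neq_ordS // [in RHS]chord_dev_tperm ?neq_ordS // ti tSi !subrr.
have tab : touch i a b = 0.
  have /eqP := ind i; rewrite mulf_eq0 => /orP[|/eqP//]; rewrite gt_eqF //; lra.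
case: (touchP i a b) => [[_ [ti tSi]]|]; last by rewrite tab ler10.
rewrite transp_indep_comm // ![chord_dev _ _ _ (tperm a b * _)%g]chord_dev_tperm ?neq_ordS //.
by rewrite ti tSi.
Qed.

(** A pair of edges has a mixed difference only if one is touched by (k l) and the other by (a b);
    it is then at most 2, as it combines four numbers of [0, 1]. *)
Lemma edge_cross_diff2 i j k l a b p : transp_indep k l a b ->
  `|(edge_cross i j (tperm a b * p)%g - edge_cross i j (tperm k l * (tperm a b * p))%g) -
    (edge_cross i j p - edge_cross i j (tperm k l * p)%g)| <=
  2 * (touch i k l * touch j a b + touch j k l * touch i a b).
Proof.
move=> ind.
have /andP[? ?] := edge_cross_bound R i j p.
have /andP[? ?] := edge_cross_bound R i j (tperm k l * p)%g.
have /andP[? ?] := edge_cross_bound R i j (tperm a b * p)%g.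
have /andP[? ?] := edge_cross_bound R i j (tperm k l * (tperm a b * p))%g.
have le2 : `|(edge_cross i j (tperm a b * p)%g - edge_cross i j (tperm k l * (tperm a b * p))%g) -
    (edge_cross i j p - edge_cross i j (tperm k l * p)%g)| <= 2.
  by rewrite ler_norml; apply/andP; split; lra.
have z q : touch i q.1 q.2 = 0 -> touch j q.1 q.2 = 0 -> forall p',
    edge_cross i j (tperm q.1 q.2 * p')%g = edge_cross i j p'.
  case: q => u v /= ti tj p'; rewrite /edge_cross cross_tperm.
  case: (touchP i u v) => [[_ [-> ->]]|]; last by rewrite ti ler10.
  by case: (touchP j u v) => [[_ [-> ->]]|]; last by rewrite tj ler10.
have zero : touch i k l = 0 /\ touch j k l = 0 \/ touch i a b = 0 /\ touch j a b = 0 ->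
   (edge_cross i j (tperm a b * p)%g - edge_cross i j (tperm k l * (tperm a b * p))%g) -
    (edge_cross i j p - edge_cross i j (tperm k l * p)%g) = 0.
  move=> [[ti tj]|[ti tj]]; first by rewrite !(z (k, l)) // !subrr.
  by rewrite transp_indep_comm // !(z (a, b)) // subrr.
have z1 (s t : R) : 1 <= s -> s * t = 0 -> t = 0.
  by move=> s1 /eqP; rewrite mulf_eq0 => /orP[/eqP s0|/eqP//]; move: s1; rewrite s0 ler10.
have m1 (x y : R) : 1 <= x -> 1 <= y -> 1 <= x * y by move=> x1 y1; rewrite -[1]mulr1 ler_pM.
have ge0 x y u v w t : 0 <= touch x y u * touch v w t by rewrite mulr_ge0 ?touch_ge0.
have nn := addr_ge0 (ge0 i k l j a b) (ge0 j k l i a b).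
have [hi hj] := (ind i, ind j).
case: (touchP i k l) => [[ti _]|ti]; case: (touchP j k l) => [[tj _]|tj].
- by rewrite zero ?normr0 ?mulr_ge0 //; left.
- have ja := z1 _ _ tj hj.
  case: (touchP i a b) => [[ia _]|ia]; first by rewrite zero ?normr0 ?mulr_ge0 //; right.
  by apply: le_trans le2 _; have := m1 _ _ tj ia; have := ge0 i k l j a b; lra.
- have ia := z1 _ _ ti hi.
  case: (touchP j a b) => [[ja _]|ja]; first by rewrite zero ?normr0 ?mulr_ge0 //; right.
  by apply: le_trans le2 _; have := m1 _ _ ti ja; have := ge0 j k l i a b; lra.
- by rewrite zero ?normr0 ?mulr_ge0 //; right; split; [exact: z1 ti hi|exact: z1 tj hj].
Qed.

Lemma cycle_cross_diff2 k l a b p : transp_indep k l a b ->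
  `|(cycle_cross (tperm a b * p)%g - cycle_cross (tperm k l * (tperm a b * p))%g) -
    (cycle_cross p - cycle_cross (tperm k l * p)%g)| <= 32.
Proof.
move=> ind; rewrite /cycle_cross -!mulrBl normrM [`|_^-1|]ger0_norm ?invr_ge0 // ler_pdivrMr // -!sumrB.
apply: le_trans (ler_norm_sum _ _ _) _.
apply: (@le_trans _ _ (\sum_i \sum_j 2 * (touch i k l * touch j a b + touch j k l * touch i a b))).
  apply: ler_sum => i _; rewrite -!sumrB; apply: le_trans (ler_norm_sum _ _ _) _.
  by apply: ler_sum => j _; exact: edge_cross_diff2.
rewrite (eq_bigr (fun i => 2 * (touch i k l * 4 + 4 * touch i a b))) => [|i _].
  by rewrite -mulr_sumr big_split /= -mulr_suml -mulr_sumr !sum_touch; lra.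
by rewrite -mulr_sumr big_split /= -mulr_sumr -mulr_suml !sum_touch.
Qed.

Variable phi : R -> R.
Hypothesis phi_norm : forall x : R, `|phi x| <= `|x|.

(** [phi] will be the identity for [stein_var] and the absolute value for [stein_abs]: one Lipschitz
    bound serves both. *)
Definition exchange_sum p : R := \sum_k \sum_l
  phi (cycle_linear p - cycle_linear (tperm k l * p)%g) *
  (cycle_cross p - cycle_cross (tperm k l * p)%g).

(** 320 = 64 + 256. An independent pair (k, l) changes by at most 2N * 32, which gives 64 N^3 over
    all pairs. A dependent one changes by at most 2 * (2N * 4N), and the weights [touch] bound their
    number by 4N * 4. *)
Lemma exchange_sum_lip : transp_lip (320 * N ^+ 3) exchange_sum.
Proof.
move=> a b p; rewrite /exchange_sum -sumrB; apply: le_trans (ler_norm_sum _ _ _) _.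
apply: (@le_trans _ _ (\sum_k \sum_l
  (64 * N + 16 * N ^+ 2 * \sum_i touch i k l * touch i a b))); last first.
  rewrite le_eqVlt; apply/orP; left; apply/eqP.
  transitivity (N * (N * (64 * N)) + 16 * N ^+ 2 * \sum_i (4 * N) * touch i a b).
    under eq_bigr do rewrite big_split /= sum_constn -[X in _ + X]mulr_sumr [X in _ + _ * X]exchange_big /=.
    rewrite big_split /= sum_constn -mulr_sumr; congr (_ + _ * _).
    rewrite exchange_big /=; apply: eq_bigr => i _; rewrite -(sum_touch2 i) mulr_suml.
    by apply: eq_bigr => k _; rewrite mulr_suml.
  by rewrite -mulr_sumr sum_touch; ring.
apply: ler_sum => k _; rewrite -sumrB; apply: le_trans (ler_norm_sum _ _ _) _.
apply: ler_sum => l _.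
have N0 : 0 <= N by exact: ler0n.
have L q := le_trans (phi_norm _) (cycle_linear_diff k l q).
case: (transp_indepP k l a b) => [ind|s1].
  rewrite cycle_linear_diff2 // -mulrBr normrM.
  apply: (@le_trans _ _ (2 * N * 32)); first by rewrite ler_pM ?normr_ge0 ?cycle_cross_diff2.
  rewrite big1 ?mulr0; last by move=> i _; exact: ind.
  lra.
apply: (@le_trans _ _ (16 * N ^+ 2)); last first.
  by rewrite -[X in X <= _]add0r lerD ?mulr_ge0 // ler_peMr ?mulr_ge0 ?sqr_ge0.
apply: le_trans (ler_normB _ _) _; rewrite !normrM.
apply: (@le_trans _ _ (2 * N * (4 * N) + 2 * N * (4 * N))); last by lra.
by rewrite lerD // ler_pM ?normr_ge0 ?cycle_cross_diff.
Qed.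

End Lipschitz.

(** * Stein bound *)

Section SteinExchange.
Variables (R : realFieldType) (n : nat).
Implicit Types (p : 'S_n) (k l : 'I_n).

Lemma avg_exchange k l (F : 'S_n -> 'S_n -> R) :
  avg (fun p => F p (tperm k l * p)%g) = avg (fun p => F (tperm k l * p)%g p).
Proof. by rewrite -[LHS](avg_mulg (tperm k l)); apply: eq_avg => p; rewrite tpermKg. Qed.

Variables (W L : 'S_n -> R) (lam : R).
Hypothesis lam_gt0 : 0 < lam.
Hypothesis L_eigen : forall p, \sum_k \sum_l (L p - L (tperm k l * p)%g) = lam * L p.

(** A sum over all pairs, not a mean; [lam] follows the same convention, so the factor n^2 cancels
    in the quotients by [2 * lam]. *)
Definition exch_sum (F : 'S_n -> 'S_n -> R) p : R := \sum_k \sum_l F p (tperm k l * p)%g.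

Definition stein_var p := exch_sum (fun p p' => (L p - L p') * (W p - W p')) p / (2 * lam).
Definition stein_abs p := exch_sum (fun p p' => `|L p - L p'| * (W p - W p')) p / (2 * lam).

Lemma avg_exch_sum F : avg (exch_sum F) = \sum_k \sum_l avg (fun p => F p (tperm k l * p)%g).
Proof. by rewrite avg_sum; apply: eq_bigr => k _; rewrite avg_sum. Qed.

Lemma avg_exch_sumC F : avg (exch_sum F) = avg (exch_sum (fun p p' => F p' p)).
Proof.
by rewrite !avg_exch_sum; apply: eq_bigr => k _; apply: eq_bigr => l _; exact: avg_exchange.
Qed.

Lemma exch_sumD F G p : exch_sum (fun p p' => F p p' + G p p') p = exch_sum F p + exch_sum G p.
Proof. by rewrite -big_split; apply: eq_bigr => k _; rewrite -big_split. Qed.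

Lemma exch_sumB F G p : exch_sum (fun p p' => F p p' - G p p') p = exch_sum F p - exch_sum G p.
Proof. by rewrite -sumrB; apply: eq_bigr => k _; rewrite -sumrB. Qed.

Lemma exch_sumMl (g : 'S_n -> R) F p : exch_sum (fun p p' => g p * F p p') p = g p * exch_sum F p.
Proof. by rewrite mulr_sumr; apply: eq_bigr => k _; rewrite mulr_sumr. Qed.

Lemma exch_sum_norm F G p : (forall p p', `|F p p'| <= G p p') -> `|exch_sum F p| <= exch_sum G p.
Proof.
move=> FG; apply: le_trans (ler_norm_sum _ _ _) _; apply: ler_sum => k _.
by apply: le_trans (ler_norm_sum _ _ _) _; apply: ler_sum => l _.
Qed.

(** [L_eigen] tested against [g (W p)] gives the sum of (L - L') g(W); averaging it with its image
    under the exchange of p and p' produces the difference of g. *)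
Lemma avg_stein (g : R -> R) : avg (fun p => L p * g (W p)) =
  avg (exch_sum (fun p p' => (L p - L p') * (g (W p) - g (W p')))) / (2 * lam).
Proof.
set S := avg _; have lam2 : 2 * lam != 0 by rewrite mulf_neq0 ?lt0r_neq0.
apply: (mulIf lam2); rewrite divfK //.
have E : avg (exch_sum (fun p p' => g (W p) * (L p - L p'))) = lam * S.
  rewrite -avgZ; apply: eq_avg => p; rewrite exch_sumMl {1}/exch_sum L_eigen; ring.
rewrite (@eq_avg _ _ _ (fun p => exch_sum (fun p p' => g (W p) * (L p - L p')) p +
   exch_sum (fun p p' => g (W p') * (L p' - L p)) p)) => [|p]; last first.
  by rewrite -exch_sumD; apply: eq_bigr => k _; apply: eq_bigr => l _; ring.
rewrite avgD -(avg_exch_sumC (fun p p' => g (W p) * (L p - L p'))) E; ring.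
Qed.

Lemma avg_stein_var : avg stein_var = avg (fun p => L p * W p).
Proof. by rewrite avgZr (avg_stein id). Qed.

(** [|L - L'|] is symmetric and W - W' antisymmetric. With mean 0, concentration of [stein_abs]
    bounds its absolute mean directly. *)
Lemma avg_stein_abs : avg stein_abs = 0.
Proof.
rewrite avgZr; set F := (X in exch_sum X); have : avg (exch_sum F) = - avg (exch_sum F).
  rewrite {1}avg_exch_sumC -avgN; apply: eq_avg => p.
  rewrite /exch_sum -sumrN; apply: eq_bigr => k _; rewrite -sumrN; apply: eq_bigr => l _.
  by rewrite /F distrC -mulrN opprB.
by move=> E; rewrite (_ : avg _ = 0) ?mul0r //; move: E; lra.
Qed.

(* The error term is controlled by an increment of K(w) = w f(w) - 1{w <= z}; by
   exchangeability it becomes 2 E[K(W) stein_abs], with no absolute value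
   around W - W'. *)
Lemma stein_bound (z u : R) (f : R -> R) :
  let h (w : R) := w * f w in let I (w : R) : R := (w <= z)%R%:R in let q w := h w + I w - u in
  (forall w, `|f w| <= 4) -> (forall w, `|q w| <= 1) ->
  (forall w, `|h w - I w - (u - 1)| <= 1) ->
  (forall a b, `|f b - f a - (b - a) * q b| <= (b - a) * ((h b - I b) - (h a - I a))) ->
  `|avg (fun p => I (W p)) - u| <= avg (fun p => `|1 - stein_var p|)
     + 4 * avg (fun p => `|W p - L p|) + 2 * avg (fun p => `|stein_abs p|).
Proof.
move=> h I q f4 q1 hI1 fq.
have lam2 : 0 < 2 * lam by rewrite mulr_gt0.
pose T p p' := (L p - L p') * ((W p - W p') * q (W p) - (f (W p) - f (W p'))).
(* Identically I - u = q - h, where q plays the role of f'. Inserting the factor [stein_var] costs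
   the first term, replacing W f(W) by L f(W) the second; [avg_stein] leaves [T], a first-order
   Taylor error. *)
have -> : avg (fun p => I (W p)) - u = avg (fun p => q (W p) * (1 - stein_var p))
    - avg (fun p => (W p - L p) * f (W p)) + avg (exch_sum T) / (2 * lam).
  have E : avg (fun p => q (W p) * stein_var p) - avg (fun p => L p * f (W p)) = avg (exch_sum T) / (2 * lam).
    rewrite avg_stein -[X in _ - X]avgZr -[RHS]avgZr -avgB; apply: eq_avg => p.
    rewrite /stein_var mulrA -mulrBl; congr (_ / _).
    rewrite -(exch_sumMl (fun p => q (W p))) -exch_sumB.
    by apply: eq_bigr => k _; apply: eq_bigr => l _; rewrite /T; ring.
  rewrite -E -[u in LHS](@avg_const R n) -!avgB -!avgD.
  by apply: eq_avg => p; rewrite /q /h; ring.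
have T_bound : `|avg (exch_sum T) / (2 * lam)| <= 2 * avg (fun p => `|stein_abs p|).
  rewrite normrM [`|_^-1|]gtr0_norm ?invr_gt0 // ler_pdivrMr //.
  pose K w := h w - I w - (u - 1).
  pose G p p' := `|L p - L p'| * (W p - W p').
  have TG p p' : `|T p p'| <= K (W p) * G p p' + K (W p') * G p' p.
    rewrite /T normrM.
    apply: (@le_trans _ _ (`|L p - L p'| * ((W p - W p') * (K (W p) - K (W p'))))).
      rewrite ler_wpM2l // -normrN opprB; apply: le_trans (fq (W p') (W p)) _.
      by rewrite le_eqVlt; apply/orP; left; apply/eqP; rewrite /K; ring.
    by rewrite le_eqVlt; apply/orP; left; apply/eqP; rewrite /G (distrC (L p') (L p)); ring.
  apply: le_trans (ler_norm_avg _) _.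
  apply: le_trans (le_avg (fun p => exch_sum_norm p TG)) _.
  rewrite (@eq_avg _ _ _ (fun p => exch_sum (fun p p' => K (W p) * G p p') p +
    exch_sum (fun p p' => K (W p') * G p' p) p)) => [|p]; last by rewrite exch_sumD.
  rewrite avgD -(avg_exch_sumC (fun p p' => K (W p) * G p p')).
  have : avg (exch_sum (fun p p' => K (W p) * G p p')) <= avg (fun p => `|stein_abs p|) * (2 * lam).
    rewrite -avgZr; apply: le_avg => p; rewrite exch_sumMl.
    have -> : exch_sum G p = stein_abs p * (2 * lam) by rewrite divfK ?lt0r_neq0.
    rewrite mulrA ler_pM2r //; apply: le_trans (ler_norm _) _; rewrite normrM.
    by rewrite ler_piMl // hI1.
  by move: (avg _) (avg _) => x y; lra.
have q_bound : `|avg (fun p => q (W p) * (1 - stein_var p))| <= avg (fun p => `|1 - stein_var p|).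
  apply: le_trans (ler_norm_avg _) _; apply: le_avg => p; rewrite normrM.
  by rewrite ler_piMl // q1.
have r_bound : `|avg (fun p => (W p - L p) * f (W p))| <= 4 * avg (fun p => `|W p - L p|).
  apply: le_trans (ler_norm_avg _) _; rewrite -avgZ; apply: le_avg => p; rewrite normrM.
  by rewrite mulrC ler_wpM2r // f4.
apply: le_trans (ler_normD _ _) _; rewrite lerD //.
by apply: le_trans (ler_normB _ _) _; rewrite lerD.
Qed.

End SteinExchange.

(** * The bound for the standardised crossing number, with constants *)

Section CycleStein.
Variables (R : rcfType) (m : nat).
Hypothesis m27 : (27 <= m)%N.
Local Notation n := m.+3.
Implicit Types (p : 'S_n).
Local Notation N := (n%:R : R).
Local Notation X := (@cycle_cross R m).
Local Notation Lin := (@cycle_linear R m).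
Local Notation rest := (@cycle_rest R m).

Definition cycle_sd : R := Num.sqrt (avg (fun p => (X p - avg X) ^+ 2)).
Definition cycle_std p : R := (X p - avg X) / cycle_sd.
Definition cycle_std_linear p : R := Lin p / cycle_sd.

Let m2 : (2 <= m)%N. Proof. exact: leq_trans m27. Qed.

Lemma N_ge30 : 30 <= N.
Proof. by rewrite ler_nat. Qed.

(** N^2 / 90 - N / 3 is nonnegative from N = 30 on: the origin of the threshold. *)
Lemma cycle_var_ge : N ^+ 3 / 45 <= avg (fun p => (X p - avg X) ^+ 2).
Proof.
rewrite avg_cycle_cross_sqr // -addrA lerDl subr_ge0.
have := N_ge30; rewrite expr2; nra.
Qed.

Lemma N3_gt0 : 0 < N ^+ 3 / 45.
Proof. by rewrite divr_gt0 ?exprn_gt0 ?ltr0n. Qed.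

Lemma cycle_sd_gt0 : 0 < cycle_sd.
Proof. by rewrite sqrtr_gt0 (lt_le_trans N3_gt0 cycle_var_ge). Qed.

Lemma cycle_sd_sqr : cycle_sd ^+ 2 = avg (fun p => (X p - avg X) ^+ 2).
Proof. by rewrite sqr_sqrtr // (le_trans (ltW N3_gt0) cycle_var_ge). Qed.

Lemma avg_cycle_std_sqr : avg (fun p => cycle_std p ^+ 2) = 1.
Proof.
rewrite (@eq_avg _ _ _ (fun p => (X p - avg X) ^+ 2 / cycle_sd ^+ 2)) => [|p]; last exact: expr_div_n.
by rewrite avgZr -cycle_sd_sqr divff // sqrf_eq0 gt_eqF // cycle_sd_gt0.
Qed.

(** 2 N^2 over N^3 / 45 is 90 / N, rounded up to 100 / N. *)
Lemma avg_rest_std_sqr :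
  avg (fun p => (cycle_std p - cycle_std_linear p) ^+ 2) <= (10 / Num.sqrt N) ^+ 2.
Proof.
have N0 : 0 < N by rewrite ltr0n.
rewrite (@eq_avg _ _ _ (fun p => rest p ^+ 2 / cycle_sd ^+ 2)) => [|p]; last first.
  by rewrite -expr_div_n /cycle_std /cycle_std_linear -mulrBl.
have s2 : 0 < cycle_sd ^+ 2 by rewrite exprn_gt0 // cycle_sd_gt0.
rewrite avgZr ler_pdivrMr // expr_div_n sqr_sqrtr ?(ltW N0) //.
apply: le_trans (avg_cycle_rest_sqr R m2) _.
rewrite cycle_sd_sqr; apply: (@le_trans _ _ (10 ^+ 2 / N * (N ^+ 3 / 45))).
  rewrite [leRHS](_ : _ = 100 / 45 * N ^+ 2); last by field; rewrite natr3E gt_eqF.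
  by rewrite ler_wpM2r ?sqr_ge0 //; lra.
by apply: ler_wpM2l; [rewrite divr_ge0 ?exprn_ge0 ?(ltW N0)|exact: cycle_var_ge].
Qed.

Lemma cycle_eigen p : \sum_k \sum_l (cycle_std_linear p - cycle_std_linear (tperm k l * p)%g) =
  4 * (N - 1) * cycle_std_linear p.
Proof.
rewrite /cycle_std_linear mulrA -cycle_linear_transp_sum mulr_suml.
by apply: eq_bigr => k _; rewrite mulr_suml; apply: eq_bigr => l _; rewrite mulrBl.
Qed.

(** [poincare] with the constant 320 N^3 gives 320 * 45 / 8 * N / (N - 1) over sqrt N; N >= 30
    bounds 1800 N / (N - 1) by 1870. Homogeneity of [phi] lets the standard deviation be factored
    out. *)
Lemma cycle_exch_dev (phi : R -> R) :
  (forall x : R, `|phi x| <= `|x|) -> (forall c x : R, 0 <= c -> phi (x * c) = phi x * c) ->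
  let F p := exch_sum (fun p p' => phi (cycle_std_linear p - cycle_std_linear p') *
    (cycle_std p - cycle_std p')) p / (2 * (4 * (N - 1))) in
  is_true (avg (fun p => `|F p - avg F|) <= 1870 / Num.sqrt N).
Proof.
move=> phin phiZ F; have N0 : 0 < N by rewrite ltr0n.
have N30 := N_ge30; have s0 := cycle_sd_gt0.
pose c := (8 * (N - 1) * cycle_sd ^+ 2)^-1.
have c0 : 0 <= c by rewrite invr_ge0 mulr_ge0 ?sqr_ge0 //; lra.
have lE p q : cycle_std_linear p - cycle_std_linear q = (Lin p - Lin q) / cycle_sd.
  exact/esym/mulrBl.
have sE p q : cycle_std p - cycle_std q = (X p - X q) / cycle_sd.
  by rewrite -[LHS]mulrBl opprB addrA subrK.
have FE p : F p = exchange_sum phi p * c.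
  rewrite /F /exch_sum /exchange_sum !mulr_suml; apply: eq_bigr => k _.
  rewrite !mulr_suml; apply: eq_bigr => l _.
  rewrite lE sE phiZ ?invr_ge0 ?(ltW s0) //; move: (phi _) (X p - _) => x y.
  by rewrite /c; field; rewrite natr3E !gt_eqF //; lra.
have lip := exchange_sum_lip phin.
have lipF : transp_lip (320 * N ^+ 3 * c) F.
  move=> a b p; rewrite !FE -mulrBl normrM (ger0_norm c0) ler_wpM2r //; exact: lip.
apply: avg_norm_le; first by rewrite divr_ge0 // sqrtr_ge0.
have cc : 0 <= 320 * N ^+ 3 * c by rewrite !mulr_ge0 ?exprn_ge0 // ltW.
apply: le_trans (poincare cc lipF) _.
rewrite [leRHS]expr_div_n [in leRHS]sqr_sqrtr ?(ltW N0) // ler_pdivlMr // mulrAC -expr2 -exprMn.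
rewrite lerXn2r ?nnegrE ?(mulr_ge0 (ltW N0) cc) //.
rewrite mulrA ler_pdivrMr ?mulr_gt0 ?exprn_gt0 //; last by lra.
apply: (@le_trans _ _ (1870 * (8 * (N - 1) * (N ^+ 3 / 45)))).
  have : 0 <= N ^+ 3 by rewrite exprn_ge0 // ltW.
  move: (N ^+ 3) N30 => M; move: (N) => K; nra.
by rewrite ler_wpM2l // ler_wpM2l ?cycle_sd_sqr ?cycle_var_ge //; lra.
Qed.

Lemma cycle_stein (z u : R) (f : R -> R) :
  let h (w : R) := w * f w in let I (w : R) : R := (w <= z)%R%:R in let q w := h w + I w - u in
  (forall w, `|f w| <= 4) -> (forall w, `|q w| <= 1) ->
  (forall w, `|h w - I w - (u - 1)| <= 1) ->
  (forall a b, `|f b - f a - (b - a) * q b| <= (b - a) * ((h b - I b) - (h a - I a))) ->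
  `|avg (fun p => I (cycle_std p)) - u| <= 6270 / Num.sqrt N.
Proof.
move=> h I q f4 q1 hI1 fq; have N0 : 0 < N by rewrite ltr0n.
have N30 := N_ge30.
have lam0 : 0 < 4 * (N - 1) by lra.
have bound := @stein_bound _ _ cycle_std cycle_std_linear _ lam0 cycle_eigen z u f f4 q1 hI1 fq.
have r0 : 0 <= 10 / Num.sqrt N by rewrite divr_ge0 // sqrtr_ge0.
have rest1 := avg_norm_le r0 avg_rest_std_sqr.
have dev1 := @cycle_exch_dev id (fun x => lexx _) (fun c x _ => erefl).
have normZ (c x : R) : 0 <= c -> `|x * c| = `|x| * c by move=> c0; rewrite normrM (ger0_norm c0).
have normn (x : R) : `| `|x| | <= `|x| by rewrite normr_id.
have dev2 := @cycle_exch_dev (@Num.norm R R) normn normZ.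
set SV := stein_var _ _ _ in bound; set SA := stein_abs _ _ _ in bound.
have {}dev1 : avg (fun p => `|SV p - avg SV|) <= 1870 / Num.sqrt N := dev1.
have {}dev2 : avg (fun p => `|SA p - avg SA|) <= 1870 / Num.sqrt N := dev2.
have dev2' : avg (fun p => `|SA p|) <= 1870 / Num.sqrt N.
  by apply: le_trans dev2; apply: le_avg => p; rewrite avg_stein_abs subr0.
(* As E W^2 = 1, 1 - E[LW] = E[(W - L) W]; Cauchy-Schwarz in the form |xy| <= (x^2 / r + r y^2) /
   2. *)
have mean_le (r : R) : 0 < r ->
    avg (fun p => (cycle_std p - cycle_std_linear p) ^+ 2) <= r ^+ 2 -> `|1 - avg SV| <= r.
  move=> rp rr.
  rewrite (@avg_stein_var _ _ cycle_std _ _ lam0 cycle_eigen) -avg_cycle_std_sqr -avgB.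
  rewrite (@eq_avg _ _ _ (fun p => (cycle_std p - cycle_std_linear p) * cycle_std p)) => [|p]; last by ring.
  apply: le_trans (ler_norm_avg _) _.
  apply: (@le_trans _ _ (avg (fun p => ((cycle_std p - cycle_std_linear p) ^+ 2 / r + r * cycle_std p ^+ 2) / 2))).
    apply: le_avg => p; rewrite normrM ler_pdivlMr //.
    move: (cycle_std p) (cycle_std p - _) => y x.
    rewrite -(ler_pM2r rp) mulrDl divfK ?gt_eqF // -[x ^+ 2]real_normK ?num_real // -[y ^+ 2]real_normK ?num_real //.
    by have := sqr_ge0 (`|x| - r * `|y|); rewrite sqrrB exprMn; nra.
  rewrite avgZr avgD avgZr avgZ avg_cycle_std_sqr ler_pdivrMr //.
  have : avg (fun p => (cycle_std p - cycle_std_linear p) ^+ 2) / r <= r by rewrite ler_pdivrMr // -expr2.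
  by lra.
have mean : `|1 - avg SV| <= 10 / Num.sqrt N.
  by apply: mean_le avg_rest_std_sqr; rewrite divr_gt0 // sqrtr_gt0.
have var1 : avg (fun p => `|1 - SV p|) <= 10 / Num.sqrt N + 1870 / Num.sqrt N.
  apply: (@le_trans _ _ (avg (fun p => `|1 - avg SV| + `|SV p - avg SV|))).
    apply: le_avg => p; rewrite [X in _ <= _ + X]distrC; apply: le_trans (ler_normD _ _).
    by rewrite addrA subrK.
  by rewrite avgD avg_const lerD.
(* In units of 1 / sqrt N the total is (10 + 1870) + 4 * 10 + 2 * 1870 = 5660, below 6270. *)
apply: le_trans bound _; move: var1 rest1 dev2' r0.
rewrite -[6270 / _]mulrC -[1870 / _]mulrC -[10 / _]mulrC; move: (_^-1) => t; lra.
Qed.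

End CycleStein.

From mathcomp Require Import all_classical all_reals all_analysis.

Import numFieldNormedType.Exports.

Local Open Scope classical_set_scope.

(** * Solution of Stein's equation *)

Section MeanValue.
Variable R : realType.
Implicit Types (f df : R -> R).

Lemma mvt_bounds f df (a b u v : R) : a <= b ->
  (forall x, a <= x <= b -> is_derive x 1 f (df x)) ->
  (forall x, a <= x <= b -> u <= df x <= v) ->
  u * (b - a) <= f b - f a <= v * (b - a).
Proof.
move=> ab fdf dfuv.
have cf : {within `[a, b], continuous f}.
  apply: derivable_within_continuous => x; rewrite in_itv /= => xab.
  exact: (@ex_derive _ _ _ _ _ _ _ (fdf x xab)).
have [x|c] := @MVT_segment R f df a b ab _ cf.
  by rewrite in_itv /= => /andP[/ltW ax /ltW xb]; apply: fdf; rewrite ax.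
rewrite in_itv /= => /dfuv /andP[uc cv] ->.
by rewrite !ler_wpM2r ?subr_ge0.
Qed.

Lemma derive_ge0_le f df (a b : R) : a <= b ->
  (forall x, a <= x <= b -> is_derive x 1 f (df x)) ->
  (forall x, a <= x <= b -> 0 <= df x) -> f a <= f b.
Proof.
move=> ab fdf df0.
have cf : {within `[a, b], continuous f}.
  apply: derivable_within_continuous => x; rewrite in_itv /= => xab.
  exact: (@ex_derive _ _ _ _ _ _ _ (fdf x xab)).
have [x|c] := @MVT_segment R f df a b ab _ cf.
  by rewrite in_itv /= => /andP[/ltW ax /ltW xb]; apply: fdf; rewrite ax.
rewrite in_itv /= => /df0 c0 E; rewrite -subr_ge0 E mulr_ge0 // subr_ge0 //.
Qed.

End MeanValue.

Section Mills.
Variables (R : realType) (c : R).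
Hypothesis c0 : 0 < c.

Definition gauss (x : R) := c * expR (- (x ^+ 2) / 2).

Lemma gauss_gt0 x : 0 < gauss x.
Proof. by rewrite mulr_gt0 ?expR_gt0. Qed.

Lemma gauss_le x : gauss x <= c.
Proof.
rewrite -[leRHS]mulr1 ler_pM2l // -expR0 ler_expR mulNr oppr_le0.
by rewrite divr_ge0 ?sqr_ge0.
Qed.

Lemma is_derive_half_sqr (x : R) : is_derive x 1 (fun x : R => x ^+ 2 / 2) x.
Proof.
have -> : (fun x : R => x ^+ 2 / 2) = (2^-1 : R) *: (fun x : R => x ^+ 2) :> (R -> R).
  by apply/funext => y; rewrite /= mulrC.
apply: is_derive_eq.
by rewrite -![_ *: _]/(_ * _) mulr1; field.
Qed.

Lemma is_derive_gauss (x : R) : is_derive x 1 gauss (- x * gauss x).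
Proof.
have E : gauss = c *: (expR \o - (fun x : R => x ^+ 2 / 2)) :> (R -> R).
  by apply/funext => y; rewrite /gauss /= mulNr.
rewrite {1}E.
have h := is_derive_half_sqr x.
have h2 : is_derive x 1 (expR \o - (fun x : R => x ^+ 2 / 2)) (expR (- (x ^+ 2 / 2)) * - x).
  apply: is_derive1_comp.
apply: is_derive_eq.
by rewrite -![_ *: _]/(_ * _) /gauss [- (x ^+ 2) / 2]mulNr; ring.
Qed.

Definition mills_inv (x : R) := c^-1 * expR (x ^+ 2 / 2).

Lemma is_derive_mills_inv (x : R) : is_derive x 1 mills_inv (x * mills_inv x).
Proof.
have E : mills_inv = c^-1 *: (expR \o (fun x : R => x ^+ 2 / 2)) :> (R -> R).
  by apply/funext => y.
rewrite {1}E.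
have h := is_derive_half_sqr x.
have h2 : is_derive x 1 (expR \o (fun x : R => x ^+ 2 / 2)) (expR (x ^+ 2 / 2) * x).
  apply: is_derive1_comp.
apply: is_derive_eq.
by rewrite -![_ *: _]/(_ * _) /mills_inv; ring.
Qed.

Lemma gauss_mills_inv x : gauss x * mills_inv x = 1.
Proof.
rewrite /gauss /mills_inv mulrACA divff ?gt_eqF // mul1r -expRD mulNr addNr expR0 //.
Qed.

Lemma mills_inv_gt0 x : 0 < mills_inv x.
Proof. by rewrite mulr_gt0 ?invr_gt0 ?expR_gt0. Qed.

Variable F : R -> R.
Hypothesis dF : forall x : R, is_derive x 1 F (gauss x).
Hypothesis F_ge0 : forall x, 0 <= F x.
Hypothesis F_lim : forall w e : R, 0 < e -> exists2 v, v < w & F v < e.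

Lemma is_derive_inv_neg (x : R) : x < 0 -> is_derive x 1 (fun x : R => x^-1) (- x ^- 2).
Proof.
move=> x0; have h : is_derive x 1 (@id R) 1 by exact: is_derive_id.
have := @is_deriveV _ id x 1 1 (ltr0_neq0 x0) h.
by rewrite -[_ *: _]/(_ * _) mulr1.
Qed.

(* For x < 0, F(x) + gauss(x) / x decreases from its limit 0 at -oo. *)
Lemma mills_upper x : 0 <= x * F x + gauss x.
Proof.
have [x0|x0] := leP 0 x; first by rewrite addr_ge0 ?mulr_ge0 // ltW ?gauss_gt0.
pose g (y : R) := gauss y * y^-1 + F y.
have dg (y : R) : y < 0 -> is_derive y 1 (- g) (gauss y * y ^- 2).
  move=> y0; have h1 := is_derive_gauss y; have h2 := is_derive_inv_neg y0; have h3 := dF y.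
  have E : - g = - ((gauss : R -> R) * (fun y : R => y^-1) + F) by [].
  rewrite E; apply: is_derive_eq; rewrite -![_ *: _]/(_ * _) -exprVn.
  by field; rewrite ltr0_neq0.
suff gx : g x <= 0.
  have : x * g x >= 0 by rewrite mulr_le0 // ltW.
  by rewrite /g mulrDr mulrCA divff ?ltr0_neq0 // mulr1 addrC.
rewrite leNgt; apply/negP => gx.
have [v vx Fv] := F_lim x gx.
have : - g v <= - g x.
  have dgv (y : R) : v <= y <= x -> is_derive y 1 (- g) (gauss y * y ^- 2).
    by move=> /andP[_ yx]; apply: dg; exact: le_lt_trans yx x0.
  apply: (@derive_ge0_le _ (- g) _ v x (ltW vx) dgv) => y _.
  by rewrite mulr_ge0 ?invr_ge0 ?sqr_ge0 // ltW ?gauss_gt0.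
rewrite lerN2 => /(lt_le_trans Fv); rewrite /g ltrDr pmulr_rgt0 ?gauss_gt0 // invr_gt0.
by rewrite ltNge ltW // (lt_trans vx).
Qed.

(** F(x) + x gauss(x) / (1 + x^2) increases from its limit 0 at -oo, with derivative 2 gauss(x) / (1
    + x^2)^2. The inequality is the sign of the derivative of [x * mills x]. *)
Lemma mills_lower x : 0 <= (1 + x ^+ 2) * F x + x * gauss x.
Proof.
have [x0|x0] := leP 0 x.
  by rewrite addr_ge0 ?mulr_ge0 // ?addr_ge0 ?sqr_ge0 // ltW ?gauss_gt0.
have pos (y : R) : 0 < 1 + y ^+ 2 by rewrite ltr_pwDl ?sqr_ge0.
pose g (y : R) := y * gauss y * (1 + y ^+ 2)^-1 + F y.
have dg (y : R) : is_derive y 1 g (2 * gauss y * (1 + y ^+ 2)^-1 ^+ 2).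
  have h1 := is_derive_gauss y; have h3 := dF y.
  have h4 : is_derive y 1 (fun y : R => 1 + y ^+ 2) (2 * y).
    have E : (fun y : R => 1 + y ^+ 2) = cst 1 + (fun y : R => y ^+ 2) :> (R -> R) by [].
    rewrite E; apply: is_derive_eq; rewrite -![_ *: _]/(_ * _); ring.
  have h2 : is_derive y 1 (fun y : R => (1 + y ^+ 2)^-1) (- (1 + y ^+ 2) ^- 2 *: (2 * y)).
    exact: (@is_deriveV _ (fun y : R => 1 + y ^+ 2) y _ 1 (lt0r_neq0 (pos y)) h4).
  have E : g = ((id : R -> R) * (gauss : R -> R)) * (fun y : R => (1 + y ^+ 2)^-1) + F by [].
  rewrite E; apply: is_derive_eq; rewrite -![_ *: _]/(_ * _) -exprVn /=.
  rewrite -[(id * gauss) y]/(y * gauss y); by field; rewrite lt0r_neq0.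
suff gx : 0 <= g x.
  have : 0 <= (1 + x ^+ 2) * g x by rewrite mulr_ge0 // ltW.
  by rewrite /g mulrDr mulrCA divff ?lt0r_neq0 // mulr1 addrC.
rewrite leNgt; apply/negP => gx.
(* As gauss <= c, below -c / |g x| the first term of [g v] already exceeds [g x]; this stands in for
   its limit at -oo. *)
pose v := Num.min x (- (c / - g x)).
have vx : v <= x by rewrite ge_min lexx.
have : g v <= g x.
  apply: (@derive_ge0_le _ g _ v x vx (fun y hy => dg y)) => y hy.
  by rewrite mulr_ge0 ?sqr_ge0 // mulr_ge0 // ltW ?gauss_gt0.
have v0 : v < 0 by exact: le_lt_trans vx x0.
have vg : c / - g x <= - v by rewrite lerNr ge_min lexx orbT.
suff : g x < g v by move=> h1 h2; move: (lt_le_trans h1 h2); rewrite ltxx.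
have Ng : 0 < - g x by rewrite oppr_gt0.
rewrite {2}/g; apply: (@lt_le_trans _ _ (v * gauss v * (1 + v ^+ 2)^-1)); last by rewrite lerDl.
rewrite ltr_pdivlMr //.
move: vg; rewrite ler_pdivrMr // => vg.
have := gauss_le v; have := gauss_gt0 v.
move: (gauss v) (g x) Ng vg v0 => G Y; rewrite oppr_gt0 mulrNN => Y0 vY v0 G0 Gc.
have h1 : v * c <= v * G by rewrite ler_nM2l.
have h2 : v * (v * Y) <= v * c by rewrite ler_nM2l.
by apply: lt_le_trans (le_trans h2 h1); nra.
Qed.

(** The Mills ratio of the left tail: the solution of f' = 1 + x f that stays bounded at -oo. *)
Definition mills (x : R) := F x * mills_inv x.

Lemma mills_ge0 x : 0 <= mills x.
Proof. by rewrite mulr_ge0 // ltW ?mills_inv_gt0. Qed.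

Lemma mills_geN1 x : -1 <= x * mills x.
Proof.
have -> : x * mills x = (x * F x + gauss x) * mills_inv x - 1.
  by rewrite mulrDl gauss_mills_inv /mills mulrA addrK.
by rewrite lerBrDl subrr mulr_ge0 ?mills_upper // ltW ?mills_inv_gt0.
Qed.

Lemma is_derive_mills (x : R) : is_derive x 1 mills (1 + x * mills x).
Proof.
have h1 := dF x; have h2 := is_derive_mills_inv x.
have E : mills = (F : R -> R) * (mills_inv : R -> R) by [].
rewrite {1}E; apply: is_derive_eq; rewrite -![_ *: _]/(_ * _).
by rewrite [mills_inv x * _]mulrC gauss_mills_inv /mills; ring.
Qed.

Lemma mills_homo (x y : R) : x <= y -> x * mills x <= y * mills y.
Proof.
move=> xy; pose g (x : R) := x * mills x.
apply: (@derive_ge0_le _ g (fun x => ((1 + x ^+ 2) * F x + x * gauss x) * mills_inv x) x y xy).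
  move=> w _; have h := is_derive_mills w.
  have E : g = (id : R -> R) * (mills : R -> R) by [].
  rewrite E; apply: is_derive_eq; rewrite -![_ *: _]/(_ * _) mulrDl -[w * gauss w * _]mulrA gauss_mills_inv.
  by rewrite /mills /=; ring.
by move=> w _; rewrite mulr_ge0 ?mills_lower // ltW ?mills_inv_gt0.
Qed.

End Mills.

Section SteinSolution.
Variables (R : realType) (c : R).
Hypothesis c0 : 0 < c.
Local Notation gauss := (gauss c).
Local Notation mills_inv := (mills_inv c).
Variable Phi : R -> R.
Hypothesis dPhi : forall x : R, is_derive x 1 Phi (gauss x).
Hypothesis Phi01 : forall x, 0 <= Phi x <= 1.
Hypothesis Phi_Ny : forall w e : R, 0 < e -> exists2 v, v < w & Phi v < e.
Hypothesis Phi_y : forall w e : R, 0 < e -> exists2 v, w < v & 1 - Phi v < e.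

(** The upper tail read backwards. As the density is even, it satisfies the same hypotheses as
    [Phi], so the facts on left tails also serve to the right of [z]. *)
Definition Psi (x : R) := 1 - Phi (- x).

Lemma is_derive_Psi (x : R) : is_derive x 1 Psi (gauss x).
Proof.
have h : is_derive x 1 (Phi \o -%R) (gauss (- x) * - 1).
  apply: is_derive1_comp.
have E : Psi = cst 1 - (Phi \o -%R) by [].
rewrite E; apply: is_derive_eq.
by rewrite /gauss sqrrN; ring.
Qed.

Lemma Psi_ge0 x : 0 <= Psi x.
Proof. by rewrite subr_ge0; case/andP: (Phi01 (- x)). Qed.

Lemma Psi_Ny (w e : R) : 0 < e -> exists2 v, v < w & Psi v < e.
Proof.
move=> /(Phi_y (- w))[v wv ve]; exists (- v); first by rewrite ltrNl.
by rewrite /Psi opprK.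
Qed.

Let Phi_ge0 x : 0 <= Phi x. Proof. by case/andP: (Phi01 x). Qed.

Variable z : R.
Local Notation u := (Phi z).

(** The two branches of the classical solution of f'(w) - w f(w) = 1{w <= z} - u, the right one
    written through the reflected tail. *)
Definition stein_left (w : R) := (1 - u) * mills c Phi w.
Definition stein_right (w : R) := u * mills c Psi (- w).

Lemma stein_glue : stein_left z = stein_right z.
Proof.
by rewrite /stein_left /stein_right /mills /Psi opprK /mills_inv sqrrN; ring.
Qed.

Let u0 : 0 <= u. Proof. exact: Phi_ge0. Qed.
Let u1 : 0 <= 1 - u. Proof. by rewrite subr_ge0; case/andP: (Phi01 z). Qed.

Lemma stein_left_homo x y : x <= y -> x * stein_left x <= y * stein_left y.
Proof.
move=> xy; rewrite /stein_left !(mulrCA _ (1 - u)) ler_wpM2l //.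
exact: (mills_homo c0 dPhi Phi_ge0).
Qed.

Lemma stein_right_homo x y : x <= y -> x * stein_right x <= y * stein_right y.
Proof.
move=> xy; rewrite /stein_right !(mulrCA _ u) ler_wpM2l //.
rewrite -lerN2 -!mulNr; apply: (mills_homo c0 is_derive_Psi Psi_ge0).
by rewrite lerN2.
Qed.

Lemma stein_left_ge x : u - 1 <= x * stein_left x.
Proof.
rewrite /stein_left mulrCA -[leLHS]opprB -mulrN1 ler_wpM2l //.
exact: (mills_geN1 c0 dPhi Phi_ge0 Phi_Ny).
Qed.

Lemma stein_right_le x : x * stein_right x <= u.
Proof.
rewrite /stein_right mulrCA -[leRHS]mulr1 ler_wpM2l // -lerN2 -mulNr.
exact: (mills_geN1 c0 is_derive_Psi Psi_ge0 Psi_Ny).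
Qed.

Lemma is_derive_stein_left (x : R) : is_derive x 1 stein_left (x * stein_left x + (1 - u)).
Proof.
have h := is_derive_mills c0 dPhi x.
have E : stein_left = (1 - u) *: (mills c Phi : R -> R) by [].
rewrite {1}E; apply: is_derive_eq; rewrite -![_ *: _]/(_ * _) /stein_left; ring.
Qed.

Lemma is_derive_stein_right (x : R) : is_derive x 1 stein_right (x * stein_right x - u).
Proof.
have h : is_derive x 1 (mills c Psi \o -%R) ((1 + (- x) * mills c Psi (- x)) * - 1).
  have h' := is_derive_mills c0 is_derive_Psi (- x).
  apply: is_derive1_comp.
have E : stein_right = u *: (mills c Psi \o -%R : R -> R) by [].
rewrite {1}E; apply: is_derive_eq; rewrite -![_ *: _]/(_ * _) /stein_right; ring.
Qed.

Lemma stein_left_mvt (a b : R) : a <= b ->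
  (a * stein_left a + (1 - u)) * (b - a) <= stein_left b - stein_left a
    <= (b * stein_left b + (1 - u)) * (b - a).
Proof.
move=> ab; apply: mvt_bounds ab (fun x _ => is_derive_stein_left x) _ => x /andP[ax xb].
by rewrite !lerD2r !stein_left_homo.
Qed.

Lemma stein_right_mvt (a b : R) : a <= b ->
  (a * stein_right a - u) * (b - a) <= stein_right b - stein_right a
    <= (b * stein_right b - u) * (b - a).
Proof.
move=> ab; apply: mvt_bounds ab (fun x _ => is_derive_stein_right x) _ => x /andP[ax xb].
by rewrite !lerD2r !stein_right_homo.
Qed.

Definition stein_sol (w : R) := if w <= z then stein_left w else stein_right w.

Local Notation h := (fun w : R => w * stein_sol w).
Local Notation I := (fun w : R => (w <= z)%R%:R : R).

Lemma stein_sol_homo x y : x <= y -> h x <= h y.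
Proof.
rewrite /stein_sol; case: (leP x z) => xz; case: (leP y z) => yz xy.
- exact: stein_left_homo.
- apply: le_trans (stein_left_homo xz) _; rewrite stein_glue.
  exact/stein_right_homo/ltW.
- by have := lt_le_trans xz (le_trans xy yz); rewrite ltxx.
- exact: stein_right_homo.
Qed.

Lemma stein_sol_bounds x : u - 1 <= h x <= u.
Proof.
have hz : h z = z * stein_left z by rewrite /stein_sol lexx.
case: (leP x z) => xz; apply/andP; split.
- by rewrite /stein_sol xz stein_left_ge.
- by apply: le_trans (stein_sol_homo xz) _; rewrite hz stein_glue stein_right_le.
- by apply: le_trans (stein_sol_homo (ltW xz)); rewrite hz stein_left_ge.
- by rewrite /stein_sol (leNgt x z) xz /= stein_right_le.
Qed.

Lemma stein_sol_deriv w : `|h w + I w - u| <= 1.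
Proof.
have /andP[h1 h2] := stein_sol_bounds w; move: h1 h2; move: (h w) u0 u1 => k.
by case: (w <= z) => /=; rewrite ler_norml => ? ? ? ?; apply/andP; split; lra.
Qed.

Lemma stein_sol_shift w : `|h w - I w - (u - 1)| <= 1.
Proof.
have /andP[h1 h2] := stein_sol_bounds w; move: h1 h2; move: (h w) u0 u1 => k.
by case: (w <= z) => /=; rewrite ler_norml => ? ? ? ?; apply/andP; split; lra.
Qed.

Lemma I_homo x y : x <= y -> I y <= I x.
Proof. by move=> xy; rewrite ler_nat; case: (leP y z) => // /(le_trans xy) ->. Qed.

(** Off z the derivative is h + I - u with h increasing and I decreasing, so on an interval it
    differs from its value at an end by at most the growth of h plus the drop of I. It jumps at z,
    hence mean value bounds on either side, glued by [stein_glue]. For b < a both factors on the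
    right change sign. *)
Lemma stein_sol_incr a b :
  `|stein_sol b - stein_sol a - (b - a) * (h b + I b - u)| <=
  (b - a) * ((h b - I b) - (h a - I a)).
Proof.
have fwd x y : x <= y ->
  (x * stein_sol x + I x - u) * (y - x) - (y - x) * (I x - I y) <= stein_sol y - stein_sol x
    <= (y * stein_sol y + I y - u) * (y - x) + (y - x) * (I x - I y).
  move=> xy; have hxy := stein_sol_homo xy; rewrite /stein_sol in hxy *.
  case: (leP x z) hxy => xz; case: (leP y z) => yz /= hxy.
  - have := stein_left_mvt xy; lra.
  - have /andP[l1 l2] := stein_left_mvt xz; have /andP[r1 r2] := stein_right_mvt (ltW yz).
    have := stein_left_homo xz; have := stein_right_homo (ltW yz).
    rewrite -stein_glue in r1 r2 *; move: l1 l2 r1 r2.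
    move: (stein_left x) (stein_left z) (stein_right y) => fx fz fy.
    have yz0 : 0 <= y - z by rewrite subr_ge0 ltW.
    have zx0 : 0 <= z - x by rewrite subr_ge0.
    move: u0 u1 => ? ? l1 l2 r1 r2 k1 k2.
    have := mulr_ge0 yz0 (_ : 0 <= z * fz - x * fx); rewrite subr_ge0 => /(_ k2).
    have := mulr_ge0 zx0 (_ : 0 <= y * fy - z * fz); rewrite subr_ge0 => /(_ k1).
    by move=> p1 p2; apply/andP; split; nra.
  - by have := lt_le_trans xz (le_trans xy yz); rewrite ltxx.
  - have := stein_right_mvt xy; lra.
have [ab|ba] := leP a b.
  have /andP[] := fwd _ _ ab; have d0 : 0 <= b - a by rewrite subr_ge0.
  have := mulr_ge0 d0 (_ : 0 <= h b - h a); rewrite subr_ge0 => /(_ (stein_sol_homo ab)).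
  have := mulr_ge0 d0 (_ : 0 <= I a - I b); rewrite subr_ge0 => /(_ (I_homo ab)).
  rewrite ler_norml; move: (h a) (h b) (stein_sol a) (stein_sol b) (I a) (I b) (b - a) u.
  by move=> ha hb fa fb Ia Ib d U *; apply/andP; split; lra.
have /andP[] := fwd _ _ (ltW ba); have d0 : 0 <= a - b by rewrite subr_ge0 ltW.
have := mulr_ge0 d0 (_ : 0 <= h a - h b); rewrite subr_ge0 => /(_ (stein_sol_homo (ltW ba))).
have := mulr_ge0 d0 (_ : 0 <= I b - I a); rewrite subr_ge0 => /(_ (I_homo (ltW ba))).
rewrite -(opprB a b) ler_norml.
move: (h a) (h b) (stein_sol a) (stein_sol b) (I a) (I b) (a - b) u.
by move=> ha hb fa fb Ia Ib d U *; apply/andP; split; lra.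
Qed.

(** For |w| >= 1 the bound |w f(w)| <= 1 suffices. Otherwise [stein_sol_incr] from 1 or -1, at
    distance at most 1, gives 1 + 1 + 2. *)
Lemma stein_sol_le w : `|stein_sol w| <= 4.
Proof.
have f0 x : 0 <= stein_sol x.
  rewrite /stein_sol; case: ifP => _; apply: mulr_ge0 => //.
    exact: (mills_ge0 c0 Phi_ge0).
  exact: (mills_ge0 c0 Psi_ge0).
have far x : 1 <= `|x| -> stein_sol x <= 1.
  move=> x1; have : `|h x| <= 1.
    have /andP[h1 h2] := stein_sol_bounds x; move: h1 h2; move: (h x) u0 u1 => k ? ? ? ?.
    by rewrite ler_norml; apply/andP; split; lra.
  by rewrite normrM (ger0_norm (f0 x)) => /(le_trans _); apply; rewrite ler_peMl.
rewrite (ger0_norm (f0 w)); have [w1|w1] := leP 1 `|w|; first by apply: le_trans (far _ w1) _; lra.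
have near a : `|w - a| <= 1 -> 1 <= `|a| -> stein_sol w <= 4.
  move=> wa a1; have fa := far a a1; have inc := stein_sol_incr a w.
  have b1 : `|(w - a) * (h w + I w - u)| <= 1.
    by rewrite normrM -[leRHS]mulr1 ler_pM ?normr_ge0 ?stein_sol_deriv.
  have b2 : `|(w - a) * (h w - I w - (h a - I a))| <= 2.
    rewrite normrM -[leRHS]mul1r ler_pM ?normr_ge0 //.
    have := stein_sol_shift w; have := stein_sol_shift a.
    by rewrite !ler_norml => /andP[? ?] /andP[? ?]; apply/andP; split; lra.
  by move: b1 b2 inc; rewrite !ler_norml => /andP[? ?] /andP[? ?] /andP[? ?]; lra.
move: w1; rewrite ltr_norml => /andP[w1 w2].
have [w0|w0] := leP 0 w.
  apply: (near 1); last by rewrite normr1.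
  by rewrite ler_norml; apply/andP; split; lra.
apply: (near (-1)); last by rewrite normrN1.
by rewrite ler_norml; apply/andP; split; lra.
Qed.

End SteinSolution.

(** * Uniform random permutations and the normal distribution *)

Section UniformPermutation.
Variables (R : realType) (n : nat) (d : measure_display) (T : measurableType d).
Variables (P : probability T R) (s : T -> 'S_n).
Hypothesis hs : uniform_permutation P s.

(** Measurability is known for the fibres of [s], so functions of [s] are expanded in the indicators
    of its n! fibres. *)
Lemma indic_fibre (F : 'S_n -> R) w :
  F (s w) = \sum_(t : 'S_n) F t * \1_(s @^-1` [set t]) w.
Proof.
rewrite (bigD1 (s w)) //= indicE mem_set // mulr1 big1 ?addr0 // => t ts.
by rewrite indicE memNset ?mulr0 //= => /esym/eqP; rewrite (negPf ts).
Qed.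

Lemma expectation_perm (F : 'S_n -> R) : ('E_P[F \o s] = (avg F)%:E)%E.
Proof.
rewrite unlock; transitivity (\int[P]_w \sum_(t : 'S_n) (F t * \1_(s @^-1` [set t]) w)%:E)%E.
  by apply: eq_integral => w _ /=; rewrite indic_fibre sumEFin.
have int1 t : P.-integrable setT (fun w => (\1_(s @^-1` [set t]) w)%:E).
  apply: integrable_indic => //; exact: (hs t).1.
rewrite integral_sum //; last first.
  move=> t; have := integrableZl measurableT (F t) (int1 t).
  by apply: eq_integrable => // w _; rewrite /= EFinM.
rewrite (eq_bigr (fun t => (F t * (n`!)%:R^-1)%:E)) => [|t _].
  by rewrite sumEFin -mulr_suml.
have [mt Pt] := hs t.
under eq_integral do rewrite EFinM.
rewrite integralZl // EFinM; congr (_ * _)%E.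
by rewrite integral_indic // setIT; exact: Pt.
Qed.

Lemma probability_perm (B : pred 'S_n) :
  P [set w | B (s w)] = (avg (fun t => (B t)%:R : R))%:E.
Proof.
have mA : measurable [set w | B (s w)].
  have -> : [set w | B (s w)] = \bigcup_(t in [set t | B t]) (s @^-1` [set t]).
    apply/seteqP; split=> [w Bw|w [t Bt st]]; first by exists (s w).
    by rewrite /= (st : s w = t).
  apply: fin_bigcup_measurable => [|t _]; last exact: (hs t).1.
  exact: finite_finset.
transitivity (\int[P]_w (\1_[set w | B (s w)] w)%:E)%E; first by rewrite integral_indic // setIT.
rewrite -expectation_perm unlock.
apply: eq_integral => w _; rewrite /= indicE.
have -> // : (w \in [set w | B (s w)]) = B (s w).
by apply/idP/idP; [move/set_mem|move=> ?; exact/mem_set].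
Qed.

Lemma variance_perm (F : 'S_n -> R) :
  ('V_P[F \o s] = (avg (fun p => (F p - avg F) ^+ 2))%:E)%E.
Proof.
rewrite /variance unlock expectation_perm /= -expectation_perm; congr ('E_P[_])%E.
Qed.

End UniformPermutation.

Section NormalCdf.
Variables (R : realType) (d' : measure_display) (T' : measurableType d').
Variables (Q : probability T' R) (Z : {RV Q >-> R}).
Hypothesis hZ : standard_normal Z.

Definition normal_cdf (x : R) : R := fine (cdf Z x).

Lemma cdf_fin x : cdf Z x = (normal_cdf x)%:E.
Proof. by rewrite /normal_cdf fineK // fin_num_measure. Qed.

Lemma normal_cdf01 x : 0 <= normal_cdf x <= 1.
Proof. by rewrite -!lee_fin -cdf_fin cdf_ge0 cdf_le1. Qed.

Lemma normal_cdf_Ny (w e : R) : 0 < e -> exists2 v, v < w & normal_cdf v < e.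
Proof.
move=> e0; have /fine_cvgP[_] := cvg_cdfNy0 Z.
move=> /cvgrPdist_lt /(_ e e0) [M [_ hM]].
exists (Num.min (M - 1) (w - 1)); first by rewrite gt_min [w - 1 < w]gtrBl ltr01 orbT.
have := hM (Num.min (M - 1) (w - 1)); rewrite /= gt_min [M - 1 < M]gtrBl ltr01 => /(_ isT).
by rewrite sub0r normrN => /(le_lt_trans (ler_norm _)).
Qed.

Lemma normal_cdf_y (w e : R) : 0 < e -> exists2 v, w < v & 1 - normal_cdf v < e.
Proof.
move=> e0; have /fine_cvgP[_] := cvg_cdfy1 Z.
move=> /cvgrPdist_lt /(_ e e0) [M [_ hM]].
exists (Num.max (M + 1) (w + 1)); first by rewrite lt_max [w < w + 1]ltrDl ltr01 orbT.
have := hM (Num.max (M + 1) (w + 1)); rewrite /= lt_max [M < M + 1]ltrDl ltr01 => /(_ isT).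
by apply: le_lt_trans; exact: ler_norm.
Qed.

Lemma normal_pdfE01 (x : R) : normal_pdf 0 1 x = gauss (normal_peak 1) x.
Proof.
by rewrite normal_pdfE ?oner_neq0 // /normal_fun subr0 expr1n /gauss.
Qed.

Lemma is_derive_normal_cdf (x : R) : is_derive x 1 normal_cdf (gauss (normal_peak 1) x).
Proof.
have E : normal_cdf = fun x : R => (\int[lebesgue_measure]_(t in `]-oo, x]) normal_pdf 0 1 t)%R.
  apply/funext => y; rewrite /normal_cdf /cdf hZ //.
have xx : x < x + 1 by rewrite ltrDl.
have [] := @continuous_FTC1 R (normal_pdf 0 1) (BInfty _ true) x (x + 1) xx _ _ _.
- by apply: (integrableS measurableT) => //; exact: integrable_normal_pdf.
- by rewrite ltNyr.
- by apply: continuous_normal_pdf; exact: oner_neq0.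
move=> h hE; rewrite E -normal_pdfE01.
rewrite -hE.
rewrite derive1E.
exact: derivableP.
Qed.

End NormalCdf.

(** * From quadruples of vertices to pairs of edges *)

Section CrossingsCount.
Variable m : nat.
Local Notation Z := 'I_m.+3.
Local Notation n := m.+3.

(** The two conditions exclude each other because 2 is nonzero modulo n >= 3. *)
Lemma cycle_graphE (a b : Z) :
  cycle_graph n a b = ((b == ordS a) + (a == ordS b))%N :> nat.
Proof.
rewrite /cycle_graph; case: (eqVneq b (ordS a)) => [->|_] //=.
suff -> : (a == ordS (ordS a)) = false by [].
rewrite !ordS_add1 eq_sym -subr_eq0 (_ : _ - a = 2%:~R) ?Zp_int_eq0 //; ring.
Qed.

Lemma sum_cycle_graph (G : Z -> Z -> nat) :
  (\sum_a \sum_b cycle_graph n a b * G a b = \sum_i (G i (ordS i) + G (ordS i) i))%N.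
Proof.
transitivity (\sum_a \sum_b (b == ordS a) * G a b + \sum_a \sum_b (a == ordS b) * G a b)%N.
  rewrite -big_split; apply: eq_bigr => a _; rewrite -big_split; apply: eq_bigr => b _.
  by rewrite cycle_graphE mulnDl.
rewrite big_split; congr (_ + _)%N.
  apply: eq_bigr => a _; rewrite (bigD1 (ordS a)) //= eqxx mul1n big1 ?addn0 //.
  by move=> b /negPf ->.
rewrite exchange_big /=; apply: eq_bigr => b _.
rewrite (bigD1 (ordS b)) //= eqxx mul1n big1 ?addn0 //.
by move=> a /negPf ->.
Qed.

(** [K i j] holds the four quadruples of [chords_cross_desc] that list edge i first, so
    [K i j + K j i] is the crossing indicator. Symmetrising the double sum doubles it, which matches
    the factor 1/2 of [cycle_cross]. *)
Lemma card_crossings (R : realFieldType) (s : 'S_n) :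
  (#|crossings (cycle_graph n) s|)%:R = cycle_cross R s.
Proof.
pose D a b c d : nat := desc (s a) (s b) (s c) (s d).
pose K i j := (D i (ordS i) j (ordS j) + D i (ordS i) (ordS j) j +
  (D (ordS i) i j (ordS j) + D (ordS i) i (ordS j) j))%N.
have -> : #|crossings (cycle_graph n) s| = (\sum_i \sum_j K i j)%N.
  transitivity (\sum_a \sum_b cycle_graph n a b * \sum_c \sum_d cycle_graph n c d * D a b c d)%N.
    rewrite -sum1_card big_mkcond /=.
    under [RHS]eq_bigr do under eq_bigr do rewrite big_distrr /=.
    under [RHS]eq_bigr do under eq_bigr do under eq_bigr do rewrite big_distrr /=.
    rewrite pair_bigA /= pair_bigA /= pair_bigA /=; apply: eq_bigr => -[[[a b] c] d] _ /=.
    rewrite inE /D /desc /=.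
    by case: (cycle_graph n a b) => //=; case: (cycle_graph n c d) => //=; case: ifP.
  rewrite sum_cycle_graph; apply: eq_bigr => i _.
  by rewrite !sum_cycle_graph -big_split.
rewrite /cycle_cross; apply: (mulIf (_ : 2 != 0 :> R)); rewrite ?pnatr_eq0 // divfK ?pnatr_eq0 //.
transitivity ((\sum_i \sum_j K i j + \sum_i \sum_j K j i)%N%:R : R).
  by rewrite [X in (_ + X)%N]exchange_big /= addnn -muln2 natrM.
rewrite -big_split natr_sum; apply: eq_bigr => i _; rewrite -big_split natr_sum.
apply: eq_bigr => j _ /=; rewrite /edge_cross /cross chords_cross_desc /K /D; congr (_%:R).
by rewrite !addnA.
Qed.

End CrossingsCount.

Theorem mainTheorem11 (R : realType) (n : nat) (hn : (3 <= n)%N)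
    (d : measure_display) (T : measurableType d) (P : probability T R)
    (s : T -> 'S_n) (hs : uniform_permutation P s)
    (d' : measure_display) (T' : measurableType d') (Q : probability T' R)
    (Z : {RV Q >-> R}) (hZ : standard_normal Z) :
  let X : T -> R := fun w => (#|crossings (cycle_graph n) (s w)|)%:R in
  let W : T -> R := standardization P X in
  [/\ ('E_P[X] = (n%:R * (n%:R - 3) / 6)%:E)%E,
      (5 <= n)%N ->
        ('V_P[X] = (n%:R ^+ 3 / 45 + n%:R ^+ 2 / 90 - n%:R / 3)%:E)%E
    & (kolmogorov_dist P Q W Z <= (6270 / Num.sqrt n%:R)%:E)%E].
Proof.
case: n hn s hs => [|[|[|m]]] // _ s hs X W.
have XE : X = cycle_cross R (m := m) \o s.
  by apply/funext => w; rewrite /X card_crossings.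
have EX : ('E_P[X] = (avg (cycle_cross R (m := m)))%:E)%E by rewrite XE expectation_perm.
have VX := variance_perm hs (cycle_cross R (m := m)); rewrite -XE in VX.
split.
- by rewrite EX avg_cycle_cross.
- by rewrite !ltnS => m2; rewrite VX avg_cycle_cross_sqr.
apply: ub_ereal_sup => _ [x _ <-].
have WE w : W w = cycle_std R (s w) by rewrite /W /standardization EX VX XE.
have -> : P [set w | (W w <= x)%R] =
    (avg (fun p : 'S_m.+3 => (cycle_std R p <= x)%R%:R : R))%:E.
  rewrite -(probability_perm hs (fun p => cycle_std R p <= x)); congr (P _).
  by apply/funext => w; rewrite /= WE.
have -> : Q [set w | (Z w <= x)%R] = (normal_cdf Z x)%:E.
  by rewrite -cdf_fin.
rewrite -EFinB abse_EFin lee_fin.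
have [m27|m27] := leqP 27 m.
  have c0 : 0 < normal_peak 1 :> R by rewrite normal_peak_gt0 // oner_neq0.
  have dPhi := is_derive_normal_cdf hZ.
  have Phi01 := @normal_cdf01 R d' T' Q Z.
  have h1 := normal_cdf_Ny Z; have h2 := normal_cdf_y Z.
  apply: (@cycle_stein R m m27 x (normal_cdf Z x) (stein_sol (normal_peak 1) (normal_cdf Z) x)).
  - by move=> w; exact: stein_sol_le.
  - by move=> w; exact: stein_sol_deriv.
  - by move=> w; exact: stein_sol_shift.
  - by move=> a b; exact: stein_sol_incr.
have N0 : 0 < (m.+3)%:R :> R by rewrite ltr0n.
(* Two probabilities differ by at most 1. This covers n = 3, where the variance is 0 and the
   standardisation is the zero function. *)
apply: (@le_trans _ _ 1).
  have /andP[p0 p1] := normal_cdf01 Z x.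
  have a0 : 0 <= avg (fun p : 'S_m.+3 => (cycle_std R p <= x)%R%:R : R).
    by apply: avg_ge0 => p; exact: ler0n.
  have a1 : avg (fun p : 'S_m.+3 => (cycle_std R p <= x)%R%:R : R) <= 1.
    by rewrite -[leRHS](@avg_const R m.+3); apply: le_avg => p; rewrite lern1 leq_b1.
  by rewrite ler_norml; apply/andP; split; lra.
rewrite ler_pdivlMr ?sqrtr_gt0 // mul1r.
have [K K30 ->] : exists2 K : R, 30 <= K & 6270 = K by exists 6270; rewrite // ler_nat.
have K0 : 0 <= K by lra.
rewrite -[leRHS]ger0_norm // -sqrtr_sqr ler_sqrt ?sqr_ge0 //.
have N30 : (m.+3)%:R <= 30 :> R by rewrite ler_nat !ltnS ltnW.
by rewrite (le_trans N30) // (le_trans K30) // expr2 ler_peMr //; lra.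
Qed.
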